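(* Let $A:\mathbb{R}\to\mathrm{GL}(N,\mathbb{R})$ be a smooth, faithful and closed representation such that for every $t\ne 0$ the matrix $A(t)$ has no eigenvalue of absolute value $1$, and let $\rho:\mathbb{R}^N\rtimes_A\mathbb{R}\to\mathrm{GL}(N+1,\mathbb{C})$, $\rho(b,t)=\begin{pmatrix}A(t)&b\\0&1\end{pmatrix}$. Let $G\subset\mathrm{PSL}(N+1,\mathbb{C})$ be a Lie group admitting a lift $\tilde G\subset\mathrm{GL}(N+1,\mathbb{C})$ with $\sigma^{-1}\tilde G\sigma=\rho(\mathbb{R}^N\rtimes_A\mathbb{R})$ for some $\sigma\in\mathrm{GL}(N+1,\mathbb{C})$, and suppose that $G$ admits a lattice $\Gamma$. Let $\Omega_1,\Omega_2\subset\mathbb{P}^N_{\mathbb{C}}$ be the open sets defined in the context. Then each $\Omega_i$ is a maximal $\Gamma$-invariant open set on which $\Gamma$ acts properly discontinuously, and the quotient space $\Gamma\setminus\Omega_i$ is a smooth manifold diffeomorphic to $(\Gamma\setminus G)\times X$ for a space $X$ diffeomorphic to the product of a sphere and a Euclidean space.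
   Context: $\mathbb{R}^N\rtimes_A\mathbb{R}$ is $\mathbb{R}^N\times\mathbb{R}$ with product $(b,t)\cdot(b',t')=(b+A(t)b',t+t')$. A representation of $\mathbb{R}$ is closed if its image is closed. $\mathrm{PSL}(N+1,\mathbb{C})=\mathrm{PGL}(N+1,\mathbb{C})$ acts on $\mathbb{P}^N_{\mathbb{C}}$ by $g[z]=[gz]$; a lift of $G$ is a subgroup of $\mathrm{GL}(N+1,\mathbb{C})$ projecting onto $G$. A lattice is a discrete subgroup of finite covolume. Definition of $\Omega_1,\Omega_2$: write $A(t)=\exp(tM)$ with $M=\dot A(0)$. All eigenvalues of $M$ have nonzero real part, so $\mathbb{R}^N=E^s\oplus E^u$ with $E^s,E^u$ the $M$-invariant subspaces on which $M$ has only eigenvalues with negative, respectively positive, real part. Decompose $\mathbb{C}^N=\mathbb{R}^N\oplus iE^s\oplus iE^u$ (real direct sum) and let $\pi_s:\mathbb{C}^N\to E^s$, $\pi_u:\mathbb{C}^N\to E^u$ be the corresponding real-linear projections ($\pi_s(b+ix+iy)=x$, $\pi_u(b+ix+iy)=y$ for $b\in\mathbb{R}^N$, $x\in E^s$, $y\in E^u$). Put $U^-=\mathbb{C}^N\setminus\ker\pi_s$ and $U^+=\mathbb{C}^N\setminus\ker\pi_u$. Let $\phi$ be the chart $[z_1:\dots:z_N:1]\mapsto(z_1,\dots,z_N)^T$ of $\mathbb{P}^N_{\mathbb{C}}$. Then $\Omega_1=\sigma\,\phi^{-1}(U^-)$ and $\Omega_2=\sigma\,\phi^{-1}(U^+)$.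 *)

(* Defs.v *)
From HB Require Import structures.
From mathcomp Require Import all_boot all_order all_algebra.
From mathcomp Require Import all_classical all_reals all_analysis.
From mathcomp.real_closed Require Import complex.
Set Implicit Arguments.
Unset Strict Implicit.
Unset Printing Implicit Defensive.
Import Order.TTheory GRing.Theory Num.Theory numFieldNormedType.Exports.
Local Open Scope classical_set_scope.
Local Open Scope quotient_scope.
Local Open Scope ring_scope.

(* The library equips every abstract numFieldType, but not R[i], with the
   topology of its norm. *)
HB.instance Definition _ (R : rcfType) :=
  PseudoMetricNormedZmod.copy R[i] (R[i] : numFieldType)^o.

(* The quotient of T identifying the points with the same image under f; for
   an orbit map f this is the orbit space, with the quotient topology. *)
Definition same_image T S (f : T -> S) : rel T := fun x y => `[< f x = f y >].

Lemma same_image_equiv T S (f : T -> S) : equiv_class_of (same_image f).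
Proof.
split=> [x|x y|y x z]; rewrite /same_image; first exact/asboolP.
- by apply/asboolP/asboolP.
- by move=> /asboolP-> /asboolP->; exact/asboolP.
Qed.
Canonical same_image_rel T S (f : T -> S) :=
  EquivRelPack (same_image_equiv f).

Definition fquot (T : topologicalType) S (f : T -> S) : topologicalType :=
  quotient_topology {eq_quot (same_image_rel f)}.
Definition fclass (T : topologicalType) S (f : T -> S) (x : T) : fquot f :=
  \pi_(quotient_topology {eq_quot (same_image_rel f)}) x.
Definition frepr (T : topologicalType) S (f : T -> S) (q : fquot f) : T :=
  repr (q : quotient_topology {eq_quot (same_image_rel f)}).

Section Smooth.
Context {R : realType}.

(* f is of class C^k on U, where U is open *)
Fixpoint Ck (V W : normedModType R) (k : nat) (U : set V) (f : V -> W) : Prop :=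
  match k with
  | 0 => forall x, U x -> {for x, continuous f}
  | k.+1 => (forall x, U x -> differentiable f x) /\
            forall v, Ck k U (fun x => 'D_v f x)
  end.

Definition smooth_near (V W : normedModType R) (x : V) (f : V -> W) :=
  exists U : set V, [/\ open U, U x & forall k, Ck k U f].
End Smooth.

(* A smooth structure is given by its sheaf of smooth functions:
   [smooth_germ x f] says that f is smooth on a neighbourhood of x.  The axioms
   making such a space a manifold are those of [smooth_manifold]. *)
Record smooth_space (R : realType) := SmoothSpace {
  points :> topologicalType ;
  smooth_germ : points -> (points -> R) -> Prop }.

Section Manifolds.
Context {R : realType}.
Local Notation C := R[i].
Implicit Types M N : smooth_space R.

Definition smooth_map M N (f : M -> N) :=
  continuous f /\
  forall x g, smooth_germ (f x) g -> smooth_germ x (g \o f).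

Definition diffeomorphic M N :=
  exists (f : M -> N) (g : N -> M),
    [/\ cancel f g, cancel g f, smooth_map f & smooth_map g].

(* phi is a homeomorphism of the open set U onto an open subset of R^n, with
   inverse psi, and the smooth functions on U are those that are smooth in the
   coordinates phi. *)
Definition is_chart M (n : nat) (U : set M)
    (phi : M -> 'rV[R]_n) (psi : 'rV[R]_n -> M) :=
  [/\ open U /\ open (phi @` U),
      forall x, U x -> psi (phi x) = x,
      forall x, U x -> {for x, continuous phi},
      forall x, U x -> {for phi x, continuous psi} &
      forall x (f : M -> R), U x ->
        smooth_germ x f <-> smooth_near (phi x) (f \o psi) ].

Definition smooth_manifold M :=
  [/\ hausdorff_space M, @second_countable M &
      exists n, forall x : M, exists U phi psi, U x /\ @is_chart M n U phi psi].

Definition euclidean (n : nat) : smooth_space R :=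
  @SmoothSpace R 'rV[R]_n (fun x f => smooth_near x f).

(* smoothness of functions of complex variables is meant over the reals *)
Definition complex_mx (m n : nat) : smooth_space R :=
  @SmoothSpace R 'M[C]_(m, n) (fun z f =>
    smooth_near (map_mx (@complex.Re R) z, map_mx (@complex.Im R) z)
      (fun p : 'M[R]_(m, n) * 'M[R]_(m, n) =>
         f (map2_mx (@Complex R) p.1 p.2))).

(* On a subset: the functions extending locally to smooth functions on M.  This
   is the usual structure of an open subset and of an embedded submanifold. *)
Definition sub_space M (S : set M) : smooth_space R :=
  @SmoothSpace R (set_type S) (fun x f =>
    exists2 F, smooth_germ (val x) F & \forall y \near x, F (val y) = f y).

(* On a quotient: the functions whose pullback is smooth.  When the projection
   is a submersion for some manifold structure on the quotient, for instance
   when it is a local diffeomorphism, this is that structure. *)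
Definition quotient_space M S (f : M -> S) : smooth_space R :=
  @SmoothSpace R (fquot f) (fun q g =>
    forall x, fclass f x = q -> smooth_germ x (g \o fclass f)).

(* On a product: the functions that are locally smooth functions of finitely
   many smooth functions on the factors (e.g. of local coordinates). *)
Definition prod_space M N : smooth_space R :=
  @SmoothSpace R (M * N)%type (fun p f =>
    exists k l (u : M -> 'rV[R]_k) (v : N -> 'rV[R]_l)
           (F : 'rV[R]_k * 'rV[R]_l -> R),
      [/\ forall i, smooth_germ p.1 (fun x => u x 0 i),
          forall j, smooth_germ p.2 (fun y => v y 0 j),
          smooth_near (u p.1, v p.2) F &
          \forall q \near p, f q = F (u q.1, v q.2)]).

Definition sphere (n : nat) : smooth_space R :=
  sub_space [set x : euclidean n.+1 | \sum_i x 0 i ^+ 2 = 1].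

End Manifolds.
Arguments euclidean R n : clear implicits.
Arguments complex_mx R m n : clear implicits.
Arguments sphere R n : clear implicits.

Definition GL (K : numFieldType) (n : nat) : set 'M[K]_n :=
  [set g | g \in unitmx].
Arguments GL K n : clear implicits.

Section GeneralLinear.
Context {K : numFieldType} {n : nat}.

Definition gl_of (g : 'M[K]_n) (ug : GL K n g) : GL K n := SigSub (mem_set ug).

Lemma gl_unit (g : GL K n) : val g \in unitmx.
Proof. by case: g => g /= /set_mem. Qed.

Fact gl_one_subproof : GL K n 1%:M. Proof. exact: unitmx1. Qed.
Fact gl_mul_subproof (g h : GL K n) : GL K n (val g *m val h).
Proof. by rewrite /GL /= unitmx_mul !gl_unit. Qed.
Fact gl_inv_subproof (g : GL K n) : GL K n (invmx (val g)).
Proof. by rewrite /GL /= unitmx_inv gl_unit. Qed.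

Definition gl_one := gl_of gl_one_subproof.
Definition gl_mul g h := gl_of (gl_mul_subproof g h).
Definition gl_inv g := gl_of (gl_inv_subproof g).

Definition gl_subgroup (H : set (GL K n)) :=
  [/\ H gl_one, forall g h, H g -> H h -> H (gl_mul g h) &
      forall g, H g -> H (gl_inv g)].
End GeneralLinear.

Section Projective.
Context {R : realType} {n : nat}.
Local Notation C := R[i].

Definition nonzero : set (complex_mx R n 1) := [set z | z != 0].

Definition scalings m p (A : 'M[C]_(m, p)) : set 'M[C]_(m, p) :=
  [set c *: A | c in [set c : C | c != 0]].

(* P^(n-1)(C) *)
Definition projective : smooth_space R :=
  @quotient_space R (sub_space nonzero) _ (fun z => scalings (val z)).

(* PGL(n,C) = PSL(n,C) *)
Definition PGL : smooth_space R :=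
  @quotient_space R (@sub_space R (complex_mx R n n) (GL R[i] n)) _
    (fun g => scalings (val g)).

Definition pgl_class (g : GL C n) : PGL := fclass _ g.
Definition pgl_repr (g : PGL) : GL C n := frepr g.

Definition pgl_one : PGL := pgl_class gl_one.
Definition pgl_mul (g h : PGL) : PGL :=
  pgl_class (gl_mul (pgl_repr g) (pgl_repr h)).
Definition pgl_inv (g : PGL) : PGL := pgl_class (gl_inv (pgl_repr g)).

Definition pgl_subgroup (H : set PGL) :=
  [/\ H pgl_one, forall g h, H g -> H h -> H (pgl_mul g h) &
      forall g, H g -> H (pgl_inv g)].

Definition proj_of (z : 'cV[C]_n) (nz : nonzero z) : projective :=
  fclass _ (SigSub (mem_set nz) : nonzero).

Fact proj_act_subproof (g : GL C n) (z : nonzero) : nonzero (val g *m val z).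
Proof.
case: z => z /= /set_mem zn0; apply/eqP => gz0.
by move/eqP: zn0; apply; rewrite -(mulKmx (gl_unit g) z) gz0 mulmx0.
Qed.

Definition proj_act (g : PGL) (z : projective) : projective :=
  proj_of (proj_act_subproof (pgl_repr g) (frepr z)).

Definition lie_subgroup (G : set PGL) :=
  pgl_subgroup G /\ smooth_manifold (sub_space G).

Definition orbit_space (Gamma : set PGL) (Omega : set projective) :
    smooth_space R :=
  @quotient_space R (sub_space Omega) _
    (fun z => [set proj_act g (val z) | g in Gamma]).

Definition coset_space (Gamma G : set PGL) : smooth_space R :=
  @quotient_space R (sub_space G) _
    (fun x => [set pgl_mul g (val x) | g in Gamma]).

End Projective.
Arguments projective R n : clear implicits.
Arguments PGL R n : clear implicits.

(* a copy of T pointed at x, as required by the library of measurable types *)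
Definition pointed_at (T : topologicalType) (x : T) : Type := T.
HB.instance Definition _ (T : topologicalType) (x : T) :=
  Topological.on (pointed_at x).
HB.instance Definition _ (T : topologicalType) (x : T) :=
  isPointed.Build (pointed_at x) x.

Definition borel (T : topologicalType) (x : T) :=
  g_sigma_algebraType (@open (pointed_at x)).

Section Lattice.
Context {R : realType} {n : nat}.
Implicit Types Gamma G : set (PGL R n).

Definition right_translate Gamma G (h : PGL R n)
    (B : set (coset_space Gamma G)) : set (coset_space Gamma G) :=
  [set fclass _ y | y in [set y : G | exists x : G,
     B (fclass _ x) /\ val y = pgl_mul (val x) h]].

(* Gamma \ G carries a nonzero finite Borel measure invariant under the right
   action of G *)
Definition finite_covolume Gamma G :=
  exists (x : coset_space Gamma G) (mu : {measure set (borel x) -> \bar R}),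
    [/\ mu setT != 0%E, (mu setT < +oo)%E &
        forall h (B : set (borel x)), G h -> measurable B ->
          mu (right_translate h B) = mu B].

Definition discrete_subset Gamma :=
  forall g, Gamma g ->
    exists U : set (PGL R n), open U /\ U `&` Gamma = [set g].

Definition lattice Gamma G :=
  [/\ Gamma `<=` G, pgl_subgroup Gamma, discrete_subset Gamma &
      finite_covolume Gamma G].

Definition properly_discontinuous Gamma (Omega : set (projective R n)) :=
  forall K : set (projective R n), K `<=` Omega -> compact K ->
    finite_set
      [set g | Gamma g /\ [set proj_act g z | z in K] `&` K !=set0].

Definition discontinuity_domain Gamma (Omega : set (projective R n)) :=
  [/\ open Omega,
      forall g z, Gamma g -> Omega z -> Omega (proj_act g z) &
      properly_discontinuous Gamma Omega].

Definition maximal_discontinuity_domain Gamma (Omega : set (projective R n)) :=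
  discontinuity_domain Gamma Omega /\
  forall Omega', discontinuity_domain Gamma Omega' -> Omega `<=` Omega' ->
    Omega' = Omega.

End Lattice.

Section Hyperbolic.
Context {R : realType} {N : nat}.
Local Notation C := R[i].

Definition cmx m p (A : 'M[R]_(m, p)) : 'M[C]_(m, p) := map_mx (real_complex R) A.

Fact rho_subproof (A : R -> GL R N) (b : 'cV[R]_N) (t : R) :
  GL C (N + 1) (block_mx (cmx (val (A t))) (cmx b) 0 1%:M).
Proof.
by rewrite /GL /= unitmxE det_ublock det1 mulr1 -unitmxE map_unitmx gl_unit.
Qed.

Definition rho (A : R -> GL R N) (b : 'cV[R]_N) (t : R) : GL C (N + 1) :=
  gl_of (rho_subproof A b t).

Definition generator (A : R -> GL R N) : 'M[R]_N :=
  derive1 (fun t => val (A t)) 0.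

(* c is an eigenvalue of the complexification of the restriction of M to E *)
Definition restr_eigenvalue (M : 'M[R]_N) (E : {vspace 'cV[R]_N}) (c : C) :=
  exists w : 'cV[C]_N, [/\ w != 0, map_mx (@complex.Re R) w \in E,
    map_mx (@complex.Im R) w \in E & cmx M *m w = c *: w].

(* these properties determine Es and Eu *)
Definition spectral_splitting (M : 'M[R]_N) (Es Eu : {vspace 'cV[R]_N}) :=
  [/\ (Es + Eu = fullv)%VS /\ (Es :&: Eu = 0)%VS,
      forall v, v \in Es -> M *m v \in Es,
      forall v, v \in Eu -> M *m v \in Eu,
      forall c, restr_eigenvalue M Es c -> complex.Re c < 0 &
      forall c, restr_eigenvalue M Eu c -> 0 < complex.Re c].

(* b + ix + iy |-> x for b in R^N, x in E and y in F, where R^N = E (+) F;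
   thus pi_s = [im_proj Es Eu] and pi_u = [im_proj Eu Es]. *)
Definition im_proj (E F : {vspace 'cV[R]_N}) (z : 'cV[C]_N) : 'cV[R]_N :=
  daddv_pi E F (map_mx (@complex.Im R) z).

Fact affine_subproof (z : 'cV[C]_N) :
  (@nonzero R (N + 1)) (col_mx z 1%:M).
Proof. by apply/eqP; rewrite -col_mx0 => /eq_col_mx[_ /eqP]; rewrite oner_eq0. Qed.

(* the inverse (z_1, ..., z_N) |-> [z_1 : ... : z_N : 1] of the affine chart *)
Definition affine_point (z : 'cV[C]_N) : projective R (N + 1) :=
  proj_of (affine_subproof z).

(* Omega_1 = [Omega sigma Es Eu] and Omega_2 = [Omega sigma Eu Es] *)
Definition Omega (sigma : GL C (N + 1)) (E F : {vspace 'cV[R]_N}) :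
    set (projective R (N + 1)) :=
  [set proj_act (pgl_class sigma) (affine_point z) |
     z in [set z | im_proj E F z != 0]].

End Hyperbolic.

(* Main.v *)
(* Split R^N = R^p + R^q in a basis adapted to E^s + E^u and to a Lyapunov norm,
   and absorb the change of basis in sigma.  A point a + i(x, y) of Omega_1 has
   x <> 0, and since |A(-t) x| strictly increases with t there is exactly one time
   T(x) with |A(-T) x| = 1.  As T(A(t) x) = T(x) + t, the map
     a + i(x, y) |-> ((a, T x), A(-T) x, A(-T) y)
   is a G-equivariant diffeomorphism from Omega_1 to G x S^(p-1) x R^q, which
   gives proper discontinuity and the structure of the quotient.  Omega_2 is
   Omega_1 for the flow A(-t).
   Maximality uses Poincare recurrence on Gamma \ G, of finite volume: for g in G
   and U open in G, Gamma contains elements u' g^n u^-1 with u, u' in U and n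
   arbitrarily large.  At a point at infinity, take for g a translation, which
   fixes it.  At b + iy with y in E^u, take g = A(-1): the element u' g^n u^-1
   moves u(i(A(n) xi + y)), close to the point, to u'(i(xi + A(-n) y)), which stays
   in a compact subset of Omega_1.
   Recurrence also shows that E^s and E^u are nonzero: if A is contracting, then
   Gamma contains a contraction, hence by discreteness all of Gamma fixes its
   fixed point, contradicting recurrence for translations. *)
Require Import Defs.
From HB Require Import structures.
From mathcomp Require Import all_boot all_order all_algebra.
From mathcomp Require Import all_classical all_reals all_analysis.
From mathcomp.real_closed Require Import complex.
From mathcomp Require Import ring lra.
Set Implicit Arguments.
Unset Strict Implicit.
Unset Printing Implicit Defensive.
Import Order.TTheory GRing.Theory Num.Theory numFieldNormedType.Exports.
Local Open Scope classical_set_scope.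
Local Open Scope ring_scope.

(** * Smooth functions on finite-dimensional spaces *)

(** Germs on subspaces and quotients are hard to compute with, so [G] and the domain are handled
    through parametrizations by open subsets of vector spaces, [theta] and [chart_point]. They are
    local diffeomorphisms in the sense of [etale], a property that descends to orbit spaces, and
    smoothness of maps is verified upstairs on explicit matrix formulas. A smooth left inverse of
    [theta] comes from the hitting time, which recovers [t] from the stable block of [A t] without a
    logarithm. The Hausdorff property is proved for the coset space, where it follows from
    discreteness, and reaches the orbit space through the diffeomorphism. The Lyapunov norm is built
    over the complex numbers: triangularize, shrink the off-diagonal entries by a diagonal
    conjugation, then turn the real part of the Hermitian form into the standard form by a Cholesky
    factor. The energy is then strictly monotone along orbits, so the hitting time solves a scalar
    equation with nonvanishing derivative and is smooth. In both cases of maximality the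
    contradiction is the same: proper discontinuity leaves finitely many returning elements, which
    bounds the exponent [n] that recurrence makes arbitrarily large. *)

Section CkCalculus.
Context {R : realType}.
Implicit Types V W Z : normedModType R.

Lemma differentiable_eq_near V W (f g : V -> W) (x : V) :
  (\forall y \near x, f y = g y) -> differentiable f x -> differentiable g x.
Proof.
move=> fg df.
have /diff_locallyP[_ E] := df.
have fgx : f x = g x := nbhs_singleton fg.
have E2 : g \o shift x = cst (g x) + 'd f x +o_ 0 id.
  apply/eqaddoP => e e0.
  have /eqaddoP/(_ e e0) := E.
  have : \forall h \near (0 : V), f (h + x) = g (h + x).
    have cs : (fun h : V => h + x) @ (0 : V) --> x.
      rewrite -[X in _ --> X]add0r; apply: cvgD; [exact: cvg_id|exact: cvg_cst].
    exact: (cs _ fg).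
  apply: filterS2 => h /= E1; rewrite !fctE /= -fgx.
  by rewrite E1.
have dd := diff_unique (diff_continuous df) E2.
by apply/diff_locallyP; rewrite dd; split => //; exact: diff_continuous.
Qed.

Lemma Ck_eq V W k (U : set V) (f g : V -> W) : open U ->
  (forall x, U x -> f x = g x) -> Ck k U f -> Ck k U g.
Proof.
move=> oU; elim: k f g => [|k IH] f g fg /=.
  move=> cf x Ux; have nU : \forall y \near x, f y = g y.
    by apply: filterS (open_nbhs_nbhs (conj oU Ux)) => y; exact: fg.
  rewrite /prop_for /continuous_at -(fg _ Ux).
  apply: cvg_trans (cf _ Ux); exact: near_eq_cvg.
move=> [df Df]; have nU x : U x -> \forall y \near x, f y = g y.
  by move=> Ux; apply: filterS (open_nbhs_nbhs (conj oU Ux)) => y; exact: fg.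
split=> [x Ux|v].
  by apply: differentiable_eq_near (df _ Ux); exact: nU.
apply: IH (Df v) => x Ux.
by apply: near_eq_derive => //; exact: nU.
Qed.

Lemma Ck_subset V W k (U U' : set V) (f : V -> W) :
  U `<=` U' -> Ck k U' f -> Ck k U f.
Proof.
move=> UU'; elim: k f => [|k IH] f /=; first by move=> cf x /UU'; exact: cf.
by move=> [df Df]; split=> [x /UU'|v]; [exact: df|exact: IH].
Qed.

Lemma CkW V W k (U : set V) (f : V -> W) : Ck k.+1 U f -> Ck k U f.
Proof.
elim: k f => [|k IH] f; first by move=> [df _] x /df/differentiable_continuous.
by move=> [df Df]; split=> // v; exact/IH/Df.
Qed.

Lemma Ck_continuous V W k (U : set V) (f : V -> W) : Ck k U f ->
  forall x, U x -> {for x, continuous f}.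
Proof. by elim: k => // k IH /CkW /IH. Qed.

Lemma Ck_cst V W k (U : set V) (c : W) : Ck k U (cst c).
Proof.
elim: k c => [|k IH] c /=; first by move=> x _; exact: cst_continuous.
split=> [x _|v]; first exact: differentiable_cst.
rewrite (_ : (fun x => _) = cst 0); first exact: IH.
by apply/funext => x; rewrite derive_cst.
Qed.

Lemma CkD V W k (U : set V) (f g : V -> W) : open U -> Ck k U f -> Ck k U g ->
  Ck k U (fun x => f x + g x).
Proof.
move=> oU; elim: k f g => [|k IH] f g /=.
  by move=> cf cg x Ux; apply: cvgD; [exact: cf|exact: cg].
move=> [df Df] [dg Dg]; split=> [x Ux|v].
  by apply: differentiableD; [exact: df|exact: dg].
apply: Ck_eq (IH _ _ (Df v) (Dg v)) => // x Ux /=.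
by rewrite deriveD //; apply: diff_derivable; [exact: df|exact: dg].
Qed.

Lemma Ck_lin V W Z k (U : set V) (f : V -> W) (L : {linear W -> Z}) :
  open U -> continuous L -> Ck k U f -> Ck k U (fun x => L (f x)).
Proof.
move=> oU cL; elim: k f => [|k IH] f /=.
  by move=> cf x Ux; apply: continuous_comp; [exact: cf|exact: cL].
have dL y : differentiable L y by exact: linear_differentiable.
move=> [df Df]; split=> [x Ux|v].
  by apply: (differentiable_comp (g := L)) => //; exact: df.
apply: Ck_eq (IH _ (Df v)) => // x Ux /=.
have dfx := df _ Ux.
rewrite deriveE // [RHS]deriveE; last exact: (differentiable_comp (g := L)).
by rewrite (diff_comp (g := L)) //= diff_lin.
Qed.

Lemma Ck_linear V W k (U : set V) (L : {linear V -> W}) : open U ->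
  continuous L -> Ck k U L.
Proof.
move=> oU cL; case: k => [|k] /=; first by move=> x _; exact: cL.
have dL y : differentiable L y by exact: linear_differentiable.
split=> // v; rewrite (_ : (fun x => _) = cst (L v)); first exact: Ck_cst.
by apply/funext => x; rewrite deriveE // diff_lin.
Qed.

Lemma CkM V k (U : set V) (f g : V -> R) : open U -> Ck k U f -> Ck k U g ->
  Ck k U (fun x => f x * g x).
Proof.
move=> oU; elim: k f g => [|k IH] f g.
  by move=> cf cg x Ux; apply: cvgM; [exact: cf|exact: cg].
move=> Ckf Ckg; have [[df Df] [dg Dg]] := (Ckf, Ckg); split=> [x Ux|v].
  by apply: differentiableM; [exact: df|exact: dg].
apply: Ck_eq (CkD oU (IH _ _ (CkW Ckf) (Dg v)) (IH _ _ (CkW Ckg) (Df v))) => //.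
move=> x Ux /=; rewrite deriveM //; apply: diff_derivable; [exact: df|exact: dg].
Qed.

Lemma CkN V k (U : set V) (f : V -> R) : open U -> Ck k U f ->
  Ck k U (fun x => - f x).
Proof.
move=> oU Cf; have E := CkM oU (@Ck_cst V R k U (-1)) Cf.
by apply: (Ck_eq oU _ E) => x _; rewrite /= mulN1r.
Qed.

Lemma CkV V k (U : set V) (f : V -> R) : open U ->
  (forall x, U x -> f x != 0) -> Ck k U f -> Ck k U (fun x => (f x)^-1).
Proof.
move=> oU f0; elim: k => [|k IH].
  by move=> cf x Ux; apply: cvgV; [exact: f0|exact: cf].
move=> Ckf; have [df Df] := Ckf; split=> [x Ux|v].
  by apply: differentiableV; [exact: df|exact: f0].
have Ci := IH (CkW Ckf).
have E := CkN oU (CkM oU (CkM oU Ci Ci) (Df v)).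
apply: (Ck_eq oU _ E).
move=> x Ux /=; rewrite deriveV ?f0 //; last exact/diff_derivable/df.
by rewrite /GRing.scale /= expr2 invfM mulNr.
Qed.

End CkCalculus.

(** [Ck] is phrased by directional derivatives, so the chain rule needs finitely many directions
    that span. A chosen basis with continuous dual coordinates provides them, and is inherited by
    matrices and products. *)
Class findim (R : realType) (V : normedModType R) := Findim {
  crd_index : finType;
  crd : crd_index -> {linear V -> R};
  crd_vec : crd_index -> V;
  crd_continuous : forall i, continuous (crd i);
  crd_sum : forall v, v = \sum_i crd i v *: crd_vec i;
  crd_crd_vec : forall i j, crd i (crd_vec j) = (i == j)%:R }.

Section Findim.
Context {R : realType}.

Definition id_linear : {linear R -> R} := idfun.

Program Definition real_findim : findim (R : normedModType R) :=
  @Findim R R unit (fun _ => id_linear) (fun _ => 1) _ _ _.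
Next Obligation. by move=> _ x A. Qed.
Next Obligation.
move=> v; rewrite (bigD1 tt) //= big1 ?addr0 /GRing.scale /= ?mulr1 //; case.
Qed.
Next Obligation. by case; case. Qed.

Section MatrixFindim.
Context (m n : nat).
Definition entry (ij : 'I_m * 'I_n) (M : 'M[R]_(m, n)) : R := M ij.1 ij.2.
Lemma entry_is_linear ij : linear (entry ij).
Proof. by move=> a u v; rewrite /entry !mxE. Qed.
HB.instance Definition _ ij :=
  GRing.isLinear.Build R 'M[R]_(m, n) R _ (entry ij) (entry_is_linear ij).

Program Definition matrix_findim : findim ('M[R]_(m, n) : normedModType R) :=
  @Findim R _ ('I_m * 'I_n)%type (fun ij => entry ij)
    (fun ij => delta_mx ij.1 ij.2) _ _ _.
Next Obligation. by move=> i; exact: coord_continuous. Qed.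
Next Obligation.
move=> v; rewrite [LHS]matrix_sum_delta pair_bigA /=; exact: eq_bigr.
Qed.
Next Obligation.
by move=> [i j] [i1 j1] /=; rewrite /entry mxE /= xpair_eqE.
Qed.
End MatrixFindim.

Section ProdFindim.
Context (V W : normedModType R) (fV : findim V) (fW : findim W).

Definition prod_crd (i : @crd_index _ _ fV + @crd_index _ _ fW) (p : V * W) : R :=
  match i with inl i => crd i p.1 | inr j => crd j p.2 end.
Lemma prod_crd_is_linear i : linear (prod_crd i).
Proof. by case: i => i a u v; rewrite /prod_crd linearP. Qed.
HB.instance Definition _ i :=
  GRing.isLinear.Build R (V * W)%type R _ (prod_crd i) (prod_crd_is_linear i).
Definition prod_crd_vec (i : @crd_index _ _ fV + @crd_index _ _ fW) : V * W :=
  match i with inl i => (crd_vec i, 0) | inr j => (0, crd_vec j) end.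

Program Definition prod_findim : findim ((V * W)%type : normedModType R) :=
  @Findim R _ (@crd_index _ _ fV + @crd_index _ _ fW)%type
    (fun i => prod_crd i) prod_crd_vec _ _ _.
Next Obligation.
case=> i /= p; rewrite /prod_crd.
- by apply: (cvg_comp (fun p : V * W => p.1) (crd i) cvg_fst); exact: crd_continuous.
- by apply: (cvg_comp (fun p : V * W => p.2) (crd i) cvg_snd); exact: crd_continuous.
Qed.
Next Obligation.
case=> v w; rewrite big_sumType /=.
rewrite [X in (X, _) = _](crd_sum v) [X in (_, X) = _](crd_sum w).
have E1 : \sum_i crd i v *: (crd_vec i, 0) =
  (\sum_i crd i v *: crd_vec i, 0) :> V * W.
  rewrite [LHS]surjective_pairing; congr pair.
    by rewrite (raddf_sum fst) /=.
  by rewrite (raddf_sum snd) /= big1 // => i _; rewrite scaler0.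
have E2 : \sum_i crd i w *: (0, crd_vec i) =
  (0, \sum_i crd i w *: crd_vec i) :> V * W.
  rewrite [LHS]surjective_pairing; congr pair.
    by rewrite (raddf_sum fst) /= big1 // => i _; rewrite scaler0.
  by rewrite (raddf_sum snd) /=.
rewrite /prod_crd /= E1 E2; congr pair; first by rewrite /= addr0.
by rewrite /= add0r.
Qed.
Next Obligation.
case=> i; case=> j; rewrite /prod_crd /=.
- by rewrite crd_crd_vec.
- by rewrite linear0.
- by rewrite linear0.
- by rewrite crd_crd_vec.
Qed.
End ProdFindim.
End Findim.
#[export] Existing Instance real_findim.
#[export] Existing Instance matrix_findim.
#[export] Existing Instance prod_findim.

Section Composition.
Context {R : realType}.
Implicit Types V W Z : normedModType R.

Lemma Ck_scalel V W k (U : set V) (f : V -> R) (w : W) : open U -> Ck k U f ->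
  Ck k U (fun x => f x *: w).
Proof.
move=> oU Cf.
have sx_lin : linear ( *:%R ^~ w : R -> _).
  by move=> u y z; rewrite scalerDl scalerA.
pose sxlM := GRing.isLinear.Build _ _ _ _ _ sx_lin.
pose sxL : {linear _ -> _} := HB.pack ( *:%R ^~ w) sxlM.
by apply: (@Ck_lin _ _ _ _ _ _ _ sxL) => //; exact: scalel_continuous.
Qed.

Lemma Ck_sum V W k (U : set V) (I : Type) (r : seq I) (f : I -> V -> W) :
  open U -> (forall i, Ck k U (f i)) -> Ck k U (fun x => \sum_(i <- r) f i x).
Proof.
move=> oU Cf; elim: r => [|i r IH].
  apply: (Ck_eq oU _ (@Ck_cst _ _ _ k U 0)) => x _ /=; by rewrite big_nil.
by apply: (Ck_eq oU _ (CkD oU (Cf i) IH)) => x _ /=; rewrite big_cons.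
Qed.

Lemma Ck_crd V W {fW : findim W} k (U : set V) (f : V -> W) : open U ->
  (forall i, Ck k U (fun x => crd i (f x))) -> Ck k U f.
Proof.
move=> oU Cf.
have := Ck_sum (index_enum (@crd_index _ _ fW)) oU
  (fun i => Ck_scalel (crd_vec i) oU (Cf i)).
by apply: Ck_eq => // x _; rewrite -crd_sum.
Qed.

(** Chain rule by induction on [k]: the derivative of the composite is a sum over coordinates of a
    derivative of a coordinate of [f] times a partial derivative of [g] along [f], and both factors
    are one class lower. *)
Lemma Ck_comp V W Z {fW : findim W} {fZ : findim Z} k (U : set V) (Y : set W)
    (f : V -> W) (g : W -> Z) : open U -> open Y -> (forall x, U x -> Y (f x)) ->
  Ck k U f -> Ck k Y g -> Ck k U (fun x => g (f x)).
Proof.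
move=> oU oY UY Cf Cg.
(* Coordinates on [Z] reduce to a scalar function, which the induction can replace by its partial
   derivatives. *)
suff H (h : W -> R) : Ck k Y h -> Ck k U (fun x => h (f x)).
  by apply: Ck_crd => // i; apply: (H (fun y => crd i (g y)));
     apply: Ck_lin => //; exact: crd_continuous.
move=> {Z fZ g Cg}; elim: k h f UY Cf => [|k IH] h f UY Cf Ch.
  move=> x Ux; apply: continuous_comp; first exact: Cf.
  exact/Ch/UY.
have [[df Df] [dh Dh]] := (Cf, Ch); split=> [x Ux|v].
  by apply: (differentiable_comp (f := f)); [exact: df|exact/dh/UY].
have E i := CkM oU (Ck_lin oU (@crd_continuous _ _ fW i) (Df v))
  (IH _ _ UY (CkW Cf) (Dh (crd_vec i))).
apply: Ck_eq (Ck_sum (index_enum (@crd_index _ _ fW)) oU E) => // x Ux /=.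
have [dfx dhx] := (df _ Ux, dh _ (UY _ Ux)).
rewrite [RHS]deriveE; last exact: (differentiable_comp (f := f)).
rewrite (diff_comp (f := f)) //= -(deriveE v dfx).
rewrite [X in 'd h (f x) X](crd_sum ('D_v f x)) linear_sum /=.
by apply: eq_bigr => i _; rewrite linearZ /= -(deriveE _ dhx).
Qed.
End Composition.

Section SmoothNear.
Context {R : realType}.
Implicit Types V W Z : normedModType R.

Lemma smooth_near_eq V W (x : V) (f g : V -> W) :
  (\forall y \near x, f y = g y) -> smooth_near x f -> smooth_near x g.
Proof.
move=> fg [U [oU Ux CU]].
have oUf : open (U `&` [set y | f y = g y]^°) by apply: openI => //; exact: open_interior.
exists (U `&` [set y | f y = g y]^°); split => // k.
apply: (Ck_eq oUf _ (Ck_subset _ (CU k))) => [y [_ /interior_subset //]|y []//].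
Qed.

Lemma smooth_near_ext V W (x : V) (f g : V -> W) :
  f =1 g -> smooth_near x f -> smooth_near x g.
Proof. by move=> /funext->. Qed.

Lemma smooth_near_continuous V W (x : V) (f : V -> W) :
  smooth_near x f -> {for x, continuous f}.
Proof. by move=> [U [oU Ux CU]]; exact: Ck_continuous (CU 0%N) _ Ux. Qed.

Lemma smooth_near_cst V W (x : V) (c : W) : smooth_near x (fun _ => c).
Proof. by exists setT; split=> // [|k]; [exact: openT|exact: Ck_cst]. Qed.

Lemma smooth_near_linear V W (L : {linear V -> W}) (x : V) : continuous L ->
  smooth_near x L.
Proof.
by move=> cL; exists setT; split=> // [|k]; [exact: openT|exact/Ck_linear/cL/openT].
Qed.

Lemma smooth_near_id V (x : V) : smooth_near x (fun y => y).
Proof. by apply: (@smooth_near_linear V V idfun) => y; exact: cvg_id. Qed.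

Lemma smooth_near_comp V W Z {fW : findim W} {fZ : findim Z} (x : V)
    (f : V -> W) (g : W -> Z) :
  smooth_near (f x) g -> smooth_near x f -> smooth_near x (fun y => g (f y)).
Proof.
move=> [Y [oY Yfx CY]] [U [oU Ux CU]].
have fY : nbhs x (f @^-1` Y).
  by apply: (Ck_continuous (CU 0%N) Ux); exact: open_nbhs_nbhs.
have oU' : open (U `&` (f @^-1` Y)^°) by apply: openI => //; exact: open_interior.
exists (U `&` (f @^-1` Y)^°); split => // k.
apply: (Ck_comp oU' oY _ (Ck_subset _ (CU k)) (CY k)) => y [] //.
by move=> _ /interior_subset.
Qed.

Local Lemma smooth_near2 V W1 W2 Z (x : V) (f : V -> W1) (g : V -> W2)
    (h : V -> Z) :
  (forall U k, open U -> Ck k U f -> Ck k U g -> Ck k U h) ->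
  smooth_near x f -> smooth_near x g -> smooth_near x h.
Proof.
move=> H [U [oU Ux CU]] [U' [oU' Ux' CU']]; exists (U `&` U').
split=> // [|k]; first exact: openI.
apply: H; first exact: openI.
- by apply: Ck_subset (CU k) => y [].
- by apply: Ck_subset (CU' k) => y [].
Qed.

Lemma smooth_nearD V W (x : V) (f g : V -> W) :
  smooth_near x f -> smooth_near x g -> smooth_near x (fun y => f y + g y).
Proof. by apply: smooth_near2 => U k oU; exact: CkD. Qed.

Lemma smooth_nearM V (x : V) (f g : V -> R) :
  smooth_near x f -> smooth_near x g -> smooth_near x (fun y => f y * g y).
Proof. by apply: smooth_near2 => U k oU; exact: CkM. Qed.

Lemma smooth_nearN V (x : V) (f : V -> R) :
  smooth_near x f -> smooth_near x (fun y => - f y).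
Proof. by move=> sf; apply: (smooth_near2 _ sf sf) => U k oU Cf _; exact: CkN. Qed.

Lemma smooth_nearB V (x : V) (f g : V -> R) :
  smooth_near x f -> smooth_near x g -> smooth_near x (fun y => f y - g y).
Proof. by move=> sf sg; apply: smooth_nearD => //; exact: smooth_nearN. Qed.

Lemma smooth_nearV V (x : V) (f : V -> R) : f x != 0 ->
  smooth_near x f -> smooth_near x (fun y => (f y)^-1).
Proof.
move=> fx0 sf; have cf := smooth_near_continuous sf.
have n0 : \forall y \near x, f y != 0.
  by apply: (cf [set y | y != 0]); apply: open_nbhs_nbhs; split.
have [U [oU Ux CU]] := sf.
exists (U `&` [set y | f y != 0]^°).
have oU' : open (U `&` [set y | f y != 0]^°) by apply: openI => //; exact: open_interior.
split=> // k; apply: CkV => //; first by move=> y [_ /interior_subset].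
by apply: Ck_subset (CU k) => y [].
Qed.

Lemma smooth_near_sum V W (x : V) (I : Type) (r : seq I) (f : I -> V -> W) :
  (forall i, smooth_near x (f i)) ->
  smooth_near x (fun y => \sum_(i <- r) f i y).
Proof.
move=> sf; elim: r => [|i r IH].
  by under eq_fun do rewrite big_nil; exact: smooth_near_cst.
by under eq_fun do rewrite big_cons; exact: smooth_nearD.
Qed.

Lemma smooth_near_crd V W {fW : findim W} (x : V) (f : V -> W) :
  (forall i, smooth_near x (fun y => crd i (f y))) -> smooth_near x f.
Proof.
move=> sf.
apply: (smooth_near_eq (f := fun y => \sum_i crd i (f y) *: crd_vec i)).
  by apply: nearW => y; rewrite -crd_sum.
apply: smooth_near_sum => i.
have [U [oU Ux CU]] := sf i; exists U; split=> // k; exact: Ck_scalel.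
Qed.

Lemma smooth_near_mx V m n (x : V) (f : V -> 'M[R]_(m, n)) :
  (forall i j, smooth_near x (fun y => f y i j)) -> smooth_near x f.
Proof. by move=> sf; apply: smooth_near_crd => -[i j]; exact: sf. Qed.

Lemma smooth_near_entry V m n (x : V) (f : V -> 'M[R]_(m, n)) i j :
  smooth_near x f -> smooth_near x (fun y => f y i j).
Proof.
move=> [U [oU Ux CU]]; exists U; split=> // k.
by apply: (Ck_lin (L := entry (i, j))) => //; exact: coord_continuous.
Qed.

Lemma smooth_near_fst V W1 W2 (x : V) (f : V -> W1 * W2) :
  smooth_near x f -> smooth_near x (fun y => (f y).1).
Proof.
move=> [U [oU Ux CU]]; exists U; split=> // k.
by apply: (Ck_lin (L := fst)) => // y; exact: cvg_fst.
Qed.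

Lemma smooth_near_snd V W1 W2 (x : V) (f : V -> W1 * W2) :
  smooth_near x f -> smooth_near x (fun y => (f y).2).
Proof.
move=> [U [oU Ux CU]]; exists U; split=> // k.
by apply: (Ck_lin (L := snd)) => // y; exact: cvg_snd.
Qed.

Lemma smooth_near_pair V W1 W2 {f1 : findim W1} {f2 : findim W2} (x : V)
    (f : V -> W1) (g : V -> W2) :
  smooth_near x f -> smooth_near x g -> smooth_near x (fun y => (f y, g y)).
Proof.
move=> sf sg; apply: smooth_near_crd => -[i|i] /=; rewrite /prod_crd /=.
- have [U [oU Ux CU]] := sf; exists U; split=> // k.
  by apply: (Ck_lin (L := crd i)) => //; exact: crd_continuous.
- have [U [oU Ux CU]] := sg; exists U; split=> // k.
  by apply: (Ck_lin (L := crd i)) => //; exact: crd_continuous.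
Qed.

Lemma smooth_near_mulmx V m n p (x : V) (f : V -> 'M[R]_(m, n))
    (g : V -> 'M[R]_(n, p)) :
  smooth_near x f -> smooth_near x g -> smooth_near x (fun y => f y *m g y).
Proof.
move=> sf sg; apply: smooth_near_mx => i j; under eq_fun do rewrite mxE.
by apply: smooth_near_sum => l; apply: smooth_nearM; exact: smooth_near_entry.
Qed.
End SmoothNear.

(** * Hausdorff and second countable spaces *)

Section Separation.

Lemma hausdorff_nbhsP (T : topologicalType) :
  hausdorff_space T <->
  forall x y : T, x <> y -> exists A B,
    [/\ nbhs x A, nbhs y B & forall z, A z -> B z -> False].
Proof.
split=> [H x y xy|H x y cxy].
  apply: contrapT => N; apply: xy; apply: H => A B nA nB.
  apply: contrapT => AB; apply: N; exists A, B; split=> // z Az Bz.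
  by apply: AB; exists z.
apply: contrapT => /H[A [B [nA nB AB]]].
by have [z [/AB]] := cxy _ _ nA nB.
Qed.

Lemma hausdorff_inj (T T' : topologicalType) (f : T -> T') :
  continuous f -> injective f -> hausdorff_space T' -> hausdorff_space T.
Proof.
move=> cf fi /hausdorff_nbhsP H; apply/hausdorff_nbhsP => x y xy.
have [|A [B [nA nB AB]]] := H (f x) (f y); first by move=> /fi.
exists (f @^-1` A), (f @^-1` B); split; [exact: cf|exact: cf|].
by move=> z; exact: AB.
Qed.

Lemma hausdorff_prod (T T' : topologicalType) :
  hausdorff_space T -> hausdorff_space T' -> hausdorff_space (T * T')%type.
Proof.
move=> /hausdorff_nbhsP H /hausdorff_nbhsP H'.
apply/hausdorff_nbhsP => -[x y] [x' y'] xy.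
have [xx'|/H[A [B [nA nB AB]]]] := pselect (x = x').
  have /H'[A [B [nA nB AB]]] : y <> y' by move=> yy'; apply: xy; rewrite xx' yy'.
  exists (snd @^-1` A), (snd @^-1` B); split; last by move=> z; exact: AB.
  - exact: (cvg_snd (F := nbhs x) (G := nbhs y)).
  - exact: (cvg_snd (F := nbhs x') (G := nbhs y')).
exists (fst @^-1` A), (fst @^-1` B); split; last by move=> z; exact: AB.
- exact: (cvg_fst (F := nbhs x) (G := nbhs y)).
- exact: (cvg_fst (F := nbhs x') (G := nbhs y')).
Qed.

(** The images of the traces on [W] of the basic sets form a base, because [f] is open at the points
    of [W]. *)
Lemma second_countable_image (T T' : topologicalType) (W : set T) (f : T -> T') :
  open W ->
  (forall w, W w -> {for w, continuous f}) ->
  (forall w B, W w -> nbhs w B -> nbhs (f w) (f @` B)) ->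
  (forall y, exists2 w, W w & f w = y) ->
  @second_countable T -> @second_countable T'.
Proof.
move=> oW cf opf sf [B cB [Bo Bb]].
exists [set f @` (b `&` W) | b in B].
  exact: (sub_countable (card_image_le (fun b => f @` (b `&` W)) B)).
split=> [_ [b Bb' <-]|y A nA].
  rewrite openE => _ [w [bw Ww] <-]; apply: opf => //.
  by apply: open_nbhs_nbhs; split=> //; apply: openI => //; exact: Bo.
have [w Ww fw] := sf y; subst y.
have [b [Bb' bw] bA] := Bb w _ (cf w Ww _ nA).
exists (f @` (b `&` W)); first by split; [exists b|exists w].
by move=> _ [v [bv _] <-]; exact: bA.
Qed.

Lemma second_countable_prod (T T' : topologicalType) :
  @second_countable T -> @second_countable T' ->
  @second_countable (T * T')%type.
Proof.
move=> [B cB [Bo Bb]] [B' cB' [Bo' Bb']].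
exists [set p.1 `*` p.2 | p in B `*` B'].
  apply: (sub_countable (card_image_le (fun p => p.1 `*` p.2) (B `*` B'))).
  exact: countableX.
split=> [_ [[b b'] [/= Bb1 Bb1'] <-]|[x y] A [[U V] [nU nV] UVA]].
  by rewrite openE => -[x y] [/= bx by']; exists (b, b') => //; split;
    apply: open_nbhs_nbhs; split=> //; [exact: Bo|exact: Bo'].
have [b [Bb1 bx] bU] := Bb x _ nU.
have [b' [Bb1' bx'] bV] := Bb' y _ nV.
exists (b `*` b'); first by split=> //; exists (b, b').
by move=> [u v] [/= /bU Uu /bV Vv]; apply: UVA.
Qed.

End Separation.

(** * Topology of finite-dimensional spaces *)

Section FindimTopology.
Context {R : realType} {V : normedModType R} {fV : findim V}.

Definition rat_point (q : {ffun crd_index -> rat}) : V :=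
  \sum_i ratr (q i) *: crd_vec i.

Lemma rat_point_dense (v : V) (e : R) : 0 < e -> exists q, `|v - rat_point q| < e.
Proof.
move=> e0.
pose S := \sum_i (`|@crd_vec R V fV i| + 1).
(* The denominator stays positive even when there are no coordinates, and [d * S] is below [e]. *)
pose d := e / (S + 1).
have S0 : 0 <= S by apply: sumr_ge0 => i _; exact: addr_ge0.
have d0 : 0 < d by apply: divr_gt0 => //; exact: ltr_wpDl.
have Q i : exists q : rat, `|crd i v - ratr q| < d.
  have [|q] := @rat_in_itvoo R (crd i v - d) (crd i v + d).
    by rewrite ltrD2l gt0_cp.
  rewrite in_itv /= => /andP[q1 q2]; exists q.
  by rewrite ltr_norml; apply/andP; split; lra.
exists [ffun i => projT1 (cid (Q i))].
rewrite /rat_point [v in `|v - _|]crd_sum -sumrB.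
apply: (le_lt_trans (ler_norm_sum _ _ _)).
apply: (@le_lt_trans _ _ (\sum_i d * (`|@crd_vec R V fV i| + 1))).
  apply: ler_sum => i _; rewrite ffunE -scalerBl normrZ; apply: ler_pM => //.
    exact/ltW/(projT2 (cid (Q i))).
  by rewrite lerDl.
by rewrite -mulr_sumr -/S /d mulrAC ltr_pdivrMr ?ltr_wpDl // ltr_pM2l // ltrDl.
Qed.

Lemma findim_second_countable : @second_countable V.
Proof.
exists [set ball (rat_point p.1) (p.2.+1%:R^-1 : R) | p in setT].
  exact: (sub_countable (card_image_le _ _)).
split=> [_ [[q n] _ <-]|v A /nbhs_ballP[e /= e0 eA]].
  by apply: ball_open; rewrite invr_gt0.
have e20 : 0 < e / 2 by exact: divr_gt0.
pose n := Num.truncn (e / 2)^-1.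
have nlt : n.+1%:R^-1 < e / 2.
  by rewrite invf_plt ?posrE //; exact: Num.Theory.truncnS_gt.
have [q qv] := @rat_point_dense v (n.+1%:R^-1) ltac:(by rewrite invr_gt0).
exists (ball (rat_point q) (n.+1%:R^-1)).
  split; first by exists (q, n).
  by rewrite -ball_normE /= distrC.
move=> w; rewrite -ball_normE /= => qw; apply: eA; rewrite -ball_normE /=.
rewrite -(subrKA (rat_point q)) (splitr e) (le_lt_trans (ler_normD _ _)) //.
by apply: ltrD; [exact: lt_trans qv nlt|exact: lt_trans qw nlt].
Qed.

Let n := #|@crd_index R V fV|.

Definition to_row (v : V) : 'rV[R]_n := \row_i crd (enum_val i) v.
Definition of_row (u : 'rV[R]_n) : V :=
  \sum_i u 0 (enum_rank i) *: crd_vec i.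

Lemma to_row_is_linear : linear to_row.
Proof. by move=> a u v; apply/rowP => i; rewrite !mxE linearP. Qed.
HB.instance Definition _ := GRing.isLinear.Build R V 'rV[R]_n _ to_row to_row_is_linear.

Lemma to_rowK : cancel to_row of_row.
Proof.
move=> v; rewrite [RHS]crd_sum; apply: eq_bigr => i _.
by rewrite mxE enum_rankK.
Qed.

Lemma of_rowK : cancel of_row to_row.
Proof.
move=> u; apply/rowP => i; rewrite mxE /of_row linear_sum /=.
rewrite (bigD1 (enum_val i)) //= linearZ /= crd_crd_vec eqxx enum_valK.
rewrite big1 ?addr0; first by rewrite /GRing.scale /= mulr1.
by move=> j ji; rewrite linearZ /= crd_crd_vec eq_sym (negbTE ji) scaler0.
Qed.

Lemma smooth_near_to_row x : smooth_near x to_row.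
Proof.
apply: smooth_near_mx => i j.
apply: (smooth_near_eq (f := crd (enum_val j))).
  by apply: nearW => v; rewrite mxE.
by apply: smooth_near_linear; exact: crd_continuous.
Qed.

Lemma smooth_near_of_row u : smooth_near u of_row.
Proof.
apply: smooth_near_sum => i.
have [U [oU Ux CU]] := smooth_near_entry 0 (enum_rank i) (smooth_near_id u).
by exists U; split=> // k; exact: Ck_scalel.
Qed.

End FindimTopology.

Lemma continuous_pair (S T T' : topologicalType) (f : S -> T) (g : S -> T') x :
  {for x, continuous f} -> {for x, continuous g} ->
  {for x, continuous (fun y => (f y, g y))}.
Proof. by move=> cf cg; exact: (cvg_pair cf cg). Qed.

Lemma continuous_for_comp (S T T' : topologicalType) (f : S -> T) (g : T -> T') x :
  {for x, continuous f} -> {for f x, continuous g} ->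
  {for x, continuous (fun y => g (f y))}.
Proof. exact: continuous_comp. Qed.

Lemma continuous_for_fst (T T' : topologicalType) (p : T * T') :
  {for p, continuous fst}.
Proof. by case: p => x y; exact: (cvg_fst (F := nbhs x) (G := nbhs y)). Qed.

Lemma continuous_for_snd (T T' : topologicalType) (p : T * T') :
  {for p, continuous snd}.
Proof. by case: p => x y; exact: (cvg_snd (F := nbhs x) (G := nbhs y)). Qed.

(** * Manifolds from local diffeomorphisms *)

Section Etale.
Context {R : realType}.
Implicit Types M N : smooth_space R.

(* P restricts to a local diffeomorphism from the open set W to M *)
Definition etale (V : normedModType R) M (W : set V) (P : V -> M) :=
  open W /\ forall w, W w ->
    [/\ {for w, continuous P},
        forall B, nbhs w B -> nbhs (P w) (P @` B) &
        forall f, smooth_germ (P w) f <-> smooth_near w (f \o P)].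

Lemma etale_nbhs (V : normedModType R) M (W : set V) (P : V -> M) w (A : set M) :
  etale W P -> W w -> (nbhs (P w) A <-> \forall y \near w, A (P y)).
Proof.
move=> [oW eP] Ww; have [cP oP _] := eP _ Ww; split=> [nA|nA]; first exact: cP.
by apply: filterS (oP _ nA) => _ [y Ay <-].
Qed.

(** The chart inverts [P] on a neighbourhood where it is injective, then takes row coordinates. The
    model space [V] is the same at all points, which makes the dimension constant. *)
Lemma locally_etale_manifold (V : normedModType R) {fV : findim V} M :
  hausdorff_space M -> @second_countable M ->
  (forall m : M, exists (W : set V) (P : V -> M) w B,
    [/\ etale W P, W w, P w = m, nbhs w B & {in B &, injective P}]) ->
  smooth_manifold M.
Proof.
move=> hM cM HM; split => //; exists #|@crd_index R V fV| => m.
have [W [P [w [B [[oW eP] Ww Pw nB iB]]]]] := HM m; subst m.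
pose U0 := W `&` B^°.
have oU0 : open U0 by apply: openI => //; exact: open_interior.
have U0w : U0 w by split.
have U0W u : U0 u -> W u by case.
have inj u v : U0 u -> U0 v -> P u = P v -> u = v.
  by move=> [_ /interior_subset Bu] [_ /interior_subset Bv]; apply: iB; exact/mem_set.
(* The local inverse of [P], with the arbitrary value [w] off the image of [U0]. *)
pose r (m : M) : V := xget w [set u | U0 u /\ P u = m].
have rP u : U0 u -> r (P u) = u.
  by move=> U0u; rewrite /r; case: xgetP => [v -> [U0v /inj->]//|/(_ u)[]].
have ct (u : V) : {for u, continuous (@to_row R V fV)}.
  exact: smooth_near_continuous (smooth_near_to_row u).
have co u : {for u, continuous (@of_row R V fV)}.
  exact: smooth_near_continuous (smooth_near_of_row u).
have U0row : to_row @` U0 = @of_row R V fV @^-1` U0.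
  apply/seteqP; split=> [_ [u U0u <-] /=|u U0u]; first by rewrite to_rowK.
  by exists (of_row u) => //; rewrite of_rowK.
exists (P @` U0), (to_row \o r), (P \o @of_row R V fV); split; first by exists w.
have imE : (to_row \o r) @` (P @` U0) = @to_row R V fV @` U0.
  apply/seteqP; split=> [_ [_ [u U0u <-] <-] /=|_ [u U0u <-]].
    by exists u; rewrite ?rP.
  by exists (P u); rewrite /= ?rP //; exists u.
have opn : open (P @` U0).
  rewrite openE => _ [u U0u <-]; have [_ oP _] := eP _ (U0W _ U0u).
  by apply: oP; apply: open_nbhs_nbhs.
split.
- split => //; rewrite imE U0row; apply: open_comp => // u _; exact: co.
- by move=> _ [u U0u <-] /=; rewrite rP // to_rowK.
- move=> _ [u U0u <-]; apply: continuous_comp; last by rewrite rP.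
  rewrite /prop_for /continuous_at rP // => A nA.
  have [_ oP _] := eP _ (U0W _ U0u).
  have nAU : nbhs u (A `&` U0) by apply: filterI => //; exact: open_nbhs_nbhs.
  by apply: filterS (oP _ nAU) => _ [v [Av U0v] <-] /=; rewrite rP.
- move=> _ [u U0u <-] /=; rewrite rP //; apply: continuous_comp; first exact: co.
  by rewrite to_rowK; have [] := eP _ (U0W _ U0u).
- move=> _ f [u U0u <-] /=; rewrite rP //.
  have [_ _ gP] := eP _ (U0W _ U0u); split=> [/gP sf|sf].
    apply: (smooth_near_comp (f := of_row) (g := f \o P)); first by rewrite to_rowK.
    exact: smooth_near_of_row.
  apply/gP; apply: (@smooth_near_eq _ _ _ _ (fun v => (f \o (P \o of_row)) (to_row v))).
    by apply: nearW => v; rewrite /= to_rowK.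
  exact: (smooth_near_comp sf (smooth_near_to_row _)).
Qed.

Lemma etale_manifold (V : normedModType R) {fV : findim V} M (W : set V)
    (P : V -> M) : etale W P -> (forall m, exists2 w, W w & P w = m) ->
  (forall w, W w -> exists2 B, nbhs w B & {in B &, injective P}) ->
  hausdorff_space M -> smooth_manifold M.
Proof.
move=> eP sP iP hM; have [oW eP'] := eP; apply: (@locally_etale_manifold V) => //.
  apply: (@second_countable_image V M W P) => //.
  - by move=> w /eP'[].
  - by move=> w B /eP'[_ oP _]; exact: oP.
  - exact: findim_second_countable.
move=> m; have [w Ww Pw] := sP m; have [B nB iB] := iP _ Ww.
by exists W, P, w, B.
Qed.

(** Separation and countability are transported along with the charts; this is how the orbit space
    is seen to be Hausdorff. *)
Lemma diffeomorphic_manifold M N :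
  diffeomorphic M N -> smooth_manifold N -> smooth_manifold M.
Proof.
move=> [f [g [fK gK [cf sf] [cg sg]]]] [hN cN [n chN]]; split.
- exact: hausdorff_inj cf (can_inj fK) hN.
- apply: (@second_countable_image N M setT g) => //; first exact: openT.
  + by move=> w _; exact: cg.
  + move=> w B _ nB; have nf : nbhs (g w) (f @^-1` B) by apply: cf; rewrite gK.
    by apply: filterS nf => x Bx; exists (f x).
  + by move=> y; exists (f y).
exists n => x; have [U [phi [psi [Ux [[oU opU] psiK cphi cpsi gU]]]]] := chN (f x).
exists (f @^-1` U), (phi \o f), (g \o psi); split=> //.
have imE : (phi \o f) @` (f @^-1` U) = phi @` U.
  apply/seteqP; split=> [_ [y Uy <-]|_ [y Uy <-]]; first by exists (f y).
  by exists (g y); rewrite /= gK.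
split.
- by split; [apply: open_comp => // y _; exact: cf|rewrite imE].
- by move=> y Uy /=; rewrite psiK // fK.
- by move=> y Uy; apply: continuous_comp; [exact: cf|exact: cphi].
- by move=> y Uy; apply: continuous_comp; [exact: cpsi|exact: cg].
- move=> y h Uy; rewrite compA /= -gU //; split=> [hs|/sf].
    by apply: sg; rewrite fK.
  by rewrite (_ : _ \o f = h) //; apply/funext => z /=; rewrite fK.
Qed.

Lemma prod_manifold M N :
  smooth_manifold M -> smooth_manifold N -> smooth_manifold (prod_space M N).
Proof.
move=> [hM cM [m chM]] [hN cN [n chN]]; split.
- exact: hausdorff_prod.
- exact: second_countable_prod.
exists (m + n)%N => -[x y].
have [U [phi [psi [Ux [[oU opU] psiK cphi cpsi gU]]]]] := chM x.
have [U' [phi' [psi' [Uy' [[oU' opU'] psiK' cphi' cpsi' gU']]]]] := chN y.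
pose Phi (p : M * N) := row_mx (phi p.1) (phi' p.2).
pose Psi v : M * N := (psi (lsubmx v), psi' (rsubmx v)).
have sr (p : 'rV[R]_m * 'rV[R]_n) : smooth_near p (fun q => row_mx q.1 q.2).
  apply: smooth_near_mx => i j.
  case: (split_ordP j) => k ->; under eq_fun do rewrite ?row_mxEl ?row_mxEr;
    apply: smooth_near_entry.
    exact/smooth_near_fst/smooth_near_id.
  exact/smooth_near_snd/smooth_near_id.
have sl (v : 'rV[R]_(m + n)) : smooth_near v (fun w => (lsubmx w, rsubmx w)).
  apply: smooth_near_pair; apply: smooth_near_mx => i j; under eq_fun do rewrite mxE;
    exact/smooth_near_entry/smooth_near_id.
have cPhi p : U p.1 -> U' p.2 -> {for p, continuous Phi}.
  move=> Up Up'.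
  apply: (continuous_for_comp (f := fun q : M * N => (phi q.1, phi' q.2))
    (g := fun q : 'rV[R]_m * 'rV[R]_n => row_mx q.1 q.2)); last first.
    exact: smooth_near_continuous (sr _).
  apply: continuous_pair.
    by apply: (continuous_for_comp (f := fst)); [exact: continuous_for_fst|exact: cphi].
  by apply: (continuous_for_comp (f := snd)); [exact: continuous_for_snd|exact: cphi'].
have cPsi u u' : U u -> U' u' -> {for Phi (u, u'), continuous Psi}.
  move=> Uu Uu'.
  apply: (continuous_for_comp (f := fun w : 'rV[R]_(m + n) => (lsubmx w, rsubmx w))
    (g := fun q => (psi q.1, psi' q.2))).
    exact: smooth_near_continuous (sl _).
  rewrite /Phi /= row_mxKl row_mxKr; apply: continuous_pair.
    by apply: (continuous_for_comp (f := fst)); [exact: continuous_for_fst|exact: cpsi].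
  by apply: (continuous_for_comp (f := snd)); [exact: continuous_for_snd|exact: cpsi'].
have imE : Phi @` (U `*` U') =
    (fun v => (lsubmx v, rsubmx v)) @^-1` ((phi @` U) `*` (phi' @` U')).
  apply/seteqP; split=> [_ [[u u'] [/= Uu Uu'] <-]|v [/= [u Uu uE] [u' Uu' uE']]] /=.
    by rewrite /Phi /= row_mxKl row_mxKr; split; [exists u|exists u'].
  by exists (u, u') => //; rewrite /Phi /= uE uE' hsubmxK.
have oX (T T' : topologicalType) (A : set T) (B : set T') : open A -> open B -> @open (T * T')%type (A `*` B).
  by move=> oA oB; rewrite openE => -[a b] [/= Aa Bb]; exists (A, B) => //=; split;
     apply: open_nbhs_nbhs.
exists (U `*` U'), Phi, Psi; split=> //; split.
- split; first exact: oX.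
  rewrite imE; apply: open_comp; last exact: oX.
  by move=> v _; exact: smooth_near_continuous (sl _).
- by move=> [u u'] [/= Uu Uu']; rewrite /Psi /Phi /= row_mxKl row_mxKr psiK ?psiK'.
- by move=> p [Up Up']; exact: cPhi.
- by move=> [u u'] [/= Uu Uu']; exact: cPsi.
- move=> [u u'] f [/= Uu Uu']; split.
    move=> [k [l [a [b [F [sa sb sF fE]]]]]].
    have sab : smooth_near (Phi (u, u')) (fun v => F (a (psi (lsubmx v)), b (psi' (rsubmx v)))).
      have sps : smooth_near (phi u) (a \o psi).
        by apply: smooth_near_mx => i j; rewrite (ord1 i); exact: (gU u (fun z => a z 0 j) Uu).1 (sa j).
      have sps' : smooth_near (phi' u') (b \o psi').
        by apply: smooth_near_mx => i j; rewrite (ord1 i); exact: (gU' u' (fun z => b z 0 j) Uu').1 (sb j).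
      have sl1 := smooth_near_fst (sl (Phi (u, u'))).
      have sl2 := smooth_near_snd (sl (Phi (u, u'))).
      apply: (smooth_near_comp (g := F) (f := fun v => (a (psi (lsubmx v)), b (psi' (rsubmx v))))).
        by rewrite /= /Phi /= row_mxKl row_mxKr psiK ?psiK'.
      apply: smooth_near_pair.
        apply: (smooth_near_comp (g := a \o psi) _ sl1).
        by rewrite /= /Phi row_mxKl.
      apply: (smooth_near_comp (g := b \o psi') _ sl2).
      by rewrite /= /Phi row_mxKr.
    apply: smooth_near_eq sab.
    have PsiK : Psi (Phi (u, u')) = (u, u').
      by rewrite /Psi /Phi /= row_mxKl row_mxKr psiK ?psiK'.
    have nf : nbhs (Phi (u, u')) (Psi @^-1` [set q | f q = F (a q.1, b q.2)]).
      by apply: cPsi => //; rewrite PsiK.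
    by apply: filterS nf => v /= ->.
  (* The coordinates [phi] and [phi'] serve as the finitely many smooth functions. They are
     controlled only on [U] and [U'], which suffices for germs. *)
  move=> sf; exists m, n, phi, phi', (fun q => f (Psi (row_mx q.1 q.2))).
  have scoord k (T : Type) (A : set T) (ph : T -> 'rV[R]_k) (ps : 'rV[R]_k -> T) z i :
      open (ph @` A) -> A z -> (forall x, A x -> ps (ph x) = x) ->
      smooth_near (ph z) (fun w : 'rV[R]_k => (ph (ps w)) 0 i).
    move=> oA Az psK; apply: (smooth_near_eq (f := fun w : 'rV[R]_k => w 0 i)).
      have := open_nbhs_nbhs (conj oA (imageP ph Az)).
      by apply: filterS => _ [z' Az' <-]; rewrite psK.
    exact/smooth_near_entry/smooth_near_id.
  split=> /=.
  + move=> i; apply/gU => //; exact: (scoord _ _ U).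
  + move=> i; apply/gU' => //; exact: (scoord _ _ U').
  + by apply: (smooth_near_comp (g := fun v => f (Psi v))).
  + exists (U, U'); first by split; apply: open_nbhs_nbhs.
    by move=> [v v'] [/= Uv Uv']; rewrite /Psi /= row_mxKl row_mxKr psiK ?psiK'.
Qed.

Lemma euclidean_manifold n : smooth_manifold (euclidean R n).
Proof.
apply: (@etale_manifold 'rV[R]_n _ (euclidean R n) setT id).
- split; first exact: openT.
  by move=> w _; split=> // B nB; rewrite image_id.
- by move=> m; exists m.
- by move=> w _; exists setT => //; exact: filterT.
- exact: norm_hausdorff.
Qed.

End Etale.

Local Open Scope quotient_scope.

(** * Subspaces, quotients and orbit spaces *)

Section SubQuotient.
Context {R : realType}.
Implicit Types M N : smooth_space R.

Lemma nbhs_set_typeP (T : topologicalType) (S : set T) (x : set_type S)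
    (A : set (set_type S)) :
  nbhs x A <-> exists2 B, nbhs (val x) B & forall y : set_type S, B (val y) -> A y.
Proof.
split.
  move=> [_ [[C oC <-] Cx] CA]; exists C; first exact: open_nbhs_nbhs.
  by move=> y Cy; exact: CA.
move=> [B nB BA]; apply: filterS BA _; exact: (@initial_continuous _ _ val).
Qed.

Lemma continuous_set_type (T T' : topologicalType) (S : set T')
    (f : T -> set_type S) x :
  {for x, continuous (val \o f)} -> {for x, continuous f}.
Proof.
move=> cf A /nbhs_set_typeP[B nB BA].
have nf : nbhs x ((val \o f) @^-1` B) by exact: cf.
by apply: filterS nf => y; exact: BA.
Qed.

Lemma continuous_set_val (T : topologicalType) (S : set T) :
  continuous (val : set_type S -> T).
Proof. by move=> x B nB; apply/nbhs_set_typeP; exists B. Qed.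

Lemma set_type_hausdorff (T : topologicalType) (S : set T) :
  hausdorff_space T -> hausdorff_space (set_type S).
Proof.
by move=> hT; apply: hausdorff_inj hT; [exact: continuous_set_val|exact: val_inj].
Qed.

Lemma set_type_second_countable (T : topologicalType) (S : set T) :
  @second_countable T -> @second_countable (set_type S).
Proof.
move=> [B cB [Bo Bb]].
exists [set (val : set_type S -> T) @^-1` b | b in B].
  exact: (sub_countable (card_image_le _ _)).
split=> [_ [b Bb' <-]|x A /nbhs_set_typeP[C nC CA]].
  by apply: open_comp; [move=> y _; exact: continuous_set_val|exact: Bo].
have [b [Bb' bx] bC] := Bb _ _ nC.
by exists (val @^-1` b) => [|y /= /bC /CA //]; split=> //; exists b.
Qed.

(** Near each point of the image, [r] is a smooth map of the ambient space inverting [P]. This makes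
    [P] open onto [S], and a function [f] on [S] extends to the ambient space as [f] after [P] after
    [r]. *)
Lemma etale_sub (V : normedModType R) M (S : set M) (W : set V)
    (P : V -> sub_space S) (r : M -> V) : open W ->
  (forall w, W w ->
    [/\ {for w, continuous (val \o P)},
        forall f, smooth_germ (val (P w)) f -> smooth_near w (f \o val \o P),
        {for val (P w), continuous r} & r (val (P w)) = w]) ->
  (forall w f, W w -> smooth_near w f -> smooth_germ (val (P w)) (f \o r)) ->
  (forall w, W w -> \forall x \near val (P w),
     forall y : sub_space S, val y = x -> P (r x) = y) ->
  etale W P.
Proof.
move=> oW HP gr rK; split=> // w Ww; have [cP gP cr rP] := HP _ Ww; split.
- exact: continuous_set_type.
- move=> B nB; apply/nbhs_set_typeP.
  have nr : nbhs (val (P w)) (r @^-1` B) by apply: cr; rewrite rP.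
  exists (r @^-1` B `&` [set x | forall y : sub_space S, val y = x -> P (r x) = y]).
    by apply: filterI => //; exact: rK.
  by move=> y [By Ky]; exists (r (val y)) => //; exact: Ky.
- move=> f; split=> [[F gF Ff]|sf].
    apply: smooth_near_eq (gP _ gF).
    have nf : nbhs w (P @^-1` [set y | F (val y) = f y]).
      exact: (continuous_set_type cP).
    exact: filterS nf.
  exists ((f \o P) \o r); first exact: gr.
  apply/nbhs_set_typeP.
  exists [set x | forall y : sub_space S, val y = x -> P (r x) = y]; first exact: rK.
  by move=> y Ky /=; rewrite (Ky y).
Qed.

Lemma fclassP (T : topologicalType) S (f : T -> S) x y :
  fclass f x = fclass f y <-> f x = f y.
Proof.
split=> [/eqquotP/asboolP //|E].
by apply/eqquotP; exact/asboolP.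
Qed.

Lemma freprK (T : topologicalType) S (f : T -> S) (q : fquot f) :
  fclass f (frepr q) = q.
Proof. exact: reprK. Qed.

Lemma f_frepr (T : topologicalType) S (f : T -> S) x :
  f (frepr (fclass f x)) = f x.
Proof. by apply/fclassP; rewrite freprK. Qed.

Lemma fclass_continuous (T : topologicalType) S (f : T -> S) :
  continuous (fclass f).
Proof. exact: pi_continuous. Qed.

Lemma fclass_open (T : topologicalType) S (f : T -> S) (U : set (fquot f)) :
  open (fclass f @^-1` U) -> open U.
Proof. by []. Qed.

(** The fibres of [f] after [P] are the orbits of the maps [e i], which are smooth with inverses in
    the same family. Hence saturations of open sets are open, and a germ smooth at one point of a
    fibre is smooth at all of them. Local injectivity is a separate matter, supplied later by
    discreteness. *)
Lemma etale_orbit (V : normedModType R) {fV : findim V} M S (f : M -> S)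
    (W : set V) (P : V -> M) (I : Type) (e : I -> V -> V) : etale W P ->
  (forall m, exists2 w, W w & P w = m) ->
  (forall i w, W w -> W (e i w) /\ smooth_near w (e i)) ->
  (forall i, exists j, forall w, e j (e i w) = w /\ e i (e j w) = w) ->
  (forall w w', W w -> W w' -> f (P w) = f (P w') <-> exists i, w' = e i w) ->
  @etale R V (@quotient_space R M S f) W (fclass f \o P).
Proof.
move=> [oW eP] sP We eV fP; split=> // w Ww; have [cP oP gP] := eP _ Ww; split.
- by apply: continuous_for_comp => //; exact: fclass_continuous.
- move=> B nB; pose B0 := W `&` B^°.
  have oB0 : open B0 by apply: openI => //; exact: open_interior.
  apply: (@filterS _ (nbhs _) _ ((fclass f \o P) @` B0)).
    by move=> _ [u [_ /interior_subset Bu] <-]; exists u.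
  apply: open_nbhs_nbhs; split; last by exists w.
  apply: fclass_open; rewrite openE => x [u B0u /fclassP fu].
  have [v Wv Pv] := sP x; subst x.
  have Wu : W u by case: B0u.
  have [i vE] := (fP _ _ Wu Wv).1 fu; subst v.
  have [j ej] := eV i; have [eji eij] := ej u.
  have [_ oPv _] := eP _ Wv; have [_ sj] := We j _ Wv.
  have ne : nbhs (e i u) (W `&` e j @^-1` B0).
    apply: filterI; first exact: open_nbhs_nbhs.
    by apply: (smooth_near_continuous sj); rewrite eji; exact: open_nbhs_nbhs.
  apply: filterS (oPv _ ne) => _ [z [Wz B0z] <-]; exists (e j z) => //.
  apply/fclassP/fP => //; first by case: B0z.
  by exists i; have [] := ej z.
- move=> g; split=> [gg|sg x /fclassP fx].
    by apply/(gP (g \o fclass f)); exact: gg.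
  have [v Wv Pv] := sP x; subst x; have [_ _ gPv] := eP _ Wv; apply/gPv.
  have [i vE] := (fP _ _ Ww Wv).1 (esym fx); subst v.
  have [j ej] := eV i; have [eji eij] := ej w; have [_ sj] := We j _ Wv.
  have nW : nbhs (e i w) W by exact: open_nbhs_nbhs.
  apply: (smooth_near_eq (f := fun z => (g \o (fclass f \o P)) (e j z))).
    apply: filterS nW => z Wz /=; congr g; apply/fclassP/fP => //.
      by have [] := We j _ Wz.
    by exists i; have [] := ej z.
  by apply: smooth_near_comp sj; rewrite eji.
Qed.

End SubQuotient.

(** * The sphere *)

Section Sphere.
Context {R : realType} (n : nat).

Let sqn m (w : 'rV[R]_m) := \sum_i w 0 i ^+ 2.

Lemma smooth_near_sqn m (w : 'rV[R]_m) :
  smooth_near w (fun w => \sum_i w 0 i ^+ 2).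
Proof.
apply: smooth_near_sum => i; under eq_fun do rewrite expr2.
by apply: smooth_nearM; exact/smooth_near_entry/smooth_near_id.
Qed.

Let sqn_ge0 m (w : 'rV[R]_m) : 0 <= sqn w.
Proof. by apply: sumr_ge0 => i _; exact: sqr_ge0. Qed.

Let sqnZ m (a : R) (w : 'rV[R]_m) : sqn (a *: w) = a ^+ 2 * sqn w.
Proof.
by rewrite /sqn mulr_sumr; apply: eq_bigr => i _; rewrite mxE exprMn.
Qed.

Let sqn_split (w : 'rV[R]_(1 + n)) : sqn w = w 0 0 ^+ 2 + sqn (rsubmx w).
Proof.
rewrite /sqn big_split_ord /= big_ord1; congr (_ ^+ 2 + _).
  by congr (w _ _); apply: val_inj.
by apply: eq_bigr => i _; rewrite mxE.
Qed.

(* inverse stereographic projection from the pole (e, 0, ..., 0), e = 1 or -1 *)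
Definition stereo (e : R) (w : 'rV[R]_n) : 'rV[R]_(1 + n) :=
  e *: row_mx ((sqn w - 1) / (sqn w + 1))%:M ((2 / (sqn w + 1)) *: w).

Definition stereo_inv (e : R) (x : 'rV[R]_(1 + n)) : 'rV[R]_n :=
  (e / (1 - e * x 0 0)) *: rsubmx x.

Let stereo00 e w : stereo e w 0 0 = e * ((sqn w - 1) / (sqn w + 1)).
Proof.
have E : (0 : 'I_(1 + n)) = lshift n 0 by exact: val_inj.
by rewrite mxE E row_mxEl mxE eqxx mulr1n.
Qed.

Let stereo_rsub e w : rsubmx (stereo e w) = (e * (2 / (sqn w + 1))) *: w.
Proof. by rewrite /stereo linearZ /= row_mxKr scalerA. Qed.

Let sqn1_neq0 m (w : 'rV[R]_m) : sqn w + 1 != 0.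
Proof. by rewrite gt_eqF // ltr_wpDl. Qed.

Lemma sqn_stereo e w : e ^+ 2 = 1 -> sqn (stereo e w) = 1.
Proof.
move=> e2; rewrite sqn_split stereo00 stereo_rsub sqnZ !exprMn e2.
have := sqn1_neq0 w; move: (sqn w) => a a0; field.
exact: a0.
Qed.

Lemma stereoK e : e ^+ 2 = 1 -> cancel (stereo e) (stereo_inv e).
Proof.
move=> e2 w; rewrite /stereo_inv stereo00 stereo_rsub scalerA.
rewrite [X in X *: _](_ : _ = 1) ?scale1r //.
rewrite [e * (e * _)]mulrA -expr2 e2 mul1r mulrAC mulrA -expr2 e2.
have := sqn1_neq0 w; move: (sqn w) => a a0; field.
by rewrite a0 (_ : a + 1 - (a - 1) = 2) ?pnatr_eq0 //; ring.
Qed.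

Lemma stereo_invK e (x : 'rV[R]_(1 + n)) : e ^+ 2 = 1 -> sqn x = 1 -> e * x 0 0 != 1 ->
  stereo e (stereo_inv e x) = x.
Proof.
move=> e2 sx ex; rewrite /stereo.
have d0 : 1 - e * x 0 0 != 0 by rewrite subr_eq0 eq_sym.
have E : sqn (stereo_inv e x) = (1 + e * x 0 0) / (1 - e * x 0 0).
  rewrite sqnZ expr_div_n e2 -[sqn (rsubmx x)](addKr (x 0 0 ^+ 2)) -sqn_split sx.
  have -> : - x 0 0 ^+ 2 + 1 = (1 - e * x 0 0) * (1 + e * x 0 0).
    by rewrite -subr_sqr expr1n exprMn e2 mul1r addrC.
  by field.
have Ea : (sqn (stereo_inv e x) - 1) / (sqn (stereo_inv e x) + 1) = e * x 0 0.
  by rewrite E; field; rewrite d0 /= (_ : _ + _ = 2 :> R) ?pnatr_eq0 //; ring.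
have Eb : 2 / (sqn (stereo_inv e x) + 1) = 1 - e * x 0 0.
  by rewrite E; field; rewrite d0 /= (_ : _ + _ = 2 :> R) ?pnatr_eq0 //; ring.
rewrite Ea Eb /stereo_inv scalerA [(1 - _) * _]mulrC divfK // -[RHS]hsubmxK scale_row_mx scalerA -expr2 e2.
rewrite scale1r; congr row_mx; apply/rowP => i; rewrite (ord1 i) !mxE eqxx mulr1n.
by rewrite mulrA -expr2 e2 mul1r; congr (x _ _); apply: val_inj.
Qed.

Lemma smooth_near_stereo e w : smooth_near w (stereo e).
Proof.
have s1 : smooth_near w (fun w => (sqn w + 1)^-1).
  apply: smooth_nearV => //.
  by apply: smooth_nearD; [exact: smooth_near_sqn|exact: smooth_near_cst].
apply: smooth_near_mx => i j; rewrite (ord1 i).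
case: (split_ordP (j : 'I_(1 + n))) => k ->.
- apply: (smooth_near_ext (f := fun w : 'rV[R]_n => e * ((sqn w - 1) * (sqn w + 1)^-1))).
    by move=> v; rewrite mxE row_mxEl mxE (ord1 k) eqxx mulr1n.
  apply: smooth_nearM; first exact: smooth_near_cst.
  apply: smooth_nearM => //.
  by apply: smooth_nearD; [exact: smooth_near_sqn|exact: smooth_near_cst].
- apply: (smooth_near_ext (f := fun w : 'rV[R]_n => e * (2 * (sqn w + 1)^-1 * w 0 k))).
    by move=> v; rewrite mxE row_mxEr mxE.
  apply: smooth_nearM; first exact: smooth_near_cst.
  apply: smooth_nearM; last exact/smooth_near_entry/smooth_near_id.
  by apply: smooth_nearM => //; exact: smooth_near_cst.
Qed.

Lemma smooth_near_stereo_inv e (x : 'rV[R]_(1 + n)) : e * x 0 0 != 1 -> smooth_near x (stereo_inv e).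
Proof.
move=> ex; apply: smooth_near_mx => i j.
apply: (smooth_near_ext (f := fun x : 'rV[R]_(1 + n) => e * (1 - e * x 0 0)^-1 * x i (rshift 1 j))).
  by move=> v; rewrite !mxE.
apply: smooth_nearM; last exact/smooth_near_entry/smooth_near_id.
apply: smooth_nearM; first exact: smooth_near_cst.
apply: smooth_nearV; first by rewrite subr_eq0 eq_sym.
apply: smooth_nearB; first exact: smooth_near_cst.
by apply: smooth_nearM; [exact: smooth_near_cst|exact/smooth_near_entry/smooth_near_id].
Qed.

Fact stereo_sphere (e : R) : e ^+ 2 = 1 -> forall w,
  [set x : euclidean R n.+1 | \sum_i x 0 i ^+ 2 = 1] (stereo e w).
Proof. by move=> e2 w; exact: sqn_stereo. Qed.

Definition sphere_param (e : R) (e2 : e ^+ 2 = 1) (w : 'rV[R]_n) : sphere R n :=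
  SigSub (mem_set (stereo_sphere e2 w)).

(** The stereographic projection extends smoothly to the ambient space off the hyperplane
    [e * x 0 0 = 1], which the image of [stereo e] avoids; it is the inverse asked for by
    [etale_sub]. *)
Lemma etale_sphere e (e2 : e ^+ 2 = 1) : etale setT (sphere_param e2).
Proof.
have pole w : e * stereo e w 0 0 != 1.
  rewrite stereo00 mulrA -expr2 e2 mul1r.
  rewrite -subr_eq0 -[X in _ - X](divff (sqn1_neq0 w)) -mulrBl mulf_neq0 //.
    by rewrite (_ : _ - _ = - 2) ?oppr_eq0 ?pnatr_eq0 //; ring.
  by rewrite invr_eq0.
apply: (@etale_sub _ _ (euclidean R n.+1) _ setT (sphere_param e2)
  (stereo_inv e)) => [|w _|w f _ sf|w _].
- exact: openT.
- split; [|move=> f sf| |exact: stereoK].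
  + exact: smooth_near_continuous (smooth_near_stereo e w).
  + exact: (smooth_near_comp (f := stereo e) sf (smooth_near_stereo e w)).
  + exact: smooth_near_continuous (smooth_near_stereo_inv (pole w)).
- apply: smooth_near_comp; last exact: smooth_near_stereo_inv (pole w).
  by rewrite stereoK.
- have cx : {for stereo e w, continuous (fun x : 'rV[R]_(1 + n) => e * x 0 0)}.
    apply: smooth_near_continuous.
    by apply: smooth_nearM; [exact: smooth_near_cst|exact/smooth_near_entry/smooth_near_id].
  have : nbhs (stereo e w) ((fun x : 'rV[R]_(1 + n) => e * x 0 0) @^-1` [set y | y != 1]).
    by apply: cx; apply: open_nbhs_nbhs; split => //=.
  apply: filterS => x ex [y yS] /= yx; subst y; apply: val_inj => /=.
  by apply: stereo_invK => //; have := set_mem yS.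
Qed.

Lemma sphere_manifold : smooth_manifold (sphere R n).
Proof.
apply: (@locally_etale_manifold _ 'rV[R]_n).
- by apply: set_type_hausdorff; exact: norm_hausdorff.
- by apply: set_type_second_countable; exact: findim_second_countable.
move=> [x xS]; have sx : sqn x = 1 by have := set_mem xS.
(* The pole is chosen different from [x]. *)
pose e : R := if x 0 0 == 1 then -1 else 1.
have e2 : e ^+ 2 = 1 by rewrite /e; case: ifP; rewrite ?sqrrN expr1n.
have ex : e * x 0 0 != 1.
  rewrite /e; case: ifPn => [/eqP->|]; last by rewrite mul1r.
  by rewrite mulr1 eq_sym -subr_eq0 opprK (_ : 1 + 1 = 2) // pnatr_eq0.
exists setT, (sphere_param e2), (stereo_inv e x), setT; split=> //.
- exact: etale_sphere.
- by apply: val_inj; rewrite /= stereo_invK.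
- exact: filterT.
- by move=> w w' _ _ /(congr1 val) /= /(can_inj (stereoK e2)).
Qed.
End Sphere.

(** * Adapted norms *)

Section Lyapunov.
Context {R : realType}.
Local Notation C := R[i].
Local Notation Re := (@complex.Re R).
Local Notation Im := (@complex.Im R).

Let rdot (a b : C) : R := Re a * Re b + Im a * Im b.

(** The real part of the Hermitian product, that is, the Euclidean product of the underlying real
    vectors. *)
Definition cdot n (z w : 'cV[C]_n) : R :=
  \sum_i (Re (z i 0) * Re (w i 0) + Im (z i 0) * Im (w i 0)).

Definition rdotmx n (x y : 'cV[R]_n) : R := \sum_i x i 0 * y i 0.

Lemma rdotmxE n (x y : 'cV[R]_n) : rdotmx x y = (x^T *m y) 0 0.
Proof. by rewrite mxE; apply: eq_bigr => i _; rewrite mxE. Qed.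

Lemma rdotmx_ge0 n (x : 'cV[R]_n) : 0 <= rdotmx x x.
Proof. by apply: sumr_ge0 => i _; rewrite -expr2 sqr_ge0. Qed.

Lemma rdotmx_eq0 n (x : 'cV[R]_n) : (rdotmx x x == 0) = (x == 0).
Proof.
apply/eqP/eqP => [|->]; last by apply: big1 => i _; rewrite mxE mul0r.
move=> H; apply/colP => i; rewrite mxE.
have /eqP : x i 0 ^+ 2 = 0.
  by apply: (psumr_eq0P _ H) => // j _; exact: sqr_ge0.
by rewrite sqrf_eq0 => /eqP.
Qed.

Lemma cdot_eq0 n (z : 'cV[C]_n) : (cdot z z == 0) = (z == 0).
Proof.
apply/eqP/eqP => [|->]; last by apply: big1 => i _; rewrite mxE /= mul0r addr0.
move=> H; apply/colP => i; rewrite mxE.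
have P0 j : true -> 0 <= Re (z j 0) * Re (z j 0) + Im (z j 0) * Im (z j 0).
  by move=> _; rewrite -!expr2 addr_ge0 ?sqr_ge0.
have /eqP : Re (z i 0) * Re (z i 0) + Im (z i 0) * Im (z i 0) = 0.
  exact: (psumr_eq0P P0 H).
rewrite -!expr2 paddr_eq0 ?sqr_ge0 // !sqrf_eq0 => /andP[/eqP a0 /eqP b0].
by case: (z i 0) a0 b0 => a b /= -> ->.
Qed.

(** Split [u] into real and imaginary part; each of the two bilinear terms is bounded by the mean of
    the squared moduli of [a] and [b]. *)
Let rdot_le (u a b : C) :
  rdot a (u * b) <= (`|Re u| + `|Im u|) * ((rdot a a + rdot b b) / 2).
Proof.
case: u => u1 u2; case: a => a1 a2; case: b => b1 b2; rewrite /rdot /=.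
set s := (a1 * a1 + a2 * a2 + (b1 * b1 + b2 * b2)) / 2.
have E : a1 * (u1 * b1 - u2 * b2) + a2 * (u1 * b2 + u2 * b1) =
  u1 * (a1 * b1 + a2 * b2) + u2 * (a2 * b1 - a1 * b2) by ring.
have H1 : `|a1 * b1 + a2 * b2| <= s.
  rewrite ler_norml /s; have := sqr_ge0 (a1 + b1); have := sqr_ge0 (a2 + b2).
  have := sqr_ge0 (a1 - b1); have := sqr_ge0 (a2 - b2).
  by move=> ????; apply/andP; split; nra.
have H2 : `|a2 * b1 - a1 * b2| <= s.
  rewrite ler_norml /s; have := sqr_ge0 (a1 + b2); have := sqr_ge0 (a2 + b1).
  have := sqr_ge0 (a1 - b2); have := sqr_ge0 (a2 - b1).
  by move=> ????; apply/andP; split; nra.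
rewrite E mulrDl; apply: lerD; apply: (le_trans (ler_norm _)); rewrite normrM;
  exact: ler_wpM2l.
Qed.

Let rdot_diag (u a : C) : rdot a (u * a) = Re u * rdot a a.
Proof. by case: u => u1 u2; case: a => a1 a2; rewrite /rdot /=; ring. Qed.

Lemma finite_gt0_lb n (f : 'I_n -> R) : (forall i, 0 < f i) ->
  exists2 c, 0 < c & forall i, c <= f i.
Proof.
elim: n f => [|n IH] f f0; first by exists 1 => // -[].
have [c c0 cf] := IH (fun i => f (lift ord0 i)) (fun i => f0 _).
exists (Num.min c (f ord0)); first by rewrite lt_min c0 f0.
move=> i; case: (unliftP ord0 i) => [j|] ->; rewrite ge_min ?cf //.
by rewrite lexx orbT.
Qed.

(** Conjugation by the diagonal matrix with entries [e ^- i] multiplies [U i j] by [e ^+ (j - i)].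
    For small [e] the off-diagonal part is dominated by the diagonal, whose real parts are at most
    some [- c]. *)
Let trig_dissipative n (U : 'M[C]_n) :
  (forall i j : 'I_n, (j < i)%N -> U i j = 0) -> (forall i, Re (U i i) < 0) ->
  exists2 D : 'M[C]_n, D \in unitmx &
    exists2 c, 0 < c & forall z, cdot z (D *m U *m invmx D *m z) <= - c * cdot z z.
Proof.
move=> Ut Ud.
have [c c0 cU] := @finite_gt0_lb n (fun i => - Re (U i i))
  (fun i => ltac:(by rewrite oppr_gt0)).
pose K := \sum_i \sum_j (`|Re (U i j)| + `|Im (U i j)|).
have K0 : 0 <= K by apply: sumr_ge0 => i _; apply: sumr_ge0 => j _; exact: addr_ge0.
have KU (i j : 'I_n) : `|Re (U i j)| + `|Im (U i j)| <= K.
  rewrite /K (bigD1 i) //= (bigD1 j) //= -addrA lerDl addr_ge0 //.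
    by apply: sumr_ge0 => k _; exact: addr_ge0.
  by apply: sumr_ge0 => k _; apply: sumr_ge0 => l _; exact: addr_ge0.
(* Chosen so that [e * K * n] is at most [c / 2]. The bound [e <= 1] gives [e ^+ (j - i) <= e] above
   the diagonal, and the last [+ 1] covers [K * n = 0]. *)
pose e : R := Num.min 1 (c / (2 * (K * n%:R + 1))).
have Kn : 0 <= K * n%:R by exact: mulr_ge0.
have e0 : 0 < e by rewrite lt_min ltr01 divr_gt0 // mulr_gt0 // ltr_wpDl.
have e1 : e <= 1 by rewrite ge_min lexx.
have eK : e * K * n%:R <= c / 2.
  rewrite -mulrA; apply: (@le_trans _ _ (c / (2 * (K * n%:R + 1)) * (K * n%:R))).
    by apply: ler_wpM2r => //; rewrite ge_min lexx orbT.
  rewrite mulrAC ler_pdivrMr ?mulr_gt0 ?ltr_wpDl //.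
  have -> : c / 2 * (2 * (K * n%:R + 1)) = c * (K * n%:R) + c by field.
  by rewrite lerDl ltW.
pose d (i : 'I_n) : C := ((e ^+ i)^-1)%:C%C.
have eC i : (e ^+ i)%:C%C != 0 :> C.
  by rewrite (_ : 0 = (0 : R)%:C%C) // (inj_eq (@complexI R)) expf_eq0 (gt_eqF e0) andbF.
have d0 i : d i != 0 by rewrite /d fmorphV invr_eq0 eC.
pose D := diag_mx (\row_i d i); pose D' := diag_mx (\row_i (d i)^-1).
have DD' : D *m D' = 1%:M.
  rewrite mulmx_diag; apply/matrixP => i j; rewrite !mxE.
  by rewrite divff.
have Du : D \in unitmx by have [] := mulmx1_unit DD'.
have D'E : invmx D = D' by rewrite -[RHS](mulKmx Du) DD' mulmx1.
exists D => //; exists (c / 2); first exact: divr_gt0.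
move=> z; rewrite D'E.
have rd0 a : 0 <= rdot a a by rewrite /rdot -!expr2 addr_ge0 ?sqr_ge0.
have Eij (i j : 'I_n) : (D *m U *m D') i j = d i * U i j / d j.
  rewrite mul_mx_diag mxE mul_diag_mx !mxE //.
pose B (i j : 'I_n) : R := if i == j then - c * rdot (z i 0) (z i 0)
  else e * K * ((rdot (z i 0) (z i 0) + rdot (z j 0) (z j 0)) / 2).
have HB (i j : 'I_n) : rdot (z i 0) ((D *m U *m D') i j * z j 0) <= B i j.
  rewrite Eij /B; case: eqP => [<-|/eqP ij].
    have -> : d i * U i i / d i = U i i by rewrite mulrAC divff // mul1r.
    rewrite rdot_diag ler_wpM2r //.
    by rewrite lerNr; exact: cU.
  have s0 : 0 <= (rdot (z i 0) (z i 0) + rdot (z j 0) (z j 0)) / 2.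
    by apply: mulr_ge0 => //; exact: addr_ge0.
  have [ji|ij'] := ltnP j i.
    rewrite Ut // mulr0 !mul0r /rdot /= !mulr0 addr0.
    by apply: mulr_ge0 => //; apply: mulr_ge0 => //; exact: ltW.
  have {}ij : (i < j)%N by rewrite ltn_neqAle ij' andbT.
  have -> : d i * U i j / d j = (e ^+ (j - i))%:C%C * U i j.
    rewrite mulrAC; congr (_ * _); rewrite /d -[(_%:C%C)^-1]fmorphV -rmorphM invrK /=.
    by rewrite mulrC -expfB.
  apply: (le_trans (rdot_le _ _ _)); apply: ler_wpM2r => //.
  have eji : e ^+ (j - i) <= e.
    rewrite -[leRHS]expr1; apply: ler_wiXn2l => //; first exact: ltW.
    by rewrite subn_gt0.
  have eji0 : 0 <= e ^+ (j - i) by apply: exprn_ge0; exact: ltW.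
  apply: (@le_trans _ _ (e ^+ (j - i) * (`|Re (U i j)| + `|Im (U i j)|))).
    case: (U i j) => u1 u2 /=; rewrite !mul0r subr0 addr0 !normrM ger0_norm //.
    by rewrite -mulrDr.
  by apply: ler_pM => //; exact: addr_ge0.
have -> : cdot z (D *m U *m D' *m z) =
    \sum_i \sum_j rdot (z i 0) ((D *m U *m D') i j * z j 0).
  apply: eq_bigr => i _; rewrite [(_ *m z) i 0]mxE raddf_sum (raddf_sum Im) /=.
  by rewrite !mulr_sumr -big_split.
apply: (@le_trans _ _ (\sum_i \sum_j B i j)).
  by apply: ler_sum => i _; apply: ler_sum => j _; exact: HB.
(* Nonnegative diagonal terms are added to the off-diagonal bound; the double sum becomes symmetric
   and evaluates to [n] times the squared norm. *)
apply: (@le_trans _ _ (\sum_i (- c * rdot (z i 0) (z i 0) + \sum_j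
   e * K * ((rdot (z i 0) (z i 0) + rdot (z j 0) (z j 0)) / 2)))).
  apply: ler_sum => i _; rewrite (bigD1 i) //= {1}/B eqxx lerD2l.
  rewrite [leRHS](bigD1 i) //=.
  apply: (@le_trans _ _ (\sum_(j < n | j != i) e * K * ((rdot (z i 0) (z i 0) + rdot (z j 0) (z j 0)) / 2))).
    by apply: ler_sum => j ji; rewrite /B eq_sym (negbTE ji).
  rewrite lerDr; apply: mulr_ge0; first by apply: mulr_ge0 => //; exact: ltW.
  by apply: mulr_ge0 => //; exact: addr_ge0.
rewrite big_split /= -mulr_sumr.
under [X in _ + X]eq_bigr do rewrite -mulr_sumr.
rewrite -mulr_sumr.
have zz : \sum_i rdot (z i 0) (z i 0) = cdot z z by [].
have -> : \sum_(i < n) \sum_j (rdot (z i 0) (z i 0) + rdot (z j 0) (z j 0)) / 2 =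
   n%:R * cdot z z.
  transitivity (\sum_(i < n) ((n%:R * rdot (z i 0) (z i 0) + cdot z z) / 2)).
    apply: eq_bigr => i _; rewrite -mulr_suml big_split /= sumr_const card_ord.
    by rewrite mulr_natl.
  rewrite -mulr_suml big_split /= -mulr_sumr zz sumr_const card_ord.
  by rewrite -[cdot z z *+ n]mulr_natl; field.
rewrite zz mulrA.
have cz : 0 <= cdot z z by apply: sumr_ge0 => i _; exact: rd0.
by have := ler_wpM2r cz eK; lra.
Qed.

Lemma invmxM (K : comUnitRingType) n (X Y : 'M[K]_n) :
  X \in unitmx -> Y \in unitmx -> invmx (X *m Y) = invmx Y *m invmx X.
Proof.
move=> Xu Yu; have XYu : X *m Y \in unitmx by rewrite unitmx_mul Xu.
apply: (can_inj (mulKmx XYu)).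
by rewrite mulmxV // -mulmxA (mulmxA Y) mulmxV // mul1mx mulmxV.
Qed.

(** Schur triangularization followed by diagonal scaling. Schur yields a lower triangular matrix and
    eigenvectors as rows, so it is applied to the transpose of [B]. *)
Lemma complex_dissipative n (B : 'M[C]_n) :
  (forall c (v : 'cV[C]_n), v != 0 -> B *m v = c *: v -> Re c < 0) ->
  exists2 P : 'M[C]_n, P \in unitmx &
    exists2 c, 0 < c & forall z, cdot z (P *m B *m invmx P *m z) <= - c * cdot z z.
Proof.
move=> HB; case: n B HB => [|n] B HB.
  exists 1%:M; first exact: unitmx1.
  by exists 1 => // z; rewrite /cdot !big_ord0 mulr0.
have [P Pu] := Schur B^T (ltn0Sn n).
rewrite /similar_to /= conjymx // -invmx_unitary // => Pt.
have Punit := unitarymx_unit Pu.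
have [T TE] : exists T, T = P *m B^T *m invmx P by exists (P *m B^T *m invmx P).
rewrite -TE in Pt.
have TdU i : Re (T i i) < 0.
  have rt : root (char_poly T) (T i i).
    by rewrite char_poly_trig // /root horner_prod (bigD1 i) //= hornerXsubC subrr mul0r.
  move: rt; rewrite -eigenvalue_root_char => /eigenvalueP[v vT v0].
  apply: (HB _ (v *m P)^T).
    by rewrite trmx_eq0; apply: contra v0 => /eqP vP; rewrite -(mulmxK Punit v) vP mul0mx.
  rewrite -[B]trmxK -trmx_mul -linearZ /=; congr trmx.
  rewrite scalemxAl -vT TE -!mulmxA mulVmx // mulmx1 //.
have [D Du [c c0 cD]] := @trig_dissipative _ T^T
  (fun i j ji => ltac:(by rewrite mxE; apply: (is_trig_mxP Pt))) 
  (fun i => ltac:(by rewrite mxE)).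
have PTu : P^T \in unitmx by rewrite unitmx_tr.
exists (D *m invmx P^T); first by rewrite unitmx_mul Du unitmx_inv.
exists c; first exact: c0.
move=> z; suff -> : D *m invmx P^T *m B *m invmx (D *m invmx P^T) = D *m T^T *m invmx D by exact: cD.
have PTiu : invmx P^T \in unitmx by rewrite unitmx_inv.
rewrite (invmxM Du PTiu) invmxK.
by rewrite TE trmx_mul trmx_inv trmx_mul trmxK !mulmxA.
Qed.

(** Induction through the Schur complement [Q'] of the first diagonal entry. *)
Lemma cholesky n (Q : 'M[R]_n) : Q^T = Q ->
  (forall x : 'cV[R]_n, x != 0 -> 0 < (x^T *m Q *m x) 0 0) ->
  exists2 L : 'M[R]_n, L \in unitmx & Q = L^T *m L.
Proof.
elim: n Q => [|n IH] Q Qs Qp.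
  by exists 1%:M; [exact: unitmx1|apply/matrixP => -[]].
rewrite -[n.+1]/(1 + n)%N in Q Qs Qp *.
pose a := Q 0 0; pose r : 'rV_n := ursubmx Q.
have QE : Q = block_mx a%:M r r^T (drsubmx Q).
  rewrite -[LHS](@submxK _ 1 n 1 n); congr block_mx.
    apply/matrixP => i j; rewrite (ord1 i) (ord1 j) !mxE eqxx mulr1n /a.
    by congr (Q _ _); exact: val_inj.
  by rewrite /r trmx_ursub Qs.
have a0 : 0 < a.
  have e0 : (col_mx 1%:M 0 : 'cV[R]_(1 + n)) != 0.
    by apply/eqP; rewrite -col_mx0 => /eq_col_mx[/matrixP/(_ 0 0)/eqP]; rewrite !mxE oner_eq0.
  have := Qp _ e0; rewrite QE tr_col_mx trmx1 trmx0 mul_row_block !mul1mx.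
  rewrite !mul0mx !addr0 mul_row_col mulmx1 mulmx0 addr0.
  by rewrite mxE eqxx mulr1n.
pose Q' := drsubmx Q - a^-1 *: (r^T *m r).
have [L Lu LQ] : exists2 L : 'M[R]_n, L \in unitmx & Q' = L^T *m L.
  apply: IH.
    rewrite /Q' linearB linearZ /= trmx_mul trmxK; congr (_ - _).
    by rewrite -{2}Qs trmx_drsub Qs.
  move=> x x0.
  pose b := (r *m x) 0 0; have bE : r *m x = b%:M by rewrite -mx11_scalar.
  (* This first coordinate cancels the mixed terms, so the form [Q] at [y] equals [Q'] at [x]. *)
  pose y : 'cV[R]_(1 + n) := col_mx (- (b / a))%:M x.
  have y0 : y != 0 by apply: contra x0; rewrite -col_mx0 => /eqP/eq_col_mx[_ ->].
  have xr : x^T *m r^T = b%:M by rewrite -trmx_mul bE tr_scalar_mx.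
  have := Qp _ y0; rewrite {1}QE /y tr_col_mx mul_row_block mul_row_col xr.
  rewrite tr_scalar_mx -scalar_mxM -[_%:M + b%:M]raddfD /= mulNr divfK ?gt_eqF //.
  rewrite addNr raddf0 mul0mx add0r mulmxDl mul_scalar_mx -scalemxAl bE.
  rewrite /Q' mulmxBr mulmxBl -scalemxAr -scalemxAl mulmxA xr -!mulmxA bE.
  congr (0 < _); rewrite -scalar_mxM; move: (x^T *m _) => z.
  by rewrite !mxE eqxx !mulr1n; ring.
have sa : Num.sqrt a ^+ 2 = a by rewrite sqr_sqrtr // ltW.
have sa0 : Num.sqrt a != 0 by rewrite sqrtr_eq0 -ltNge.
exists (block_mx (Num.sqrt a)%:M ((Num.sqrt a)^-1 *: r) 0 L).
  rewrite unitmxE det_ublock det_scalar1 unitrM -unitmxE Lu andbT unitfE //.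
rewrite [LHS]QE tr_block_mx mulmx_block !trmx0 !mul0mx !addr0.
rewrite tr_scalar_mx !mul_scalar_mx scale_scalar_mx -expr2 sa linearZ /=.
have -> : ((Num.sqrt a)^-1 *: r)^T = (Num.sqrt a)^-1 *: r^T by rewrite linearZ.
rewrite mulmx0 addr0 mul_mx_scalar !scalerA mulVf // divff // !scale1r -LQ.
rewrite /Q' -scalemxAl -scalemxAr scalerA -invfM -expr2 sa.
by rewrite addrC subrK.
Qed.

(** On real vectors the squared norm of [P x] is a Euclidean form with matrix [Q]. A Cholesky factor
    [L] turns it into the standard form, and [S] is the inverse of [L]. *)
Lemma real_dissipative n (B : 'M[R]_n) :
  (forall c (v : 'cV[C]_n), v != 0 -> cmx B *m v = c *: v -> Re c < 0) ->
  exists2 S : 'M[R]_n, S \in unitmx & exists2 c, 0 < c &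
    forall x, rdotmx x (invmx S *m B *m S *m x) <= - c * rdotmx x x.
Proof.
move=> /complex_dissipative[P Pu [c c0 HP]].
pose PR := map_mx Re P; pose PI := map_mx Im P.
have ReP (x : 'cV[R]_n) i : Re ((P *m cmx x) i 0) = (PR *m x) i 0.
  rewrite !mxE raddf_sum; apply: eq_bigr => j _; rewrite !mxE.
  by case: (P i j) => u v /=; rewrite mulr0 subr0.
have ImP (x : 'cV[R]_n) i : Im ((P *m cmx x) i 0) = (PI *m x) i 0.
  rewrite !mxE (raddf_sum Im); apply: eq_bigr => j _; rewrite !mxE.
  by case: (P i j) => u v /=; rewrite mulr0 add0r.
pose Q := PR^T *m PR + PI^T *m PI.
have QE (x y : 'cV[R]_n) : (x^T *m Q *m y) 0 0 = cdot (P *m cmx x) (P *m cmx y).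
  rewrite /cdot big_split /=.
  under eq_bigr do rewrite !ReP.
  under [X in _ + X]eq_bigr do rewrite !ImP.
  rewrite -!/(rdotmx _ _) !rdotmxE !trmx_mul mulmxDr mulmxDl mxE.
  by rewrite !mulmxA.
have Qs : Q^T = Q by rewrite /Q linearD /= !trmx_mul !trmxK.
have Qp (x : 'cV[R]_n) : x != 0 -> 0 < (x^T *m Q *m x) 0 0.
  move=> x0; rewrite QE lt_def cdot_eq0; apply/andP; split; last first.
    by apply: sumr_ge0 => i _; rewrite -!expr2 addr_ge0 ?sqr_ge0.
  apply: contra x0 => /eqP Px; have : cmx x = 0 by rewrite -(mulKmx Pu (cmx x)) Px mulmx0.
  by move/eqP; rewrite map_mx_eq0.
have [L Lu LQ] := cholesky Qs Qp.
exists (invmx L); first by rewrite unitmx_inv.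
exists c => // y; rewrite invmxK.
pose x := invmx L *m y; have yE : y = L *m x by rewrite mulKVmx.
have -> : rdotmx y (L *m B *m invmx L *m y) = (x^T *m Q *m (B *m x)) 0 0.
  rewrite rdotmxE yE trmx_mul LQ !mulmxA; congr (_ 0 0).
  by rewrite -(mulmxA _ (invmx L) L) mulVmx // mulmx1.
have -> : rdotmx y y = (x^T *m Q *m x) 0 0.
  by rewrite rdotmxE yE trmx_mul LQ !mulmxA.
have cM : cmx (B *m x) = cmx B *m cmx x by rewrite /cmx map_mxM.
rewrite !QE cM.
have E : P *m cmx B *m invmx P *m (P *m cmx x) = P *m (cmx B *m cmx x).
  by rewrite -(mulmxA _ (invmx P)) (mulKmx Pu) mulmxA.
by rewrite -E; exact: HP.
Qed.

End Lyapunov.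

(** * Bases adapted to the splitting *)

Section SpectralBasis.
Context {R : realType}.
Local Notation C := R[i].

Lemma unitmx_inj (K : fieldType) n (S : 'M[K]_n) :
  (forall x : 'cV_n, S *m x = 0 -> x = 0) -> S \in unitmx.
Proof.
move=> H; rewrite -unitmx_tr -row_free_unit; apply: inj_row_free => v vS.
by apply: trmx_inj; rewrite trmx0; apply: H; rewrite -[S]trmxK -trmx_mul vS trmx0.
Qed.

Lemma basis_matrix n k (E : {vspace 'cV[R]_n}) : \dim E = k ->
  exists B : 'M[R]_(n, k), (forall v, v \in E <-> exists x : 'cV[R]_k, v = B *m x) /\
    (forall x : 'cV[R]_k, B *m x = 0 -> x = 0).
Proof.
move=> <-{k}; pose B : 'M[R]_(n, \dim E) := \matrix_(i, j) (vbasis E)`_j i 0.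
have BE (x : 'cV[R]_(\dim E)) : B *m x = \sum_j x j 0 *: (vbasis E)`_j.
  apply/colP => i; rewrite mxE summxE; apply: eq_bigr => j _.
  by rewrite !mxE mulrC.
have fE : free (vbasis E) := basis_free (vbasisP E).
exists B; split=> [v|x].
  split=> [vE|[x ->]]; last first.
    rewrite BE; apply: memv_suml => j _; apply: memvZ; apply: vbasis_mem.
    by apply: mem_nth; rewrite size_tuple.
  exists (\col_j coord (vbasis E) j v); rewrite BE [LHS](coord_vbasis vE).
  by apply: eq_bigr => j _; rewrite mxE.
rewrite BE => x0; apply/colP => j; rewrite mxE.
by have /freeP/(_ (fun j => x j 0) x0 j) := fE.
Qed.

(** An eigenvector of the matrix [X] of [M] on [E] becomes, through the complexified basis, an
    eigenvector of [M] with real and imaginary parts in [E]. So [real_dissipative] applies to [X],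
    and its change of basis is absorbed into [B]. *)
Lemma dissipative_basis n k (M : 'M[R]_n) (E : {vspace 'cV[R]_n}) :
  \dim E = k -> (forall v, v \in E -> M *m v \in E) ->
  (forall c, restr_eigenvalue M E c -> complex.Re c < 0) ->
  exists (B : 'M[R]_(n, k)) (ME : 'M[R]_k) (c : R),
    [/\ 0 < c, M *m B = B *m ME,
        forall x, rdotmx x (ME *m x) <= - c * rdotmx x x,
        forall v, v \in E <-> exists x : 'cV[R]_k, v = B *m x &
        forall x : 'cV[R]_k, B *m x = 0 -> x = 0].
Proof.
move=> dE ME eigE; have [B [BE B0]] := basis_matrix dE.
have colE j : exists x, col j (M *m B) = B *m x.
  apply/BE; rewrite colE -mulmxA; apply: ME.
  by apply/BE; exists (delta_mx j 0).
pose X := \matrix_(i, j) (projT1 (cid (colE j))) i 0.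
have MX : M *m B = B *m X.
  apply/matrixP => i j; have := projT2 (cid (colE j)).
  move/colP/(_ i); rewrite [LHS]mxE => ->; rewrite !mxE.
  by apply: eq_bigr => l _; rewrite mxE.
have [|T Tu [c c0 HT]] := @real_dissipative R k X.
  move=> c v v0 Xv; apply: eigE; exists (cmx B *m v).
  have ReB : map_mx (@complex.Re R) (cmx B *m v) = B *m map_mx (@complex.Re R) v.
    apply/matrixP => i j; rewrite !mxE raddf_sum; apply: eq_bigr => l _.
    by rewrite !mxE; case: (v l j) => a b /=; rewrite mul0r subr0.
  have ImB : map_mx (@complex.Im R) (cmx B *m v) = B *m map_mx (@complex.Im R) v.
    apply/matrixP => i j; rewrite !mxE (raddf_sum (@complex.Im R)).
    apply: eq_bigr => l _.
    by rewrite !mxE; case: (v l j) => a b /=; rewrite mul0r addr0.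
  split.
  - apply: contra v0 => /eqP Bv0; apply/eqP/matrixP => i j.
    have r0 : map_mx (@complex.Re R) v = 0.
      by apply: B0; rewrite -ReB Bv0; apply/matrixP => ? ?; rewrite !mxE.
    have i0 : map_mx (@complex.Im R) v = 0.
      by apply: B0; rewrite -ImB Bv0; apply/matrixP => ? ?; rewrite !mxE.
    move/matrixP/(_ i j): r0; move/matrixP/(_ i j): i0; rewrite !mxE.
    by case: (v i j) => a b /= -> ->.
  - by rewrite ReB; apply/BE; exists (map_mx (@complex.Re R) v).
  - by rewrite ImB; apply/BE; exists (map_mx (@complex.Im R) v).
  - rewrite mulmxA /cmx -map_mxM MX map_mxM -mulmxA -/(cmx X) Xv.
    by rewrite -scalemxAr.
exists (B *m T), (invmx T *m X *m T), c; split=> //.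
- by rewrite mulmxA MX !mulmxA mulmxK.
- move=> v; split=> [/BE[x ->]|[x ->]].
    by exists (invmx T *m x); rewrite mulmxA mulmxK.
  by apply/BE; exists (T *m x); rewrite mulmxA.
- by move=> x; rewrite -mulmxA => /B0 Tx; rewrite -(mulKmx Tu x) Tx mulmx0.
Qed.

(** On [Eu] the dissipative basis is taken for [- M], which turns the upper bound into a lower bound
    for [Mu]. The last clause reads [Eu] as the vanishing of the stable coordinates, the form in
    which the domain is described later. *)
Lemma spectral_basis p q (M : 'M[R]_(p + q)) (Es Eu : {vspace 'cV[R]_(p + q)}) :
  \dim Es = p -> spectral_splitting M Es Eu ->
  exists (S : 'M[R]_(p + q)) (Ms : 'M[R]_p) (Mu : 'M[R]_q) (c : R),
    [/\ S \in unitmx, 0 < c, M *m S = S *m block_mx Ms 0 0 Mu,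
        (forall x, rdotmx x (Ms *m x) <= - c * rdotmx x x) /\
        (forall y, c * rdotmx y y <= rdotmx y (Mu *m y)) &
        forall v, (v \in Eu) = (usubmx (invmx S *m v) == 0)].
Proof.
move=> ds [[sE cE] Ms Mu es eu].
have du : \dim Eu = q.
  have := dimv_disjoint_sum cE; rewrite sE dimvf /dim /= muln1 ds => /eqP.
  by rewrite eqn_add2l => /eqP.
have [Bs [X [c [c0 MX dX Bs1 Bs0]]]] := dissipative_basis ds Ms es.
have [||Bu [Y [d [d0 MY dY Bu1 Bu0]]]] := @dissipative_basis _ _ (- M) Eu du.
- by move=> v vE; rewrite mulNmx rpredN; exact: Mu.
- move=> k [w [w0 w1 w2 Mw]].
  rewrite -[k]opprK raddfN oppr_lt0; apply: eu; exists w; split=> //.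
  rewrite scaleNr -Mw -mulNmx; congr (_ *m _).
  by apply/matrixP => i j; rewrite !mxE -[in RHS]rmorphN opprK.
pose S := row_mx Bs Bu.
have SE (x : 'cV[R]_(p + q)) : S *m x = Bs *m usubmx x + Bu *m dsubmx x.
  by rewrite -[x in LHS]vsubmxK mul_row_col.
have cap v : v \in Es -> v \in Eu -> v = 0.
  by move=> vs vu; apply/eqP; rewrite -memv0 -cE memv_cap vs.
have uker (x : 'cV[R]_(p + q)) : S *m x \in Eu -> usubmx x = 0.
  rewrite SE => H; apply: Bs0; apply: cap; first by apply/Bs1; exists (usubmx x).
  by move: H; rewrite addrC rpredDl //; apply/Bu1; exists (dsubmx x).
have Su : S \in unitmx.
  apply: unitmx_inj => x Sx.
  have xu : usubmx x = 0 by apply: uker; rewrite Sx mem0v.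
  have xd : dsubmx x = 0 by apply: Bu0; move: Sx; rewrite SE xu mulmx0 add0r.
  by rewrite -[x]vsubmxK xu xd col_mx0.
exists S, X, (- Y), (Num.min c d); split=> //.
- by rewrite lt_min c0 d0.
- rewrite mul_mx_row mul_row_block !mulmx0 addr0 add0r MX; congr row_mx.
  by rewrite mulmxN -MY mulNmx opprK.
- split=> x; last first.
    have := dY x; have := rdotmx_ge0 x => x0.
    rewrite mulNmx; have -> : rdotmx x (- (Y *m x)) = - rdotmx x (Y *m x).
      by rewrite /rdotmx -sumrN; apply: eq_bigr => i _; rewrite !mxE mulrN.
    rewrite mulNr lerNr; apply: le_trans.
    by apply: ler_wpM2r => //; rewrite ge_min lexx orbT.
  apply: le_trans (dX x) _; rewrite ler_wpM2r ?rdotmx_ge0 // lerN2.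
  by rewrite ge_min lexx.
- move=> v; apply/idP/eqP => [vE|v0]; first by apply: uker; rewrite mulKVmx.
  rewrite -(mulKVmx Su v) SE v0 mulmx0 add0r.
  by apply/Bu1; exists (dsubmx (invmx S *m v)).
Qed.

End SpectralBasis.

(** * Implicit functions of one scalar unknown *)

Section Hitting.
Context {R : realType}.
Implicit Types V W : normedModType R.

Lemma Ck_local V W k (U : set V) (f : V -> W) :
  (forall x, U x -> exists U' : set V, U' x /\ Ck k U' f) -> Ck k U f.
Proof.
elim: k f => [|k IH] f H; first by move=> x /H[U' [U'x]]; exact.
split=> [x /H[U' [U'x [df _]]]|v]; first exact: df.
by apply: IH => x /H[U' [U'x [_ Df]]]; exists U'; split; last exact: Df.
Qed.

Lemma Ck_pair V W1 W2 {f1 : findim W1} {f2 : findim W2} k (U : set V)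
    (f : V -> W1) (g : V -> W2) : open U ->
  Ck k U f -> Ck k U g -> Ck k U (fun y => (f y, g y)).
Proof.
move=> oU Cf Cg; apply: (Ck_crd oU) => -[i|i] /=; rewrite /prod_crd /=.
- by apply: (Ck_lin (L := crd i)) => //; exact: crd_continuous.
- by apply: (Ck_lin (L := crd i)) => //; exact: crd_continuous.
Qed.

(** The error of the linear approximation is [(h - 'd h x) k + 'd h x (k - k x)]. In the first term
    [k] is bounded near [x]; in the second ['d h x] is Lipschitz and the other factor tends to 0. *)
Lemma caratheodory_derive V (h k : V -> R) (x : V) :
  differentiable h x -> h x = 0 -> {for x, continuous k} ->
  differentiable (fun y => h y * k y) x /\
  forall v, 'D_v (fun y => h y * k y) x = k x * 'D_v h x.
Proof.
move=> dh hx ck.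
have cdh : continuous ('d h x) := diff_continuous dh.
pose L : {linear V -> R} := k x \*: 'd h x.
have cL : continuous L by move=> y; apply: cvgZr; exact: cdh.
have [C C0 HC] := linear_lipschitz cdh.
have /diff_locallyP[_ /eqaddoP E] := dh.
have cs : (fun y : V => y + x) @ (0 : V) --> x.
  rewrite -[X in _ --> X]add0r; apply: cvgD; [exact: cvg_id|exact: cvg_cst].
have E2 : (fun y => h y * k y) \o shift x = cst (h x * k x) + L +o_ 0 id.
  apply/eqaddoP => e e0.
  pose M := `|k x| + 1.
  have M0 : 0 < M by rewrite ltr_wpDl.
  have e1 : 0 < e / 2 / M by rewrite !divr_gt0.
  have e2 : 0 < e / 2 / C by rewrite !divr_gt0.
  have kn d : 0 < d -> \forall y \near (0 : V), `|k (y + x) - k x| < d.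
    move=> d0; have : \forall y \near x, `|k y - k x| < d.
      by have /cvgrPdist_lt/(_ _ d0) := ck; apply: filterS => y; rewrite distrC.
    by move/cs.
  have {}E := E _ e1; have k1 := kn _ ltr01; have k2 := kn _ e2.
  apply: filterS3 E k1 k2 => y /= Ey k1 k2.
  have Ey' : `|h (y + x) - 'd h x y| <= e / 2 / M * `|y|.
    by move: Ey; rewrite !fctE /= hx add0r.
  rewrite !fctE /= hx mul0r add0r.
  have -> : h (y + x) * k (y + x) - k x *: 'd h x y =
    (h (y + x) - 'd h x y) * k (y + x) + 'd h x y * (k (y + x) - k x).
    by rewrite /GRing.scale /=; ring.
  rewrite (le_trans (ler_normD _ _)) // !normrM [e]splitr mulrDl.
  apply: lerD.
    apply: (@le_trans _ _ (e / 2 / M * `|y| * M)).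
      apply: ler_pM => //; apply: (@le_trans _ _ (`|k (y + x) - k x| + `|k x|)).
        by rewrite -[X in `|X| <= _](subrK (k x)) ler_normD.
      by rewrite addrC lerD2l ltW.
    by rewrite mulrAC divfK // gt_eqF.
  apply: (@le_trans _ _ (C * `|y| * (e / 2 / C))).
    by apply: ler_pM => //; exact: ltW.
  by rewrite mulrAC [C * _]mulrC divfK // gt_eqF.
have dd := diff_unique cL E2.
have D : differentiable (fun y => h y * k y) x.
  by apply/diff_locallyP; rewrite dd; split.
by split=> // v; rewrite deriveE // dd deriveE.
Qed.

(** * Linear flows and hitting times *)

Section ImplicitFunction.
Context {V : normedModType R} {fV : findim V} (F : V * R -> R) (U : set V)
  (T : V -> R).
Context (oU : open U).
Context (sF : forall x t, U x -> smooth_near (x, t) F).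
Context (FT : forall x, U x -> F (x, T x) = 1).
Context (F't : forall x t, U x -> 0 < 'D_(0, 1) F (x, t)).

Let DF (x : V) (t : R) : U x -> is_derive t 1 (fun s => F (x, s)) ('D_(0, 1) F (x, t)).
Proof.
move=> Ux; have [Y [oY Yx CY]] := sF t Ux; have [dF _] := CY 1%N.
have dFx := dF _ Yx.
have E : (fun h : R => h^-1 *: (F (x, h *: 1 + t) - F (x, t))) =
  (fun h : R => h^-1 *: (F (h *: (0, 1) + (x, t)) - F (x, t))).
  apply/funext => h; congr (_ *: (F _ - _)).
  rewrite -[RHS]/((h *: (0 : V) + x, h *: (1 : R) + t)).
  by rewrite scaler0 add0r.
have := @diff_derivable _ _ _ F (x, t) (0, 1) dFx.
rewrite /derivable => D1.
split; first by rewrite /derivable E.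
by rewrite /derive E.
Qed.

Let cF x (t : R) : U x -> {for (x, t), continuous F}.
Proof. by move=> /(sF t)/smooth_near_continuous. Qed.

(** The intermediate point is located by its distance to [s]. This treats both orders of [s] and
    [t], and lets it converge when [t] tends to [s]. *)
Let F_mvt x (s t : R) : U x -> exists2 xi, `|xi - s| <= `|t - s| &
  F (x, t) - F (x, s) = 'D_(0, 1) F (x, xi) * (t - s).
Proof.
move=> Ux.
have cont (a b : R) : {within `[a, b], continuous (fun s => F (x, s))}.
  apply: continuous_subspaceT => u; apply: differentiable_continuous.
  by apply/derivable1_diffP; have := DF u Ux; case.
have [st|ts|->] := ltgtP s t; last by exists t; rewrite ?subrr ?mulr0.
- have [xi + E] := MVT st (fun u _ => DF u Ux) (cont _ _).
  rewrite in_itv /= => /andP[h1 h2]; exists xi => //.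
  by rewrite !ger0_norm ?subr_ge0 ?ltW // ltrD2r.
- have [xi + E] := MVT ts (fun u _ => DF u Ux) (cont _ _).
  rewrite in_itv /= => /andP[h1 h2]; exists xi.
    by rewrite !ler0_norm ?subr_le0 ?ltW // ltrN2 ltrD2r.
  by rewrite -[LHS]opprB E -mulrN opprB.
Qed.

(** [F] increases in time, so it lies below 1 at [T x - e] and above 1 at [T x + e]. Both
    inequalities persist near [x] and trap [T]. *)
Lemma implicit_continuous x : U x -> {for x, continuous T}.
Proof.
move=> Ux; apply/cvgrPdist_lt => e e0.
have Fmono y (s t : R) : U y -> s < t -> F (y, s) < F (y, t).
  move=> Uy st; rewrite -subr_gt0; have [xi _ ->] := F_mvt s t Uy.
  by rewrite mulr_gt0 ?F't ?subr_gt0.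
have cFt (t : R) : {for x, continuous (fun y => F (y, t))}.
  apply: (continuous_for_comp (f := fun y => (y, t))); last exact: cF.
  by apply: continuous_pair; [exact: cvg_id|exact: cst_continuous].
have lo : F (x, T x - e) < 1 by rewrite -(FT Ux) Fmono // ltrBlDr ltrDl.
have hi : 1 < F (x, T x + e) by rewrite -(FT Ux) Fmono // ltrDl.
have nlo : nbhs x ((fun y => F (y, T x - e)) @^-1` [set u | u < 1]).
  by apply: cFt; apply: open_nbhs_nbhs; split=> //=; exact: open_lt.
have nhi : nbhs x ((fun y => F (y, T x + e)) @^-1` [set u | 1 < u]).
  by apply: cFt; apply: open_nbhs_nbhs; split=> //=; exact: open_gt.
have nU := open_nbhs_nbhs (conj oU Ux).
apply: filterS3 nlo nhi nU => y ylo yhi Uy.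
have Fle s t : s <= t -> F (y, s) <= F (y, t).
  by rewrite le_eqVlt => /orP[/eqP-> //|/(Fmono _ _ _ Uy)/ltW].
have h1 : T x - e < T y.
  rewrite ltNge; apply/negP => /Fle; rewrite FT // => H.
  by have := le_lt_trans H ylo; rewrite ltxx.
have h2 : T y < T x + e.
  rewrite ltNge; apply/negP => /Fle; rewrite FT // => H.
  by have := lt_le_trans yhi H; rewrite ltxx.
by rewrite ltr_norml; apply/andP; split; lra.
Qed.

(* F(x, T x) - F(x, t0) = F_t(x, xi) (T x - t0) displays T - t0 as the product
   of a differentiable function vanishing at x0 and a continuous one *)
Lemma implicit_derive x : U x -> differentiable T x /\
  forall v, 'D_v T x = - 'D_(v, 0) F (x, T x) / 'D_(0, 1) F (x, T x).
Proof.
move=> Ux; pose t0 := T x.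
pose h y := 1 - F (y, t0).
have [Y [oY Yx CY]] := sF t0 Ux; have [dF DFC] := CY 2%N; rewrite /= in DFC.
have dFx := dF _ Yx.
have di : differentiable (fun y : V => (y, t0)) x.
  by apply: differentiable_pair; [exact: (@ex_diff _ _ _ _ _ id id)|exact: differentiable_cst].
have dFt : differentiable (fun y => F (y, t0)) x.
  exact: (differentiable_comp (f := fun y : V => (y, t0)) (g := F)).
have dh : differentiable h x.
  by apply: differentiableB => //; exact: differentiable_cst.
have hx : h x = 0 by rewrite /h FT // subrr.
(* [T y - t0] is [h y * k y] on [U]. Where [h] vanishes the quotient says nothing, and the value
   given is the limit demanded by continuity of [k] at [x]. *)
pose k y := if h y == 0 then ('D_(0, 1) F (x, t0))^-1 else (T y - t0) / h y.
have Ft0 : 'D_(0, 1) F (x, t0) != 0 by rewrite gt_eqF // F't.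
have kx : k x = ('D_(0, 1) F (x, t0))^-1 by rewrite /k hx eqxx.
have kE y : U y -> exists2 xi, `|xi - t0| <= `|T y - t0| & h y != 0 ->
    k y = ('D_(0, 1) F (y, xi))^-1.
  move=> Uy; have [xi xi1 E] := F_mvt t0 (T y) Uy.
  exists xi => // hy; rewrite /k (negbTE hy).
  move: hy; rewrite /h -{1 2}(FT Uy) E => hy.
  have Fx : 'D_(0, 1) F (y, xi) != 0 by rewrite gt_eqF // F't.
  have ty : T y - t0 != 0 by apply: contra hy => /eqP->; rewrite mulr0.
  by rewrite invfM mulrCA divff // mulr1.
have hk y : U y -> T y = t0 + h y * k y.
  move=> Uy; rewrite /k; case: eqP => [h0|/eqP hn0].
    rewrite h0 mul0r addr0; have [xi _ E] := F_mvt t0 (T y) Uy.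
    move: E; rewrite FT // -/(h y) h0 => /esym/eqP.
    by rewrite mulf_eq0 gt_eqF ?F't //= subr_eq0 => /eqP.
  by rewrite mulrCA divff // mulr1 addrC subrK.
have ck : {for x, continuous k}.
  apply/cvgrPdist_lt => e e0; rewrite kx.
  have cD0 := differentiable_continuous ((DFC (0, 1)).1 _ Yx).
  have cD : {for (x, t0), continuous (fun q => ('D_(0, 1) F q)^-1)}.
    exact: cvgV Ft0 cD0.
  have /cvgrPdist_lt/(_ _ e0)[[A B] /= [nA nB] AB] := cD.
  have [d /= d0 dB] := (nbhs_ballP _ _).1 nB.
  have nT : \forall y \near x, `|T x - T y| < d.
    by have /cvgrPdist_lt/(_ _ d0) := implicit_continuous Ux.
  have nU := open_nbhs_nbhs (conj oU Ux).
  apply: filterS3 nA nT nU => y Ay Ty Uy.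
  have [hy|hy] := eqVneq (h y) 0; first by rewrite /k hy eqxx subrr normr0.
  have [xi xi1 ->] // := kE _ Uy.
  apply: (AB (y, xi)); split=> //=; apply: dB; rewrite -ball_normE /=.
  by rewrite distrC (le_lt_trans xi1) // distrC.
have [dhk Dhk] := caratheodory_derive dh hx ck.
have nU := open_nbhs_nbhs (conj oU Ux).
have nT : \forall y \near x, t0 + h y * k y = T y.
  by apply: filterS nU => y /hk ->.
have ds : differentiable (fun y => t0 + h y * k y) x.
  by apply: differentiableD => //; exact: differentiable_cst.
split=> [|v]; first exact: differentiable_eq_near ds.
rewrite -(near_eq_derive _ nT).
have -> : 'D_v (fun y => t0 + h y * k y) x = 'D_v (fun y => h y * k y) x.
  have := deriveD (derivable_cst t0 x v) (diff_derivable (v := v) dhk).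
  by rewrite derive_cst add0r.
rewrite Dhk kx mulrC; congr (_ / _).
have -> : 'D_v h x = - 'D_v (fun y => F (y, t0)) x.
  have := deriveB (derivable_cst (1 : R) x v) (diff_derivable (v := v) dFt).
  by rewrite derive_cst sub0r.
congr (- _).
rewrite deriveE // (diff_comp (f := fun y : V => (y, t0)) (g := F)) //=.
have did : differentiable (fun y : V => y) x by exact: (@ex_diff _ _ _ _ _ id id).
rewrite (diff_pair did (differentiable_cst t0 x)).
by rewrite deriveE // diff_cst (@diff_val _ _ _ _ _ id id).
Qed.

(** Bootstrapping: [implicit_derive] expresses the derivatives of [T] as a smooth function of [y]
    and [T y], so class [k] of [T] yields class [k.+1]. *)
Lemma implicit_smooth x : U x -> smooth_near x T.
Proof.
move=> Ux; exists U; split=> // k; elim: k => [|k IH].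
  by move=> y; exact: implicit_continuous.
split=> [y Uy|v]; first by have [] := implicit_derive Uy.
pose Y := U `*` [set: R].
have oY : open Y.
  by rewrite openE => -[y t] [/= Uy _]; exists (U, setT) => //=; split;
    [exact: open_nbhs_nbhs|exact: filterT].
have CF j : Ck j Y F.
  apply: Ck_local => -[y t] [/= Uy _]; have [W [oW Wy CW]] := sF t Uy.
  by exists W.
have CDF w : Ck k Y ('D_w F) by have [_ /(_ w)] := CF k.+1.
have Ft0 q : Y q -> 'D_(0, 1) F q != 0.
  by move: q => [y t] [/= Uy _]; rewrite gt_eqF // F't.
have CT : Ck k U (fun y => (y, T y)).
  by apply: Ck_pair => //; apply: (@Ck_linear _ V V k U idfun) => // y; exact: cvg_id.
have CG := CkM oY (CkN oY (CDF (v, 0))) (CkV oY Ft0 (CDF (0, 1))).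
have CC := Ck_comp oU oY (fun y Uy => conj Uy I : Y (y, T y)) CT CG.
by apply: (Ck_eq oU _ (CC _ _)) => y Uy /=; have [_ ->] := implicit_derive Uy.
Qed.
End ImplicitFunction.
End Hitting.

Section LinearFlow.
Context {R : realType}.

Definition linear_flow p (A : R -> 'M[R]_p) (M : 'M[R]_p) :=
  [/\ forall s t, A (s + t) = A s *m A t, A 0 = 1%:M,
      forall t, smooth_near t A & 'D_1 A 0 = M].

Lemma smooth_near_differentiable (V W : normedModType R) (f : V -> W) x :
  smooth_near x f -> differentiable f x.
Proof. by move=> [U [_ Ux /(_ 1%N)[df _]]]; exact: df. Qed.

Lemma derive_lin (V W Z : normedModType R) (f : V -> W) (L : {linear W -> Z})
    (x v : V) : continuous L -> differentiable f x ->
  'D_v (fun y => L (f y)) x = L ('D_v f x).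
Proof.
move=> cL df; have dL y : differentiable L y by exact: linear_differentiable.
have dLf : differentiable (fun y => L (f y)) x by exact: (differentiable_comp (g := L)).
by rewrite (deriveE v dLf) (deriveE v df) (diff_comp (g := L)) //= diff_lin.
Qed.

(** Derivatives at different points, or of functions on different spaces, are compared through
    increments. The group law enters here, as in [A (h + t) - A t = (A h - A 0) A t]. *)
Lemma eq_derive_growth (V V' W : normedModType R) (f : V -> W) (g : V' -> W)
    (x v : V) (y v' : V') :
  (forall h : R, f (h *: v + x) - f x = g (h *: v' + y) - g y) ->
  'D_v f x = 'D_v' g y.
Proof.
move=> E; rewrite /derive.
have -> // : (fun h => h^-1 *: ((f \o shift x) (h *: v) - f x)) =
  (fun h => h^-1 *: ((g \o shift y) (h *: v') - g y)).
by apply/funext => h; rewrite /= E.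
Qed.

Lemma mulmxr_continuous m n p (B : 'M[R]_(n, p)) :
  continuous (mulmxr B : 'M[R]_(m, n) -> 'M[R]_(m, p)).
Proof.
move=> X; apply: smooth_near_continuous; apply: smooth_near_mulmx.
  exact: smooth_near_id.
exact: smooth_near_cst.
Qed.

Lemma mulmxl_continuous m n p (B : 'M[R]_(m, n)) :
  continuous (mulmx B : 'M[R]_(n, p) -> 'M[R]_(m, p)).
Proof.
move=> X; apply: smooth_near_continuous; apply: smooth_near_mulmx.
  exact: smooth_near_cst.
exact: smooth_near_id.
Qed.

Lemma derive_entry (V : normedModType R) m n (f : V -> 'M[R]_(m, n)) (x v : V) i j :
  differentiable f x -> 'D_v (fun y => f y i j) x = ('D_v f x) i j.
Proof.
move=> df; apply: (derive_lin (L := entry (i, j))) => //.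
exact: coord_continuous.
Qed.

Lemma differentiable_entry (V : normedModType R) m n (f : V -> 'M[R]_(m, n)) (x : V) i j :
  differentiable f x -> differentiable (fun y => f y i j) x.
Proof.
move=> df; apply: (differentiable_comp (f := f) (g := fun N => N i j)) => //.
exact: differentiable_coord.
Qed.

Lemma derive_sumr (V : normedModType R) (I : Type) (r : seq I) (f : I -> V -> R) (x v : V) :
  (forall i, differentiable (f i) x) ->
  'D_v (fun y => \sum_(i <- r) f i y) x = \sum_(i <- r) 'D_v (f i) x.
Proof.
move=> df; have H : differentiable (fun y => \sum_(i <- r) f i y) x /\
   'D_v (fun y => \sum_(i <- r) f i y) x = \sum_(i <- r) 'D_v (f i) x; last by case: H.
elim: r => [|i r [IH1 IH2]].
  under eq_fun do rewrite big_nil; rewrite big_nil.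
  by split; [exact: differentiable_cst|exact: derive_cst].
under eq_fun do rewrite big_cons; rewrite big_cons -IH2; split.
  exact: differentiableD.
by apply: (@deriveD _ _ _ (f i)) => //; exact: diff_derivable.
Qed.

Lemma derive_mulmx (V : normedModType R) m n p (f : V -> 'M[R]_(m, n))
    (g : V -> 'M[R]_(n, p)) (x v : V) :
  smooth_near x f -> smooth_near x g ->
  'D_v (fun y => f y *m g y) x = 'D_v f x *m g x + f x *m 'D_v g x.
Proof.
move=> sf sg; have [df dg] := (smooth_near_differentiable sf, smooth_near_differentiable sg).
have dfg := smooth_near_differentiable (smooth_near_mulmx sf sg).
apply/matrixP => i k; rewrite -derive_entry // !mxE -big_split /=.
under eq_fun do rewrite mxE.
rewrite derive_sumr => [|j]; last first.
  by apply: differentiableM; exact: differentiable_entry.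
apply: eq_bigr => j _.
have := @deriveM _ _ (fun y => f y i j) (fun y => g y j k) x v
  (diff_derivable (differentiable_entry i j df))
  (diff_derivable (differentiable_entry j k dg)).
move=> ->; rewrite !derive_entry // /GRing.scale /= addrC.
by congr (_ + _); rewrite mulrC.
Qed.

Section FlowTheory.
Context (p : nat) (A : R -> 'M[R]_p) (M : 'M[R]_p) (fA : linear_flow A M).

Lemma flowD s t : A (s + t) = A s *m A t. Proof. by case: fA. Qed.
Lemma flow0 : A 0 = 1%:M. Proof. by case: fA. Qed.
Lemma flow_smooth t : smooth_near t A. Proof. by case: fA. Qed.
Lemma flowK t : A t *m A (- t) = 1%:M. Proof. by rewrite -flowD subrr flow0. Qed.
Lemma flowNK t : A (- t) *m A t = 1%:M. Proof. by rewrite -flowD addNr flow0. Qed.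

Lemma flow_derive t : 'D_1 A t = M *m A t.
Proof.
have [_ _ sA <-] := fA; have dA := smooth_near_differentiable (sA 0).
have := derive_lin (L := mulmxr (A t)) (1 : R) (@mulmxr_continuous p p p (A t)) dA.
move=> /= <-.
apply: eq_derive_growth => h /=.
by rewrite -!flowD addr0 add0r.
Qed.

Lemma flow_comm_gen t : A t *m M = M *m A t.
Proof.
rewrite -flow_derive; have [_ _ sA <-] := fA.
have := derive_lin (L := mulmx (A t)) (1 : R) (@mulmxl_continuous p p p (A t))
  (smooth_near_differentiable (sA 0)).
move=> /= <-.
apply: eq_derive_growth => h /=.
by rewrite -!flowD !addr0 [t + _]addrC.
Qed.

Lemma flow_opp : linear_flow (fun t => A (- t)) (- M).
Proof.
have sN (t : R) : smooth_near t (fun s : R => - s).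
  by apply: smooth_nearN; exact: smooth_near_id.
split.
- by move=> s t; rewrite opprD flowD.
- by rewrite oppr0 flow0.
- by move=> t; apply: (smooth_near_comp (flow_smooth (- t)) (sN t)).
have dA : differentiable A (- 0) by apply/smooth_near_differentiable/flow_smooth.
have dN : differentiable (fun s : R => - s) 0 by exact/smooth_near_differentiable/sN.
have dAN : differentiable (fun s : R => A (- s)) 0.
  exact: (differentiable_comp (f := fun s : R => - s)).
rewrite deriveE // (diff_comp (f := fun s : R => - s) (g := A)) //=.
rewrite -(deriveE (1 : R) dN).
have -> : 'D_1 (fun s : R => - s) 0 = - 1.
  by have [_ E] := is_deriveNid (0 : R) (1 : R); exact: E.
rewrite linearN -deriveE //; congr (- _).
by rewrite oppr0; case: fA.
Qed.

Lemma smooth_near_flow_mul (q : nat) (X : 'M[R]_(p, q)) (t : R) :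
  smooth_near t (fun s => A s *m X).
Proof.
by apply: smooth_near_mulmx; [exact: flow_smooth|exact: smooth_near_cst].
Qed.

Lemma energy_derive (x : 'cV[R]_p) t :
  'D_1 (fun s => rdotmx (A s *m x) (A s *m x)) t =
  2 * rdotmx (A t *m x) (M *m (A t *m x)).
Proof.
have dAx := smooth_near_differentiable (smooth_near_flow_mul x t).
have DAx : 'D_1 (fun s => A s *m x) t = M *m (A t *m x).
  have := derive_lin (L := mulmxr x) (1 : R) (@mulmxr_continuous p p 1 x)
    (smooth_near_differentiable (flow_smooth t)).
  by move=> /= ->; rewrite flow_derive mulmxA.
have dAxi i := differentiable_entry i 0 dAx.
rewrite /rdotmx derive_sumr => [|i]; last exact: differentiableM.
rewrite mulr_sumr; apply: eq_bigr => i _.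
have := @deriveM _ _ (fun s => (A s *m x) i 0) (fun s => (A s *m x) i 0) t 1
  (diff_derivable (dAxi i)) (diff_derivable (dAxi i)).
by move=> ->; rewrite derive_entry // DAx /GRing.scale /=; ring.
Qed.

(** The function [A (- s) K A s] has derivative zero, so it keeps its value [K] at [s = 0]. *)
Lemma flow_comm (K : 'M[R]_p) t : K *m M = M *m K -> K *m A t = A t *m K.
Proof.
move=> KM; pose f s := A (- s) *m (K *m A s).
have sKA s : smooth_near s (fun s => K *m A s).
  by apply: smooth_near_mulmx; [exact: smooth_near_cst|exact: flow_smooth].
have sAN s : smooth_near s (fun s => A (- s)) by have [_ _ sm _] := flow_opp; exact: sm.
have Df s : 'D_1 f s = 0.
  rewrite /f derive_mulmx //.
  have -> : 'D_1 (fun s => K *m A s) s = K *m (M *m A s).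
    have := derive_lin (L := mulmx K) (1 : R) (@mulmxl_continuous p p p K)
      (smooth_near_differentiable (flow_smooth s)).
    by move=> /= ->; rewrite flow_derive.
  have fo := flow_opp.
  have -> : 'D_1 (fun s => A (- s)) s = - (M *m A (- s)).
    have [_ _ so _] := fo.
    have dso := smooth_near_differentiable (so 0).
    have := derive_lin (L := mulmxr (A (- s))) (1 : R) (@mulmxr_continuous p p p (A (- s))) dso.
    have [_ _ _ ->] := fo; rewrite /= mulNmx => <-.
    apply: eq_derive_growth => h /=.
    by rewrite -!flowD addr0 oppr0 add0r -opprD.
  rewrite (mulmxA K) KM -flow_comm_gen mulNmx -!mulmxA addrC.
  by rewrite subrr.
have fE i j : f t i j = f 0 i j.
  apply: (@is_derive_0_is_cst _ (fun s => f s i j)) => s.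
  have dfs : differentiable f s.
    by apply: smooth_near_differentiable; apply: smooth_near_mulmx.
  have := diff_derivable (v := (1 : R)) (differentiable_entry i j dfs).
  by move/derivableP; rewrite derive_entry // Df mxE.
have fK : f t = K.
  apply/matrixP => i j; rewrite fE /f oppr0 flow0 mulmx1 mul1mx //.
by rewrite -[in RHS]fK /f mulmxA flowK mul1mx.
Qed.

Section Dissipative.
Context (c : R)
  (dM : forall x, rdotmx x (M *m x) <= - c * rdotmx x x).

Let phi x t := rdotmx (A t *m x) (A t *m x).

(** Gronwall: the energy multiplied by [expR (2 * c * u)] has nonpositive derivative. *)
Lemma energy_decay x s t : s <= t ->
  rdotmx (A t *m x) (A t *m x) <=
  expR (- (2 * c * (t - s))) * rdotmx (A s *m x) (A s *m x).
Proof.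
move=> st; rewrite -/(phi x t) -/(phi x s).
pose psi u := expR (2 * c * u) * phi x u.
have dphi u : derivable (phi x) u 1.
  apply/derivable1_diffP; rewrite /phi /rdotmx.
  apply: smooth_near_differentiable; apply: smooth_near_sum => i.
  by apply: smooth_nearM; exact/smooth_near_entry/smooth_near_flow_mul.
have dphiP u := derivableP (dphi u).
have dlin (u : R) : is_derive u 1 (fun u : R => 2 * c * u) (2 * c).
  have := @is_deriveZ _ _ _ (id : R -> R) (2 * c) u 1 1 (is_derive_id u 1).
  by rewrite /GRing.scale /= mulr1.
have dexp (u : R) : is_derive u 1 (fun u => expR (2 * c * u)) (expR (2 * c * u) * (2 * c)).
  apply: (@is_derive1_comp _ expR (fun u : R => 2 * c * u)).
have dpsi (u : R) : is_derive u 1 psi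
    (expR (2 * c * u) * (2 * rdotmx (A u *m x) (M *m (A u *m x)) + 2 * c * phi x u)).
  have H : is_derive u 1 psi _ := is_deriveM (dexp u) (dphiP u).
  apply: (is_derive_eq H); rewrite energy_derive /GRing.scale /=.
  by rewrite /phi; ring.
have : psi t <= psi s.
  apply: (@ler0_derive1_nincry _ psi s) => //.
  - move=> u _; rewrite derive1E; have [_ ->] := dpsi u.
    rewrite pmulr_rle0 ?expR_gt0 //.
    by have := dM (A u *m x); rewrite -/(phi x u); lra.
  - apply: continuous_subspaceT => u; apply: differentiable_continuous.
    by apply/derivable1_diffP; have := dpsi u; case.
rewrite /psi mulrBr opprB expRD expRN -ler_pdivlMl ?expR_gt0 //.
by rewrite mulrA [_^-1 * _]mulrC.
Qed.

End Dissipative.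
End FlowTheory.
End LinearFlow.

Section HittingTime.
Context {R : realType} (p : nat) (A : R -> 'M[R]_p) (M : 'M[R]_p)
  (fA : linear_flow A M) (c : R) (c0 : 0 < c)
  (dM : forall x, rdotmx x (M *m x) <= - c * rdotmx x x).

Definition energy (x : 'cV[R]_p) (t : R) : R :=
  rdotmx (A (- t) *m x) (A (- t) *m x).

(* the time at which the backward flow of x meets the unit sphere *)
Definition hit (x : 'cV[R]_p) : R := xget 0 [set t | energy x t = 1].

Lemma rdotmx_gt0 n (x : 'cV[R]_n) : x != 0 -> 0 < rdotmx x x.
Proof. by move=> x0; rewrite lt_def rdotmx_eq0 x0 rdotmx_ge0. Qed.

Lemma flow_neq0 t (x : 'cV[R]_p) : x != 0 -> A t *m x != 0.
Proof.
apply: contra => /eqP Ax.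
by rewrite -[x]mul1mx -(flowNK fA t) -mulmxA Ax mulmx0.
Qed.

Lemma smooth_near_energy q :
  smooth_near q (fun q : 'cV[R]_p * R => energy q.1 q.2).
Proof.
apply: smooth_near_sum => i.
have s : smooth_near q (fun q : 'cV[R]_p * R => (A (- q.2) *m q.1) i 0).
  apply: smooth_near_entry; apply: smooth_near_mulmx.
    apply: (smooth_near_comp (f := fun q : 'cV[R]_p * R => - q.2)).
      exact: flow_smooth fA _.
    by apply: smooth_nearN; exact/smooth_near_snd/smooth_near_id.
  exact/smooth_near_fst/smooth_near_id.
exact: smooth_nearM.
Qed.

Lemma energy_derive_gt0 (x : 'cV[R]_p) t : x != 0 ->
  0 < 'D_(0, 1) (fun q : 'cV[R]_p * R => energy q.1 q.2) (x, t).
Proof.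
move=> x0.
have -> : 'D_(0, 1) (fun q : 'cV[R]_p * R => energy q.1 q.2) (x, t) =
    'D_1 (energy x) t.
  apply: eq_derive_growth => h /=; congr (energy _ _ - _).
  exact: (etrans (congr1 (fun y => y + x) (scaler0 _ h)) (add0r x)).
rewrite (energy_derive (flow_opp fA)) pmulr_rgt0 //.
have := dM (A (- t) *m x); rewrite mulNmx.
have := rdotmx_gt0 (flow_neq0 (- t) x0).
set y := A (- t) *m x => y0.
have -> : rdotmx y (- (M *m y)) = - rdotmx y (M *m y).
  by rewrite /rdotmx -sumrN; apply: eq_bigr => i _; rewrite !mxE mulrN.
have := mulr_gt0 c0 y0; lra.
Qed.

Lemma energy_increasing (x : 'cV[R]_p) s t : x != 0 -> s < t ->
  energy x s < energy x t.
Proof.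
move=> x0 st.
have := @energy_decay _ _ _ _ fA c dM x (- t) (- s).
rewrite lerN2 => /(_ (ltW st)); rewrite -/(energy x s) -/(energy x t).
move=> /le_lt_trans; apply; rewrite gtr_pMl; last exact/rdotmx_gt0/flow_neq0.
rewrite -expR0 ltr_expR oppr_lt0 !mulr_gt0 //.
by rewrite opprK addrC subr_gt0.
Qed.

Lemma energy_hit x : x != 0 -> energy x (hit x) = 1.
Proof.
move=> x0; suff [t Et] : exists t, energy x t = 1.
  by rewrite /hit; case: xgetP => [y -> //|/(_ t)].
have N0 := rdotmx_gt0 x0; set N := rdotmx x x in N0.
have E0 : energy x 0 = N by rewrite /energy oppr0 (flow0 fA) mul1mx.
(* Both times come from [1 + x <= expR x]. Against time 0 the energy at [t1] gains at least the
   factor [expR N^-1], so it is at least 1; at [t2] it is at most [N * expR (- N)], so at most 1. *)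
pose t1 := (2 * c * N)^-1; pose t2 := - (N / (2 * c)).
have cN0 : 0 < 2 * c by rewrite mulr_gt0.
have t10 : 0 < t1 by rewrite invr_gt0 mulr_gt0.
have t20 : t2 <= 0 by rewrite oppr_le0 divr_ge0 ?ltW.
have E1 : 1 <= energy x t1.
  have := @energy_decay _ _ _ _ fA c dM x (- t1) 0.
  rewrite oppr_le0 => /(_ (ltW t10)).
  rewrite (flow0 fA) mul1mx -/N -/(energy x t1) sub0r opprK expRN.
  rewrite mulrC ler_pdivlMr ?expR_gt0 //; apply: le_trans.
  have -> : 2 * c * t1 = N^-1 by rewrite /t1 invfM mulrA divff ?mul1r // gt_eqF.
  have := expR_ge1Dx N^-1 => H.
  have H2 : N^-1 <= expR N^-1 by apply: le_trans H; rewrite lerDr.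
  by have := ler_wpM2l (ltW N0) H2; rewrite divff // gt_eqF.
have E2 : energy x t2 <= 1.
  have := @energy_decay _ _ _ _ fA c dM x 0 (- t2).
  rewrite oppr_ge0 => /(_ t20).
  rewrite (flow0 fA) mul1mx -/N -/(energy x t2) subr0 => /le_trans; apply.
  have -> : 2 * c * - t2 = N by rewrite /t2 opprK mulrCA divff ?mulr1 // gt_eqF.
  rewrite expRN mulrC ler_pdivrMr ?expR_gt0 // mul1r.
  by apply: le_trans (expR_ge1Dx N); rewrite lerDr.
have t21 : t2 <= t1 by exact: le_trans t20 (ltW t10).
have [||t _ Et] := @IVT R (energy x) t2 t1 1 t21; last by exists t.
  apply: continuous_subspaceT => u.
  apply: smooth_near_continuous.
  apply: (smooth_near_comp (f := fun u => (x, u)) (smooth_near_energy (x, u))).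
  by apply: smooth_near_pair; [exact: smooth_near_cst|exact: smooth_near_id].
by rewrite ge_min E2 le_max E1 orbT.
Qed.

Lemma hit_unique x t : x != 0 -> energy x t = 1 -> hit x = t.
Proof.
move=> x0 Et; have Eh := energy_hit x0.
have [ht|th|//] := ltgtP (hit x) t.
- by have := energy_increasing x0 ht; rewrite Et Eh ltxx.
- by have := energy_increasing x0 th; rewrite Et Eh ltxx.
Qed.

Lemma hit_flow x t : x != 0 -> hit (A t *m x) = hit x + t.
Proof.
move=> x0; apply: hit_unique; first exact: flow_neq0.
by rewrite /energy mulmxA -(flowD fA) opprD addrNK -/(energy _ _) energy_hit.
Qed.

Lemma hit_eq0 x : rdotmx x x = 1 -> hit x = 0.
Proof.
move=> x1; apply: hit_unique; last by rewrite /energy oppr0 (flow0 fA) mul1mx.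
by rewrite -rdotmx_eq0 x1 oner_eq0.
Qed.

Lemma open_neq0 (V : normedModType R) : open [set x : V | x != 0].
Proof.
have : closed [set (0 : V)].
  by apply: accessible_closed_set1; apply: hausdorff_accessible; exact: norm_hausdorff.
rewrite -openC; congr open; apply/seteqP; split=> x /=; first by move=> /eqP.
by move=> /eqP.
Qed.

Lemma smooth_near_hit (x : 'cV[R]_p) : x != 0 -> smooth_near x hit.
Proof.
move=> x0.
apply: (@implicit_smooth _ _ _ (fun q : 'cV[R]_p * R => energy q.1 q.2)
  [set x | x != 0]) => //.
- exact: open_neq0.
- by move=> y t _; exact: smooth_near_energy.
- exact: energy_hit.
- by move=> y t; exact: energy_derive_gt0.
Qed.
End HittingTime.

Section Block.
Context {R : realType} (p q : nat) (A : R -> 'M[R]_(p + q))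
  (Ms : 'M[R]_p) (Mu : 'M[R]_q)
  (fA : linear_flow A (block_mx Ms 0 0 Mu)).

(** The projection [K] on the first block commutes with the generator, hence with [A t]. *)
Lemma flow_block t : A t = block_mx (ulsubmx (A t)) 0 0 (drsubmx (A t)).
Proof.
pose K : 'M[R]_(p + q) := block_mx 1%:M 0 0 0.
have := flow_comm fA t (K := K).
rewrite {1 2}/K !mulmx_block !mulmx0 !mul0mx !mul1mx !mulmx1 !addr0 => /(_ erefl).
move: (A t) => X; rewrite -{1 2}[X]submxK /K !mulmx_block.
rewrite !mulmx0 !mul0mx !mul1mx !mulmx1 !addr0 => /eq_block_mx[_ ur dl _].
by rewrite -{1}[X]submxK ur -dl.
Qed.

Lemma flow_ul : linear_flow (fun t => ulsubmx (A t)) Ms.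
Proof.
have [AD A0 As dA] := fA; split.
- move=> s t; rewrite AD [A s]flow_block [A t]flow_block mulmx_block.
  by rewrite !mulmx0 !mul0mx !addr0 !block_mxKul.
- by rewrite A0 (scalar_mx_block _ _ 1) block_mxKul.
- move=> t; apply: smooth_near_mx => i j; under eq_fun do rewrite !mxE.
  exact: smooth_near_entry.
have dA0 := smooth_near_differentiable (As 0).
apply/matrixP => i j; rewrite -derive_entry; last first.
  apply: smooth_near_differentiable; apply: smooth_near_mx => k l.
  by under eq_fun do rewrite !mxE; exact: smooth_near_entry.
under eq_fun do rewrite !mxE.
by rewrite derive_entry // dA block_mxEul.
Qed.

Lemma flow_dr : linear_flow (fun t => drsubmx (A t)) Mu.
Proof.
have [AD A0 As dA] := fA; split.
- move=> s t; rewrite AD [A s]flow_block [A t]flow_block mulmx_block.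
  by rewrite !mulmx0 !mul0mx !add0r !block_mxKdr.
- by rewrite A0 (scalar_mx_block _ _ 1) block_mxKdr.
- move=> t; apply: smooth_near_mx => i j; under eq_fun do rewrite !mxE.
  exact: smooth_near_entry.
have dA0 := smooth_near_differentiable (As 0).
apply/matrixP => i j; rewrite -derive_entry; last first.
  apply: smooth_near_differentiable; apply: smooth_near_mx => k l.
  by under eq_fun do rewrite !mxE; exact: smooth_near_entry.
under eq_fun do rewrite !mxE.
by rewrite derive_entry // dA block_mxEdr.
Qed.
End Block.

(** * The projective action *)

Section ComplexSmooth.
Context {R : realType}.
Local Notation C := R[i].
Local Notation Re := (@complex.Re R).
Local Notation Im := (@complex.Im R).
Implicit Types V W : normedModType R.

Lemma nbhs_mxP (T : topologicalType) m n (X : 'M[T]_(m, n)) (B : set 'M[T]_(m, n)) :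
  nbhs X B <-> exists2 P : 'I_m -> 'I_n -> set T,
    (forall i j, nbhs (X i j) (P i j)) &
    [set Y : 'M[T]_(m, n) | forall i j, P i j (Y i j)] `<=` B.
Proof. by []. Qed.

Lemma continuous_mx (S T : topologicalType) m n (f : S -> 'M[T]_(m, n)) x :
  (forall i j, {for x, continuous (fun y => f y i j)}) -> {for x, continuous f}.
Proof.
move=> cf B /nbhs_mxP[P nP PB].
have nf : \forall y \near x, forall i j, P i j (f y i j).
  apply: filter_forall => i; apply: filter_forall => j.
  exact: (cf i j) (nP i j).
by apply: filterS nf => y /PB.
Qed.

Lemma continuous_entry (T : topologicalType) m n i j (X : 'M[T]_(m, n)) :
  {for X, continuous (fun Y : 'M[T]_(m, n) => Y i j)}.
Proof.
move=> B nB; apply/nbhs_mxP.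
exists (fun k l => if (k == i) && (l == j) then B else setT).
  by move=> k l; case: ifP => [/andP[/eqP-> /eqP->]//|_]; exact: filterT.
by move=> Y /(_ i j); rewrite !eqxx.
Qed.

Lemma continuous_Re (z : C) : {for z, continuous Re}.
Proof.
move=> B /nbhs_ballP[e /= e0 eB]; apply/nbhs_ballP; exists e%:C%C => /=.
  by rewrite ltcR.
move=> y; rewrite -ball_normE /= => zy; apply: eB; rewrite -ball_normE /=.
rewrite -ltcR; apply: le_lt_trans zy.
case: z y => [a b] [a' b']; rewrite normc_def /= lecR.
rewrite -sqrtr_sqr; apply: ler_wsqrtr; rewrite lerDl; exact: sqr_ge0.
Qed.

Lemma continuous_Im (z : C) : {for z, continuous Im}.
Proof.
move=> B /nbhs_ballP[e /= e0 eB]; apply/nbhs_ballP; exists e%:C%C => /=.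
  by rewrite ltcR.
move=> y; rewrite -ball_normE /= => zy; apply: eB; rewrite -ball_normE /=.
rewrite -ltcR; apply: le_lt_trans zy.
case: z y => [a b] [a' b']; rewrite normc_def /= lecR.
rewrite -sqrtr_sqr; apply: ler_wsqrtr; rewrite lerDr; exact: sqr_ge0.
Qed.

Lemma continuous_complex (T : topologicalType) (f : T -> C) x :
  {for x, continuous (fun y => Re (f y))} ->
  {for x, continuous (fun y => Im (f y))} -> {for x, continuous f}.
Proof.
move=> cr ci B /nbhs_ballP[[e e'] /= e0 eB].
(* The norm of [R[i]] is valued in [R[i]], so the radius is a complex number; positivity forces its
   imaginary part to vanish. *)
move: e0; rewrite ltcE /= => /andP[/eqP e'0 e0].
have e20 : 0 < e / 2 by exact: divr_gt0.
have nr : \forall y \near x, `|Re (f x) - Re (f y)| < e / 2.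
  by have /cvgrPdist_lt/(_ _ e20) := cr.
have ni : \forall y \near x, `|Im (f x) - Im (f y)| < e / 2.
  by have /cvgrPdist_lt/(_ _ e20) := ci.
apply: filterS2 nr ni => y; case: (f x) eB => [a b] eB; case E : (f y) => [a' b'].
move=> /= r1 r2; rewrite /preimage /= E; apply: eB; rewrite -ball_normE /=.
rewrite normc_def /= ltcE /= -e'0 eqxx /=.
set u := a - a' in r1 *; set v := b - b' in r2 *.
have H : u ^+ 2 + v ^+ 2 <= (`|u| + `|v|) ^+ 2.
  rewrite -(real_normK (num_real u)) -(real_normK (num_real v)).
  by have := mulr_ge0 (normr_ge0 u) (normr_ge0 v); lra.
apply: le_lt_trans (ler_wsqrtr H) _.
by rewrite sqrtr_sqr ger0_norm ?addr_ge0 // [e]splitr ltrD.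
Qed.

Definition csmooth V (x : V) (f : V -> C) :=
  smooth_near x (fun y => Re (f y)) /\ smooth_near x (fun y => Im (f y)).

Lemma csmooth_cst V (x : V) (a : C) : csmooth x (fun _ => a).
Proof. by split; exact: smooth_near_cst. Qed.

Lemma csmoothD V (x : V) (f g : V -> C) :
  csmooth x f -> csmooth x g -> csmooth x (fun y => f y + g y).
Proof.
move=> [f1 f2] [g1 g2]; split; under eq_fun do rewrite raddfD /=;
  exact: smooth_nearD.
Qed.

Lemma csmoothM V (x : V) (f g : V -> C) :
  csmooth x f -> csmooth x g -> csmooth x (fun y => f y * g y).
Proof.
move=> [f1 f2] [g1 g2]; split.
- apply: (smooth_near_ext (f := fun y => Re (f y) * Re (g y) - Im (f y) * Im (g y))).
    by move=> y; case: (f y) => ? ?; case: (g y).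
  by apply: smooth_nearB; exact: smooth_nearM.
- apply: (smooth_near_ext (f := fun y => Re (f y) * Im (g y) + Im (f y) * Re (g y))).
    by move=> y; case: (f y) => ? ?; case: (g y).
  by apply: smooth_nearD; exact: smooth_nearM.
Qed.

Lemma csmoothV V (x : V) (f : V -> C) : f x != 0 ->
  csmooth x f -> csmooth x (fun y => (f y)^-1).
Proof.
move=> fx0 [f1 f2].
have s : smooth_near x (fun y => (Re (f y) ^+ 2 + Im (f y) ^+ 2)^-1).
  apply: smooth_nearV; last first.
    exact: (smooth_nearD (smooth_nearM f1 f1) (smooth_nearM f2 f2)).
  apply: contra fx0; rewrite paddr_eq0 ?sqr_ge0 // !sqrf_eq0.
  by case: (f x) => a b /= /andP[/eqP-> /eqP->].
split.
- apply: (smooth_near_ext (f := fun y => Re (f y) * (Re (f y) ^+ 2 + Im (f y) ^+ 2)^-1)).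
    by move=> y; case: (f y).
  exact: smooth_nearM.
- apply: (smooth_near_ext (f := fun y => - (Im (f y) * (Re (f y) ^+ 2 + Im (f y) ^+ 2)^-1))).
    by move=> y; case: (f y).
  by apply: smooth_nearN; exact: smooth_nearM.
Qed.

Definition csmooth_mx V m n (x : V) (f : V -> 'M[C]_(m, n)) :=
  forall i j, csmooth x (fun y => f y i j).

Lemma csmooth_mulmx V m n p (x : V) (f : V -> 'M[C]_(m, n)) (g : V -> 'M[C]_(n, p)) :
  csmooth_mx x f -> csmooth_mx x g -> csmooth_mx x (fun y => f y *m g y).
Proof.
move=> sf sg i j.
suff H (r : seq 'I_n) : csmooth x (fun y => \sum_(k <- r) f y i k * g y k j).
  by have := H (index_enum _); congr csmooth; apply/funext => y; rewrite mxE.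
elim: r => [|k r IH].
  by under eq_fun do rewrite big_nil; exact: csmooth_cst.
by under eq_fun do rewrite big_cons; apply: csmoothD => //; exact: csmoothM.
Qed.

Lemma csmooth_mx_cst V m n (x : V) (X : 'M[C]_(m, n)) : csmooth_mx x (fun _ => X).
Proof. by move=> i j; exact: csmooth_cst. Qed.

Lemma csmooth_mx_scale V m n (x : V) (c : V -> C) (f : V -> 'M[C]_(m, n)) :
  csmooth x c -> csmooth_mx x f -> csmooth_mx x (fun y => c y *: f y).
Proof.
by move=> sc sf i j; under eq_fun do rewrite mxE; exact: csmoothM.
Qed.

Lemma csmooth_real V (x : V) (f : V -> R) :
  smooth_near x f -> csmooth x (fun y => (f y)%:C%C).
Proof. by move=> sf; split=> //=; exact: smooth_near_cst. Qed.

Lemma smooth_near_Re_mx V m n (x : V) (f : V -> 'M[C]_(m, n)) :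
  csmooth_mx x f -> smooth_near x (fun y => map_mx Re (f y)).
Proof.
by move=> sf; apply: smooth_near_mx => i j; under eq_fun do rewrite mxE; case: (sf i j).
Qed.

Lemma smooth_near_Im_mx V m n (x : V) (f : V -> 'M[C]_(m, n)) :
  csmooth_mx x f -> smooth_near x (fun y => map_mx Im (f y)).
Proof.
by move=> sf; apply: smooth_near_mx => i j; under eq_fun do rewrite mxE; case: (sf i j).
Qed.

Definition of_reim m n (p : 'M[R]_(m, n) * 'M[R]_(m, n)) : 'M[C]_(m, n) :=
  map2_mx (@Complex R) p.1 p.2.
Definition reim m n (z : 'M[C]_(m, n)) : 'M[R]_(m, n) * 'M[R]_(m, n) :=
  (map_mx Re z, map_mx Im z).

Lemma reimK m n : cancel (@reim m n) (@of_reim m n).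
Proof. by move=> z; apply/matrixP => i j; rewrite !mxE; case: (z i j). Qed.

Lemma of_reimK m n : cancel (@of_reim m n) (@reim m n).
Proof.
by move=> [x y]; congr pair; apply/matrixP => i j; rewrite !mxE.
Qed.

Lemma csmooth_of_reim m n (p : 'M[R]_(m, n) * 'M[R]_(m, n)) :
  csmooth_mx p (@of_reim m n).
Proof.
move=> i j; split.
- apply: (smooth_near_ext (f := fun q : 'M[R]_(m, n) * 'M[R]_(m, n) => q.1 i j)).
    by move=> q; rewrite mxE.
  exact/smooth_near_entry/smooth_near_fst/smooth_near_id.
- apply: (smooth_near_ext (f := fun q : 'M[R]_(m, n) * 'M[R]_(m, n) => q.2 i j)).
    by move=> q; rewrite mxE.
  exact/smooth_near_entry/smooth_near_snd/smooth_near_id.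
Qed.

Lemma csmooth_continuous V m n (x : V) (f : V -> 'M[C]_(m, n)) :
  csmooth_mx x f -> {for x, continuous f}.
Proof.
move=> sf; apply: continuous_mx => i j; have [s1 s2] := sf i j.
by apply: continuous_complex; exact: smooth_near_continuous.
Qed.

Lemma continuous_reim m n (z : 'M[C]_(m, n)) : {for z, continuous (@reim m n)}.
Proof.
apply: continuous_pair; apply: continuous_mx => i j.
- have -> : (fun y : 'M[C]_(m, n) => map_mx Re y i j) = (fun y => Re (y i j)).
    by apply/funext => y; rewrite mxE.
  apply: (@continuous_for_comp _ _ _ (fun y : 'M[C]_(m, n) => y i j) Re).
    exact: continuous_entry.
  exact: continuous_Re.
- have -> : (fun y : 'M[C]_(m, n) => map_mx Im y i j) = (fun y => Im (y i j)).
    by apply/funext => y; rewrite mxE.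
  apply: (@continuous_for_comp _ _ _ (fun y : 'M[C]_(m, n) => y i j) Im).
    exact: continuous_entry.
  exact: continuous_Im.
Qed.

Lemma smooth_near_reim V m n (x : V) (f : V -> 'M[C]_(m, n)) :
  csmooth_mx x f -> smooth_near x (fun y => reim (f y)).
Proof.
by move=> sf; apply: smooth_near_pair; [exact: smooth_near_Re_mx|exact: smooth_near_Im_mx].
Qed.

Lemma germ_csmooth V m n (x : V) (f : V -> complex_mx R m n)
    (g : complex_mx R m n -> R) :
  csmooth_mx x f -> smooth_germ (f x) g -> smooth_near x (g \o f).
Proof.
move=> sf sg; apply: (smooth_near_ext (f := fun y => (g \o @of_reim m n) (reim (f y)))).
  by move=> y; rewrite /= reimK.
exact: (smooth_near_comp sg (smooth_near_reim sf)).
Qed.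

Lemma scalingsP m n (A B : 'M[C]_(m, n)) :
  scalings A = scalings B <-> exists2 c, c != 0 & B = c *: A.
Proof.
split=> [E|[c c0 ->]].
  have : scalings B B by exists 1; [exact: oner_neq0|rewrite scale1r].
  by rewrite -E => -[c c0 <-]; exists c.
apply/seteqP; split=> _ [d /= d0 <-].
  by exists (d / c); rewrite /= ?mulf_neq0 ?invr_neq0 // scalerA divfK.
by exists (d * c); rewrite /= ?mulf_neq0 // scalerA.
Qed.

End ComplexSmooth.

(** * Quotients by nonzero scalars *)

Section ScalingQuotient.
Context {R : realType}.
Local Notation C := R[i].
Context (m n : nat) (X : set (complex_mx R m n)).
Let Q := @quotient_space R (sub_space X) _ (fun z => scalings (val z)).
Let cls (z : sub_space X) : Q := fclass _ z.

(** A smooth family of representatives gives a smooth map to the quotient. This serves both [PGL]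
    and [projective]. *)
Lemma scaling_class_smooth (V : normedModType R)
    (s : V -> sub_space X) w : csmooth_mx w (fun v => val (s v)) ->
  {for w, continuous (cls \o s)} /\
  forall f : Q -> R, smooth_germ (cls (s w)) f -> smooth_near w (f \o (cls \o s)).
Proof.
move=> ss.
have cs : {for w, continuous s}.
  by apply: continuous_set_type; exact: csmooth_continuous ss.
split; first by apply: continuous_for_comp => //; exact: fclass_continuous.
move=> f /(_ (s w) erefl)[F gF Ff].
have sF : smooth_near w (F \o (fun v => val (s v))) := germ_csmooth ss gF.
have nf : nbhs w (s @^-1` [set y | F (val y) = f (cls y)]) by exact: cs.
have H := smooth_near_eq (nf : \forall v \near w, F (val (s v)) = f (cls (s v))) sF.
exact: H.
Qed.

(** The chosen representative [frepr q] need not vary continuously with [q]. Invariance of [r] under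
    scaling allows any other representative instead, so continuity and smoothness are those of [r]
    on the open condition [D]. *)
Lemma scaling_retract_smooth (V : normedModType R) {fV : findim V}
    (D : set 'M[C]_(m, n)) (r : 'M[C]_(m, n) -> V) (q : Q) :
  (forall c z, X z -> D z -> c != 0 -> D (c *: z) /\ r (c *: z) = r z) ->
  (forall z, X z -> D z -> nbhs z D /\
     smooth_near (reim z) (r \o @of_reim R m n)) ->
  D (val (frepr q)) ->
  let r' (q : Q) := r (val (frepr q)) in
  {for q, continuous r'} /\
  forall h : V -> R, smooth_near (r' q) h -> smooth_germ q (h \o r').
Proof.
move=> Dr sr Dq r'.
have Xval (z : sub_space X) : X (val z) by have := set_mem (valP z).
have r'E z : D (val z) -> r' (cls z) = r (val z).
  move=> Dz; have /scalingsP[c c0 E] := esym (f_frepr (fun z : sub_space X => scalings (val z)) z).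
  by rewrite /r' E; have [] := Dr c _ (Xval z) Dz c0.
have Dcls z z' : cls z = cls z' -> D (val z) -> D (val z').
  move=> /fclassP/scalingsP[c c0 ->] Dz.
  by have [] := Dr c _ (Xval z) Dz c0.
have cr z : X z -> D z -> {for z, continuous r}.
  move=> Xz Dz; have [_ /smooth_near_continuous c] := sr _ Xz Dz.
  have -> : r = (fun z => (r \o @of_reim R m n) (reim z)).
    by apply/funext => y; rewrite /= reimK.
  by apply: (continuous_for_comp (f := @reim R m n)); [exact: continuous_reim|].
split.
- move=> B; rewrite nbhsE => -[B0 [oB0 B0q] B0B].
  suff nO : nbhs q [set q' : Q | D (val (frepr q')) /\ B0 (r' q')].
    by apply: filterS nO => q' [_ /B0B].
  apply: open_nbhs_nbhs; split=> //; apply: fclass_open; rewrite openE => z /= [Dz Bz].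
  have {}Dz : D (val z) by apply: Dcls Dz; rewrite /cls freprK.
  rewrite -/(cls z) r'E // in Bz.
  have [nD _] := sr _ (Xval z) Dz; have cz := cr _ (Xval z) Dz.
  apply/nbhs_set_typeP; exists (D `&` r @^-1` B0).
    by apply: filterI => //; apply: cz; exact: open_nbhs_nbhs.
  move=> y [Dy By]; rewrite /= -/(cls y) r'E //; split=> //.
  by apply: Dcls Dy; rewrite /cls freprK.
- move=> h sh z zq.
  have Dz : D (val z) by apply: Dcls Dq; rewrite /cls freprK.
  have [nD srz] := sr _ (Xval z) Dz.
  exists (h \o r).
    apply: (smooth_near_comp (f := r \o @of_reim R m n) (g := h)) => //.
    by rewrite /= reimK -r'E // /cls zq.
  apply/nbhs_set_typeP; exists D => // y Dy.
  by rewrite /= -/(cls y) r'E.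
Qed.

End ScalingQuotient.

Section ProjectiveAction.
Context {R : realType} {n : nat}.
Local Notation C := R[i].

Lemma pgl_classP (g h : GL C n) :
  pgl_class g = pgl_class h <-> exists2 c, c != 0 & val h = c *: val g.
Proof. by apply: (iff_trans (fclassP _ _ _)); exact: scalingsP. Qed.

Lemma pgl_reprK (x : PGL R n) : pgl_class (pgl_repr x) = x.
Proof. exact: freprK. Qed.

Lemma pgl_repr_class (g : GL C n) :
  exists2 c, c != 0 & val (pgl_repr (pgl_class g)) = c *: val g.
Proof. by apply/pgl_classP; rewrite pgl_reprK. Qed.

Lemma pgl_mul_class (g h : GL C n) :
  pgl_mul (pgl_class g) (pgl_class h) = pgl_class (gl_mul g h).
Proof.
have [c c0 Ec] := pgl_repr_class g; have [d d0 Ed] := pgl_repr_class h.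
apply/esym/pgl_classP; exists (c * d); first exact: mulf_neq0.
by rewrite /= Ec Ed -scalemxAl -scalemxAr scalerA.
Qed.

Lemma proj_ofP (z z' : 'cV[C]_n) (nz : nonzero z) (nz' : nonzero z') :
  proj_of nz = proj_of nz' <-> exists2 c, c != 0 & z' = c *: z.
Proof. by apply: (iff_trans (fclassP _ _ _)); exact: scalingsP. Qed.

Lemma proj_of_surj (x : projective R n) :
  exists (z : 'cV[C]_n) (nz : nonzero z), x = proj_of nz.
Proof.
exists (val (frepr x)), (set_mem (valP (frepr x))).
rewrite -[x in LHS]freprK /proj_of; congr (fclass _ _); exact: val_inj.
Qed.

Lemma nonzero_mul (g : GL C n) (z : 'cV[C]_n) : nonzero z -> nonzero (val g *m z).
Proof. by move=> nz; exact: (@proj_act_subproof R n g (SigSub (mem_set nz))). Qed.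

Lemma proj_act_class (g : GL C n) (z : 'cV[C]_n) (nz : nonzero z) :
  proj_act (pgl_class g) (proj_of nz) = proj_of (nonzero_mul g nz).
Proof.
have [c c0 Ec] := pgl_repr_class g.
have /scalingsP[d d0 Ed] := esym (f_frepr
  (fun z : sub_space (@nonzero R n) => scalings (val z)) (SigSub (mem_set nz))).
apply/esym/proj_ofP; exists (c * d); first exact: mulf_neq0.
by rewrite Ec Ed -scalemxAl -scalemxAr scalerA.
Qed.

Lemma proj_act_mul (g h : PGL R n) x :
  proj_act (pgl_mul g h) x = proj_act g (proj_act h x).
Proof.
rewrite -[g]pgl_reprK -[h]pgl_reprK pgl_mul_class.
have [z [nz ->]] := proj_of_surj x; rewrite !proj_act_class.
by apply/proj_ofP; exists 1; rewrite ?oner_neq0 // scale1r /= mulmxA.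
Qed.

Lemma proj_act1 x : proj_act (@pgl_one R n) x = x.
Proof.
have [z [nz ->]] := proj_of_surj x; rewrite proj_act_class.
by apply/proj_ofP; exists 1; rewrite ?oner_neq0 // scale1r /= mul1mx.
Qed.

Lemma gl_val_inj (g h : GL C n) : val g = val h -> g = h.
Proof. exact: val_inj. Qed.

Lemma pgl_mulA (x y z : PGL R n) : pgl_mul x (pgl_mul y z) = pgl_mul (pgl_mul x y) z.
Proof.
rewrite -[x]pgl_reprK -[y]pgl_reprK -[z]pgl_reprK !pgl_mul_class; congr pgl_class.
by apply: gl_val_inj; rewrite /= mulmxA.
Qed.

Lemma pgl_mul1 (x : PGL R n) : pgl_mul pgl_one x = x.
Proof.
rewrite -[x]pgl_reprK pgl_mul_class; congr pgl_class.
by apply: gl_val_inj; rewrite /= mul1mx.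
Qed.

Lemma pgl_mulV (x : PGL R n) : pgl_mul (pgl_inv x) x = pgl_one.
Proof.
rewrite /pgl_inv -[x in pgl_mul _ x]pgl_reprK pgl_mul_class; congr pgl_class.
by apply: gl_val_inj; rewrite /= mulVmx // gl_unit.
Qed.

End ProjectiveAction.

Lemma mulmx_conj (K : comUnitRingType) n (S X Y : 'M[K]_n) : S \in unitmx ->
  S *m (X *m invmx S) *m (S *m (Y *m invmx S)) = S *m (X *m Y *m invmx S).
Proof. by move=> Su; rewrite !mulmxA mulmxKV. Qed.

(** * The semidirect product and its affine action *)

Section AffineModel.
Context {R : realType} {N : nat} (A : R -> GL R N)
  (AD : forall s t, val (A (s + t)) = val (A s) *m val (A t))
  (A0 : val (A 0) = 1%:M) (sigma : GL R[i] (N + 1)).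
Local Notation C := R[i].
Local Notation H := ('cV[R]_N * R)%type.
Local Notation V := ('cV[R]_N * 'cV[R]_N)%type.

Definition theta_lift (w : H) : GL C (N + 1) :=
  gl_mul sigma (gl_mul (rho A w.1 w.2) (gl_inv sigma)).
Definition theta (w : H) : PGL R (N + 1) := pgl_class (theta_lift w).

Definition hmul (w w' : H) : H := (w.1 + val (A w.2) *m w'.1, w.2 + w'.2).
Definition hinv (w : H) : H := (- (val (A (- w.2)) *m w.1), - w.2).
(** The affine action on complex vectors, written as pairs of real and imaginary part: translations
    are real, so they leave the imaginary part alone. *)
Definition hact (w : H) (z : V) : V :=
  (w.1 + val (A w.2) *m z.1, val (A w.2) *m z.2).

Fact point_subproof (z : 'cV[C]_N) :
  @nonzero R (N + 1) (val sigma *m col_mx z 1%:M).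
Proof. exact: (nonzero_mul sigma (affine_subproof z)). Qed.

Definition chart_point (z : V) : projective R (N + 1) := proj_of (point_subproof (of_reim z)).

Lemma pointE z : chart_point (reim z) = proj_act (pgl_class sigma) (affine_point z).
Proof.
rewrite /affine_point proj_act_class; apply/proj_ofP.
by exists 1; rewrite ?oner_neq0 // scale1r reimK.
Qed.

Let AK t : val (A t) *m val (A (- t)) = 1%:M.
Proof. by rewrite -AD subrr A0. Qed.
Let ANK t : val (A (- t)) *m val (A t) = 1%:M.
Proof. by rewrite -AD addNr A0. Qed.

Lemma hmulA u v w : hmul u (hmul v w) = hmul (hmul u v) w.
Proof. by rewrite /hmul /= AD mulmxDr !mulmxA !addrA. Qed.
Lemma hmul1 w : hmul (0, 0) w = w.
Proof. by rewrite /hmul /= A0 mul1mx !add0r -surjective_pairing. Qed.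
Lemma hmulr1 w : hmul w (0, 0) = w.
Proof. by rewrite /hmul /= mulmx0 !addr0 -surjective_pairing. Qed.
Lemma hmulV w : hmul (hinv w) w = (0, 0).
Proof. by rewrite /hmul /hinv /= !addNr. Qed.
Lemma hmulrV w : hmul w (hinv w) = (0, 0).
Proof. by rewrite /hmul /hinv /= mulmxN mulmxA AK mul1mx !subrr. Qed.
Lemma hactM u v z : hact (hmul u v) z = hact u (hact v z).
Proof. by rewrite /hact /hmul /= AD mulmxDr !mulmxA !addrA. Qed.
Lemma hact1 z : hact (0, 0) z = z.
Proof. by rewrite /hact /= A0 !mul1mx add0r -surjective_pairing. Qed.
Lemma hactK w : cancel (hact w) (hact (hinv w)).
Proof. by move=> z; rewrite -hactM hmulV hact1. Qed.
Lemma hactVK w : cancel (hact (hinv w)) (hact w).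
Proof. by move=> z; rewrite -hactM hmulrV hact1. Qed.

Lemma cmxM m k l (X : 'M[R]_(m, k)) (Y : 'M[R]_(k, l)) : cmx (X *m Y) = cmx X *m cmx Y.
Proof. by rewrite /cmx map_mxM. Qed.
Lemma cmxD m k (X Y : 'M[R]_(m, k)) : cmx (X + Y) = cmx X + cmx Y.
Proof. by rewrite /cmx map_mxD. Qed.
Lemma theta_mul u v : pgl_mul (theta u) (theta v) = theta (hmul u v).
Proof.
rewrite /theta pgl_mul_class; congr pgl_class; apply: gl_val_inj; rewrite /=.
rewrite (mulmx_conj _ _ (gl_unit sigma)); congr (_ *m (_ *m _)).
rewrite mulmx_block !mulmx0 !mul0mx !mulmx1 !addr0 !add0r -cmxM -cmxM -cmxD AD.
by rewrite addrC.
Qed.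

Lemma theta1 : theta (0, 0) = pgl_one.
Proof.
rewrite /theta; congr pgl_class; apply: gl_val_inj; rewrite /= A0.
rewrite /cmx map_mx1 map_mx0 -scalar_mx_block mul1mx mulmxV // gl_unit //.
Qed.

Lemma theta_inv u : theta (hinv u) = pgl_inv (theta u).
Proof.
rewrite -[LHS]pgl_mul1 -(pgl_mulV (theta u)) -pgl_mulA theta_mul hmulrV theta1.
rewrite -{1}[pgl_inv _]pgl_reprK -[pgl_one]/(pgl_class gl_one) pgl_mul_class.
rewrite -[RHS]pgl_reprK; congr pgl_class; apply: gl_val_inj.
by rewrite /= mulmx1.
Qed.

Lemma theta_act w z : proj_act (theta w) (chart_point z) = chart_point (hact w z).
Proof.
rewrite /theta /chart_point proj_act_class; apply/proj_ofP.
exists 1; rewrite ?oner_neq0 // scale1r.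
rewrite /= -!mulmxA mulKmx ?gl_unit //; congr (_ *m _).
rewrite mul_block_col mul0mx add0r !mulmx1; congr col_mx.
apply/matrixP => i j; rewrite !mxE /=.
transitivity ((Complex (w.1 i j + (val (A w.2) *m z.1) i j) ((val (A w.2) *m z.2) i j)) : C).
  by rewrite !mxE.
rewrite !mxE; rewrite (eq_bigr (fun k => Complex (val (A w.2) i k * z.1 k j) (val (A w.2) i k * z.2 k j))).
  apply/eqP; rewrite eq_complex /= !raddfD (raddf_sum (@complex.Re R)) (raddf_sum (@complex.Im R)) /=.
  by rewrite addr0 addrC !eqxx.
by move=> k _; rewrite !mxE; apply/eqP; rewrite eq_complex /= !mul0r subr0 addr0 !eqxx.
Qed.

Fact infinity_subproof (v : 'cV[C]_N) (nv : v != 0) :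
  @nonzero R (N + 1) (val sigma *m col_mx v 0).
Proof.
apply: nonzero_mul; rewrite /nonzero /=; apply: contra nv => /eqP.
by rewrite -col_mx0 => /eq_col_mx[->].
Qed.

Definition infinity_point (v : 'cV[C]_N) (nv : v != 0) : projective R (N + 1) :=
  proj_of (infinity_subproof nv).

Lemma projective_cases (x : projective R (N + 1)) :
  (exists z, x = chart_point z) \/ (exists v (nv : v != 0), x = infinity_point nv).
Proof.
have [y [ny ->]] := proj_of_surj x.
pose u := invmx (val sigma) *m y.
have yE : y = val sigma *m col_mx (usubmx u) (dsubmx u).
  by rewrite vsubmxK /u mulKVmx // gl_unit.
have [d0|d0] := eqVneq (dsubmx u 0 0) 0; [right|left].
  have dE : dsubmx u = 0 by apply/matrixP => i j; rewrite (ord1 i) (ord1 j) d0 mxE.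
  have nv : usubmx u != 0.
    apply/eqP => u0; move: ny; rewrite /nonzero /= yE u0 dE col_mx0 mulmx0.
    by rewrite eqxx.
  exists (usubmx u), nv; apply/proj_ofP.
  by exists 1; rewrite ?oner_neq0 // scale1r yE dE.
exists (reim ((dsubmx u 0 0)^-1 *: usubmx u)); apply/proj_ofP.
exists ((dsubmx u 0 0)^-1); first by rewrite invr_neq0.
rewrite reimK [y in RHS]yE scalemxAr scale_col_mx; congr (_ *m col_mx _ _).
apply/matrixP => i j; rewrite (ord1 i) (ord1 j) [LHS]mxE eqxx [RHS]mxE.
by rewrite mulVf.
Qed.

Lemma theta_act_infinity b t v (nv : v != 0) :
  exists nv' : cmx (val (A t)) *m v != 0,
    proj_act (theta (b, t)) (infinity_point nv) = infinity_point nv'.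
Proof.
have nv' : cmx (val (A t)) *m v != 0.
  apply: contra nv => /eqP Av; have := congr1 (mulmx (cmx (val (A (- t))))) Av.
  by rewrite mulmxA -cmxM ANK /cmx map_mx1 mul1mx mulmx0 => ->.
exists nv'; rewrite /theta /infinity_point proj_act_class; apply/proj_ofP.
exists 1; rewrite ?oner_neq0 // scale1r.
rewrite /= -!mulmxA mulKmx ?gl_unit //; congr (_ *m _).
by rewrite mul_block_col !mulmx0 mul0mx !addr0.
Qed.

End AffineModel.

Section SubgroupOrbits.
Context {R : realType} {n : nat} (Gamma : set (PGL R n)) (gG : pgl_subgroup Gamma).

Lemma pgl_coset_eq (x y : PGL R n) :
  [set pgl_mul g x | g in Gamma] = [set pgl_mul g y | g in Gamma] <->
  exists2 g, Gamma g & y = pgl_mul g x.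
Proof.
have [G1 GM GV] := gG; split=> [E|[g Gg ->]].
  have : [set pgl_mul g y | g in Gamma] y by exists pgl_one; rewrite ?pgl_mul1.
  by rewrite -E => -[g Gg <-]; exists g.
apply/seteqP; split=> _ [h Gh <-].
  exists (pgl_mul h (pgl_inv g)); first by apply: GM => //; exact: GV.
  by rewrite -pgl_mulA [pgl_mul (pgl_inv g) _]pgl_mulA pgl_mulV pgl_mul1.
by exists (pgl_mul h g); [exact: GM|rewrite pgl_mulA].
Qed.

Lemma proj_orbit_eq (x y : projective R n) :
  [set proj_act g x | g in Gamma] = [set proj_act g y | g in Gamma] <->
  exists2 g, Gamma g & y = proj_act g x.
Proof.
have [G1 GM GV] := gG; split=> [E|[g Gg ->]].
  have : [set proj_act g y | g in Gamma] y by exists pgl_one; rewrite ?proj_act1.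
  by rewrite -E => -[g Gg <-]; exists g.
apply/seteqP; split=> _ [h Gh <-].
  exists (pgl_mul h (pgl_inv g)); first by apply: GM => //; exact: GV.
  by rewrite proj_act_mul -(proj_act_mul (pgl_inv g)) pgl_mulV proj_act1.
by exists (pgl_mul h g); [exact: GM|rewrite proj_act_mul].
Qed.
End SubgroupOrbits.

Section CsmoothMore.
Context {R : realType}.
Local Notation C := R[i].
Local Notation Re := (@complex.Re R).
Local Notation Im := (@complex.Im R).
Implicit Types V : normedModType R.

Lemma csmooth_neq0 V (x : V) (f : V -> C) : csmooth x f -> f x != 0 ->
  \forall y \near x, f y != 0.
Proof.
move=> [f1 f2] fx0.
have s : smooth_near x (fun y => Re (f y) * Re (f y) + Im (f y) * Im (f y)).
  exact: (smooth_nearD (smooth_nearM f1 f1) (smooth_nearM f2 f2)).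
have c := smooth_near_continuous s.
have nz : nbhs x ((fun y => Re (f y) * Re (f y) + Im (f y) * Im (f y)) @^-1`
    [set u | u != 0]).
  apply: c; apply: open_nbhs_nbhs; split=> //=.
  apply: contra fx0; rewrite -!expr2 paddr_eq0 ?sqr_ge0 // !sqrf_eq0.
  by case: (f x) => a b /= /andP[/eqP-> /eqP->].
apply: filterS nz => y /=; apply: contra => /eqP ->.
by rewrite /= !mulr0 addr0.
Qed.

Lemma csmooth_ursub V m1 m2 n1 n2 (x : V) (f : V -> 'M[C]_(m1 + m2, n1 + n2)) :
  csmooth_mx x f -> csmooth_mx x (fun y => ursubmx (f y)).
Proof. by move=> sf i j; under eq_fun do rewrite !mxE. Qed.

Lemma csmooth_ulsub V m1 m2 n1 n2 (x : V) (f : V -> 'M[C]_(m1 + m2, n1 + n2)) :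
  csmooth_mx x f -> csmooth_mx x (fun y => ulsubmx (f y)).
Proof. by move=> sf i j; under eq_fun do rewrite !mxE. Qed.

Lemma csmooth_drsub V m1 m2 n1 n2 (x : V) (f : V -> 'M[C]_(m1 + m2, n1 + n2)) :
  csmooth_mx x f -> csmooth_mx x (fun y => drsubmx (f y)).
Proof. by move=> sf i j; under eq_fun do rewrite !mxE. Qed.

Lemma csmooth_usub V m1 m2 n (x : V) (f : V -> 'M[C]_(m1 + m2, n)) :
  csmooth_mx x f -> csmooth_mx x (fun y => usubmx (f y)).
Proof. by move=> sf i j; under eq_fun do rewrite !mxE. Qed.

Lemma csmooth_dsub V m1 m2 n (x : V) (f : V -> 'M[C]_(m1 + m2, n)) :
  csmooth_mx x f -> csmooth_mx x (fun y => dsubmx (f y)).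
Proof. by move=> sf i j; under eq_fun do rewrite !mxE. Qed.

Lemma csmooth_col_mx V m1 m2 n (x : V) (f : V -> 'M[C]_(m1, n)) (g : V -> 'M[C]_(m2, n)) :
  csmooth_mx x f -> csmooth_mx x g -> csmooth_mx x (fun y => col_mx (f y) (g y)).
Proof.
move=> sf sg i j; case: (split_ordP i) => k ->;
by under eq_fun do rewrite ?col_mxEu ?col_mxEd.
Qed.

Lemma csmooth_row_mx V m n1 n2 (x : V) (f : V -> 'M[C]_(m, n1)) (g : V -> 'M[C]_(m, n2)) :
  csmooth_mx x f -> csmooth_mx x g -> csmooth_mx x (fun y => row_mx (f y) (g y)).
Proof.
move=> sf sg i j; case: (split_ordP j) => k ->;
by under eq_fun do rewrite ?row_mxEl ?row_mxEr.
Qed.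

Lemma csmooth_cmx V m n (x : V) (f : V -> 'M[R]_(m, n)) :
  smooth_near x f -> csmooth_mx x (fun y => cmx (f y)).
Proof.
move=> sf i j; under eq_fun do rewrite mxE.
by apply: csmooth_real; exact: smooth_near_entry.
Qed.

Lemma nbhs_of_reim m n (z : 'M[C]_(m, n)) (D : set 'M[C]_(m, n)) :
  (\forall p \near reim z, D (of_reim p)) -> nbhs z D.
Proof.
move=> nD; have nz : nbhs z (@reim R m n @^-1` [set p | D (of_reim p)]).
  exact: continuous_reim.
by apply: filterS nz => y; rewrite /= reimK.
Qed.

End CsmoothMore.

(** * Coordinates on the group and on the domain *)

Section Core.
Context {R : realType} (p q : nat) (A : R -> GL R (p.+1 + q))
  (Ms : 'M[R]_p.+1) (Mu : 'M[R]_q)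
  (fA : linear_flow (fun t => val (A t)) (block_mx Ms 0 0 Mu)) (c : R) (c0 : 0 < c)
  (dMs : forall x, rdotmx x (Ms *m x) <= - c * rdotmx x x)
  (sigma : GL R[i] (p.+1 + q + 1)).
Local Notation N := (p.+1 + q)%N.
Local Notation C := R[i].
Local Notation H := ('cV[R]_N * R)%type.
Local Notation V := ('cV[R]_N * 'cV[R]_N)%type.
Local Notation theta := (theta A sigma).
Local Notation chart_point := (chart_point sigma).
Local Notation hmul := (hmul A).
Local Notation hact := (hact A).

Let As t := ulsubmx (val (A t)).
Let Au t := drsubmx (val (A t)).
Let fAs : linear_flow As Ms := flow_ul fA.
Let fAu : linear_flow Au Mu := flow_dr fA.
Let hitA := hit As.

Let AD s t : val (A (s + t)) = val (A s) *m val (A t). Proof. exact: (flowD fA). Qed.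
Let A0 : val (A 0) = 1%:M. Proof. exact: (flow0 fA). Qed.
Let A_block t : val (A t) = block_mx (As t) 0 0 (Au t). Proof. exact: (flow_block fA). Qed.

Definition unit_col : 'cV[R]_p.+1 := delta_mx 0 0.
Lemma rdotmx_unit_col : rdotmx unit_col unit_col = 1.
Proof.
rewrite /rdotmx (bigD1 ord0) //= big1 => [|i i0].
  by rewrite !mxE eqxx mulr1 addr0.
by rewrite !mxE (negbTE i0) mul0r.
Qed.
Let unit_neq0 : unit_col != 0.
Proof. by rewrite -rdotmx_eq0 rdotmx_unit_col oner_eq0. Qed.

Definition unconj (g : 'M[C]_(N + 1)) : 'M[C]_(N + 1) :=
  invmx (val sigma) *m g *m val sigma.
Definition pivot (g : 'M[C]_(N + 1)) : C := drsubmx (unconj g) 0 0.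
(** In [rho] the lower right entry is 1; dividing by it makes the coordinates below independent of
    the representative. *)
Definition normalized (g : 'M[C]_(N + 1)) : 'M[C]_(N + 1) := (pivot g)^-1 *: unconj g.
Definition stable_block (d : 'M[C]_(N + 1)) : 'cV[R]_p.+1 :=
  map_mx (@complex.Re R) (ulsubmx (ulsubmx d)) *m unit_col.
(** The inverse of the parametrization of the group. The translation is the upper right block; the
    time is read off the stable block, since [A t] applied to a unit stable vector has hitting time
    [t]. *)
Definition theta_coord (d : 'M[C]_(N + 1)) : H :=
  (map_mx (@complex.Re R) (ursubmx d), hitA (stable_block d)).

Let theta_dom : set 'M[C]_(N + 1) :=
  [set g | pivot g != 0 /\ stable_block (normalized g) != 0].

Definition theta_retract (x : PGL R (N + 1)) : H :=
  theta_coord (normalized (val (pgl_repr x))).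

Lemma unconjZ k g : unconj (k *: g) = k *: unconj g.
Proof. by rewrite /unconj -scalemxAr -scalemxAl. Qed.
Lemma pivotZ k g : pivot (k *: g) = k * pivot g.
Proof. by rewrite /pivot unconjZ !mxE. Qed.
Lemma normalizedZ k g : k != 0 -> normalized (k *: g) = normalized g.
Proof.
by move=> k0; rewrite /normalized pivotZ unconjZ scalerA invfM mulrAC mulVf // mul1r.
Qed.

Let theta_dom_scale k g : k != 0 -> theta_dom g ->
  theta_dom (k *: g) /\
  theta_coord (normalized (k *: g)) = theta_coord (normalized g).
Proof.
move=> k0 [h0 u0]; rewrite (normalizedZ g k0); split; last by [].
split; first by rewrite pivotZ; exact: mulf_neq0.
by rewrite (normalizedZ g k0).
Qed.

Let theta_dom_smooth g : theta_dom g -> nbhs g theta_dom /\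
  smooth_near (reim g) ((theta_coord \o normalized) \o @of_reim R _ _).
Proof.
move=> [h0 u0].
have sh : csmooth_mx (reim g) (fun y => unconj (of_reim y)).
  apply: csmooth_mulmx; last exact: csmooth_mx_cst.
  by apply: csmooth_mulmx; [exact: csmooth_mx_cst|exact: csmooth_of_reim].
have sd : csmooth (reim g) (fun y => pivot (of_reim y)) := csmooth_drsub sh 0 0.
have h0' : pivot (of_reim (reim g)) != 0 by rewrite reimK.
have si : csmooth_mx (reim g) (fun y => normalized (of_reim y)) :=
  csmooth_mx_scale (csmoothV h0' sd) sh.
have su := smooth_near_Re_mx (csmooth_ulsub (csmooth_ulsub si)).
have sue : smooth_near (reim g) (fun y => stable_block (normalized (of_reim y))).
  exact: smooth_near_mulmx su (smooth_near_cst (reim g) unit_col).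
split.
  apply: nbhs_of_reim.
  have n1 := csmooth_neq0 sd; rewrite reimK in n1.
  have n2 : nbhs (reim g) ((fun y => stable_block (normalized (of_reim y)))
      @^-1` [set u | u != 0]).
    apply: (smooth_near_continuous sue); apply: open_nbhs_nbhs.
    by rewrite reimK; split; first exact: open_neq0.
  by apply: filterS2 (n1 h0) n2 => y h1 h2; split.
apply: smooth_near_pair.
  exact: smooth_near_Re_mx (csmooth_ursub si).
apply: (smooth_near_comp (g := hitA) _ sue).
by rewrite reimK; exact: (smooth_near_hit fAs c0 dMs).
Qed.

Lemma unconj_lift w : unconj (val (theta_lift A sigma w)) =
    block_mx (cmx (val (A w.2))) (cmx w.1) 0 1%:M.
Proof.
by rewrite /unconj /= !mulmxA mulVmx ?gl_unit // mul1mx mulmxKV // gl_unit.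
Qed.

Lemma theta_dom_lift w : theta_dom (val (theta_lift A sigma w)) /\
  theta_coord (normalized (val (theta_lift A sigma w))) = w.
Proof.
have d1 : pivot (val (theta_lift A sigma w)) = 1.
  by rewrite /pivot unconj_lift block_mxKdr mxE eqxx.
have nE : normalized (val (theta_lift A sigma w)) =
    block_mx (cmx (val (A w.2))) (cmx w.1) 0 1%:M.
  by rewrite /normalized d1 invr1 scale1r unconj_lift.
have sE : stable_block (normalized (val (theta_lift A sigma w))) = As w.2 *m unit_col.
  rewrite nE /stable_block block_mxKul; congr (_ *m _).
  by apply/matrixP => i j; rewrite !mxE.
split.
  by split; [rewrite d1; exact: oner_neq0|rewrite sE; exact: (flow_neq0 fAs)].
rewrite /theta_coord sE nE block_mxKur.
rewrite /hitA (hit_flow fAs c0 dMs) // (hit_eq0 fAs c0 dMs) ?rdotmx_unit_col //.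
rewrite add0r [RHS]surjective_pairing; congr pair.
by apply/matrixP => i j; rewrite !mxE.
Qed.

Lemma theta_retractK : cancel theta theta_retract.
Proof.
move=> w; have [k k0 E] := pgl_repr_class (theta_lift A sigma w).
have [D1 E1] := theta_dom_lift w.
rewrite /theta_retract E; have [_ ->] := theta_dom_scale k0 D1.
exact: E1.
Qed.

Lemma csmooth_theta_lift w : csmooth_mx w (fun w : H => val (theta_lift A sigma w)).
Proof.
apply: csmooth_mulmx; first exact: csmooth_mx_cst.
apply: csmooth_mulmx; last exact: csmooth_mx_cst.
rewrite /= /block_mx; apply: csmooth_col_mx; last exact: csmooth_mx_cst.
apply: csmooth_row_mx.
  apply: csmooth_cmx; apply: (smooth_near_comp (f := fun w : H => w.2) (g := fun t => val (A t))).
    exact: (flow_smooth fA).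
  exact/smooth_near_snd/smooth_near_id.
by apply: csmooth_cmx; exact/smooth_near_fst/smooth_near_id.
Qed.

Section Group.
Context (G : set (PGL R (N + 1))) (GE : forall g, G g <-> exists w, g = theta w).

Fact theta_in w : G (theta w). Proof. by apply/GE; exists w. Qed.
Definition theta_G (w : H) : sub_space G := SigSub (mem_set (theta_in w)).

Lemma theta_G_surj (x : sub_space G) : exists w, x = theta_G w.
Proof.
have /GE[w E] := set_mem (valP x).
by exists w; apply: val_inj; rewrite /= E.
Qed.

(** [theta_retract] is smooth near the image in the ambient group and inverts [theta] there, so
    [etale_sub] applies; every element of [G] is some [theta w] and is recovered from its
    retract. *)
Lemma etale_theta_G : etale setT theta_G.
Proof.
have D1 w : theta_dom (val (frepr (theta w))).
  have [k k0 E] := pgl_repr_class (theta_lift A sigma w).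
  rewrite -[frepr _]/(pgl_repr (pgl_class (theta_lift A sigma w))) E.
  by have [] := theta_dom_scale k0 (theta_dom_lift w).1.
have rs w : {for theta w, continuous theta_retract} /\
    forall h : H -> R, smooth_near w h -> smooth_germ (theta w) (h \o theta_retract).
  have [cr gr] := @scaling_retract_smooth R _ _ (GL C (N + 1)) H
    (prod_findim (matrix_findim _ _) real_findim) theta_dom
    (theta_coord \o normalized) (theta w) (fun k z _ Dz k0 => theta_dom_scale k0 Dz)
    (fun z _ => @theta_dom_smooth z) (D1 w).
  split; first exact: cr.
  by move=> h; rewrite -{1}[w]theta_retractK => sh; exact: gr.
apply: (@etale_sub R H (PGL R (N + 1)) G setT theta_G theta_retract).
- exact: openT.
- move=> w _.
  have [ct gt] := @scaling_class_smooth R _ _ (GL C (N + 1)) H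
    (fun w => theta_lift A sigma w) w (csmooth_theta_lift w).
  split.
  + exact: ct.
  + exact: gt.
  + exact: (rs w).1.
  + exact: theta_retractK.
- by move=> w f _; exact: (rs w).2.
- move=> w _; apply: (@filterS _ (nbhs _) _ setT); last exact: filterT.
  move=> x _ y yx; have [w' E] := theta_G_surj y; subst x; rewrite E.
  by rewrite [val _]/= theta_retractK.
Qed.

Section Quotients.
Context (Gamma : set (PGL R (N + 1))) (gG : pgl_subgroup Gamma)
  (GG : Gamma `<=` G).

Definition lattice_index := {w : H | Gamma (theta w)}.

Lemma Gamma_theta g : Gamma g -> exists i : lattice_index, g = theta (sval i).
Proof. by move=> Gg; have /GE[w E] := GG Gg; subst g; exists (exist _ w Gg). Qed.

Lemma lattice_inv (i : lattice_index) : exists j : lattice_index, sval j = hinv A (sval i).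
Proof.
case: i => w Gw; have Gv : Gamma (theta (hinv A w)).
  by rewrite (theta_inv AD A0); have [_ _ GV] := gG; exact: GV.
by exists (exist (fun w => Gamma (theta w)) _ Gv).
Qed.

Lemma smooth_near_A (W' : normedModType R) (x : W') (f : W' -> R) :
  smooth_near x f -> smooth_near x (fun y => val (A (f y))).
Proof.
move=> sf; apply: (smooth_near_comp (g := fun t => val (A t))) sf.
exact: (flow_smooth fA).
Qed.

Lemma smooth_near_hmul u w : smooth_near w (hmul u).
Proof.
apply: smooth_near_pair.
  apply: smooth_nearD; first exact: smooth_near_cst.
  apply: smooth_near_mulmx; first exact: smooth_near_cst.
  exact/smooth_near_fst/smooth_near_id.
by apply: smooth_nearD; [exact: smooth_near_cst|exact/smooth_near_snd/smooth_near_id].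
Qed.

Definition coset_param (w : H) : coset_space Gamma G := fclass _ (theta_G w).

Lemma coset_paramP w w' : coset_param w = coset_param w' <->
  exists i : lattice_index, w' = hmul (sval i) w.
Proof.
apply: (iff_trans (fclassP _ _ _)); apply: (iff_trans (pgl_coset_eq gG _ _)) => /=.
split=> [[g Gg]|[[u Gu] /= ->]].
  have [i ->] := Gamma_theta Gg; rewrite (theta_mul AD).
  by move/(can_inj theta_retractK) => E; exists i.
by exists (theta u) => //; rewrite (theta_mul AD).
Qed.

Lemma coset_param_surj x : exists w, x = coset_param w.
Proof.
have [w E] := theta_G_surj (frepr x); exists w.
by rewrite /coset_param -E freprK.
Qed.

Lemma etale_coset : etale setT coset_param.
Proof.
apply: (@etale_orbit R H _ (sub_space G) _
  (fun x => [set pgl_mul g (val x) | g in Gamma]) setT theta_G lattice_index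
  (fun i => hmul (sval i))).
- exact: etale_theta_G.
- by move=> x; have [w ->] := theta_G_surj x; exists w.
- by move=> i w _; split=> //; exact: smooth_near_hmul.
- move=> i; have [j E] := lattice_inv i; exists j => w.
  by rewrite E !(hmulA AD) (hmulV A) (hmulrV AD A0) (hmul1 A0).
- move=> w w' _ _; apply: iff_trans (coset_paramP w w').
  by apply: iff_sym; exact: fclassP.
Qed.

End Quotients.
End Group.

Definition homog (y : 'cV[C]_(N + 1)) : 'cV[C]_(N + 1) := invmx (val sigma) *m y.
Definition point_coord (u : 'cV[C]_(N + 1)) : V :=
  reim ((dsubmx u 0 0)^-1 *: usubmx u).
Definition point_retract (x : projective R (N + 1)) : V :=
  point_coord (homog (val (frepr x))).
Let point_dom : set 'cV[C]_(N + 1) := [set y | dsubmx (homog y) 0 0 != 0].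

Let point_dom_scale k y : k != 0 -> point_dom y ->
  point_dom (k *: y) /\ point_coord (homog (k *: y)) = point_coord (homog y).
Proof.
move=> k0 y0; have hZ : homog (k *: y) = k *: homog y.
  by rewrite /homog -scalemxAr.
have dZ : dsubmx (homog (k *: y)) 0 0 = k * dsubmx (homog y) 0 0.
  by rewrite hZ !mxE.
have uZ : usubmx (homog (k *: y)) = k *: usubmx (homog y).
  by rewrite hZ; apply/matrixP => i j; rewrite !mxE.
split; first by move: (mulf_neq0 k0 y0); rewrite -dZ.
by rewrite /point_coord dZ uZ scalerA invfM mulrAC (mulVf k0) mul1r.
Qed.

Let point_dom_smooth y : point_dom y -> nbhs y point_dom /\
  smooth_near (reim y) ((point_coord \o homog) \o @of_reim R _ _).
Proof.
move=> y0.
have sh : csmooth_mx (reim y) (fun z => homog (of_reim z)).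
  by apply: csmooth_mulmx; [exact: csmooth_mx_cst|exact: csmooth_of_reim].
have sd : csmooth (reim y) (fun z => dsubmx (homog (of_reim z)) 0 0).
  exact: csmooth_dsub sh 0 0.
split.
  by apply: nbhs_of_reim; apply: (csmooth_neq0 sd); rewrite reimK.
have y0' : dsubmx (homog (of_reim (reim y))) 0 0 != 0 by rewrite reimK.
exact: smooth_near_reim (csmooth_mx_scale (csmoothV y0' sd) (csmooth_usub sh)).
Qed.

Definition point_lift (z : V) : 'cV[C]_(N + 1) := val sigma *m col_mx (of_reim z) 1%:M.

Lemma point_dom_lift z : point_dom (point_lift z) /\
  point_coord (homog (point_lift z)) = z.
Proof.
have hE : homog (point_lift z) = col_mx (of_reim z) 1%:M.
  by rewrite /homog mulKmx // gl_unit.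
split; first by rewrite /point_dom /= hE col_mxKd mxE eqxx oner_eq0.
by rewrite hE /point_coord col_mxKd col_mxKu mxE eqxx invr1 scale1r of_reimK.
Qed.

Lemma point_frepr z : exists2 k, k != 0 & val (frepr (chart_point z)) = k *: point_lift z.
Proof.
apply/scalingsP; apply: esym.
exact: (f_frepr (fun z : sub_space (@nonzero R (N + 1)) => scalings (val z))).
Qed.

Lemma point_retractK : cancel chart_point point_retract.
Proof.
move=> z; have [k k0 E] := point_frepr z; have [D1 E1] := point_dom_lift z.
by rewrite /point_retract E; have [_ ->] := point_dom_scale k0 D1.
Qed.

Definition lift_nonzero (z : V) : sub_space (@nonzero R (N + 1)) :=
  SigSub (mem_set (point_subproof sigma (of_reim z))).

Lemma csmooth_point_lift z : csmooth_mx z (fun z => val (lift_nonzero z)).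
Proof.
apply: csmooth_mulmx; first exact: csmooth_mx_cst.
by apply: csmooth_col_mx; [exact: csmooth_of_reim|exact: csmooth_mx_cst].
Qed.

Lemma point_smooth z : {for z, continuous chart_point} /\
  forall f, smooth_germ (chart_point z) f -> smooth_near z (f \o chart_point).
Proof.
exact: (@scaling_class_smooth R _ _ (@nonzero R (N + 1)) V lift_nonzero z
  (csmooth_point_lift z)).
Qed.

Lemma point_retract_smooth z : {for chart_point z, continuous point_retract} /\
  forall h : V -> R, smooth_near z h -> smooth_germ (chart_point z) (h \o point_retract).
Proof.
have D1 : point_dom (val (frepr (chart_point z))).
  have [k k0 ->] := point_frepr z.
  by have [] := point_dom_scale k0 (point_dom_lift z).1.
have [cr gr] := @scaling_retract_smooth R _ _ (@nonzero R (N + 1)) V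
  (prod_findim (matrix_findim _ _) (matrix_findim _ _)) point_dom
  (point_coord \o homog) (chart_point z) (fun k z _ Dz k0 => point_dom_scale k0 Dz)
  (fun z _ => @point_dom_smooth z) D1.
split; first exact: cr.
by move=> h; rewrite -{1}[z]point_retractK => sh; exact: gr.
Qed.

(** Nonvanishing of the last homogeneous coordinate is open and invariant under scaling, so the
    affine chart is open in projective space. *)
Lemma point_dom_near z :
  \forall x \near chart_point z, x = chart_point (point_retract x).
Proof.
have D1 : point_dom (val (frepr (chart_point z))).
  have [k k0 ->] := point_frepr z.
  by have [] := point_dom_scale k0 (point_dom_lift z).1.
have inf (y : projective R (N + 1)) : ~ point_dom (val (frepr y)) \/ y = chart_point (point_retract y).
  have [[z' ->]|[v [nv ->]]] := projective_cases sigma y.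
    by right; rewrite point_retractK.
  left; rewrite /point_dom /= => /negP; apply.
  have /scalingsP[k k0 ->] := esym (f_frepr
    (fun z : sub_space (@nonzero R (N + 1)) => scalings (val z))
    (SigSub (mem_set (infinity_subproof sigma nv)))).
  rewrite /homog -scalemxAr mulKmx ?gl_unit // linearZ /= col_mxKd.
  by rewrite !mxE mulr0.
suff nD : nbhs (chart_point z) [set y : projective R (N + 1) | point_dom (val (frepr y))].
  by apply: filterS nD => y Dy; have [] := inf y.
apply: open_nbhs_nbhs; split=> //; apply: fclass_open.
rewrite openE => y /= Dy.
have Dcls (u v : sub_space (@nonzero R (N + 1))) :
    fclass (fun z : sub_space (@nonzero R (N + 1)) => scalings (val z)) u =
    fclass (fun z : sub_space (@nonzero R (N + 1)) => scalings (val z)) v ->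
    point_dom (val u) -> point_dom (val v).
  move=> /fclassP/scalingsP[k k0 ->] Du.
  by have [] := point_dom_scale k0 Du.
have {}Dy : point_dom (val y) by apply: Dcls Dy; rewrite freprK.
have [nD _] := point_dom_smooth Dy.
apply/nbhs_set_typeP; exists point_dom; first exact: nD.
move=> v Dv; rewrite /preimage/= in Dv *; apply: (Dcls v) Dv.
by rewrite freprK.
Qed.

Section Domain.
Context (Om : set (projective R (N + 1))).
Definition stable_nonzero : set V := [set z | usubmx z.2 != 0].
Context (OmE : forall x, Om x <-> exists2 z, stable_nonzero z & x = chart_point z).

Lemma open_stable_nonzero : open stable_nonzero.
Proof.
rewrite openE => z z0.
have s : smooth_near z (fun z : V => usubmx z.2).
  apply: smooth_near_mx => i j; under eq_fun do rewrite mxE.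
  exact/smooth_near_entry/smooth_near_snd/smooth_near_id.
have ns : nbhs z ((fun z : V => usubmx z.2) @^-1` [set u | u != 0]).
  apply: (smooth_near_continuous s).
  by apply: open_nbhs_nbhs; split => //; exact: open_neq0.
exact: ns.
Qed.

Lemma stable_nonzero_base : stable_nonzero (0, col_mx unit_col 0).
Proof. by rewrite /stable_nonzero /= col_mxKu. Qed.

Fact point_in z : stable_nonzero z -> Om (chart_point z).
Proof. by move=> Wz; apply/OmE; exists z. Qed.

(** Parametrizations are total functions on a vector space; off [stable_nonzero] the value is an
    arbitrary point of the domain. *)
Definition point_Om (z : V) : sub_space Om :=
  match pselect (stable_nonzero z) with
  | left Wz => SigSub (mem_set (point_in Wz))
  | right _ => SigSub (mem_set (point_in stable_nonzero_base))
  end.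

Lemma val_point_Om z : stable_nonzero z -> val (point_Om z) = chart_point z.
Proof. by rewrite /point_Om; case: pselect. Qed.

Lemma point_Om_surj (x : sub_space Om) : exists2 z, stable_nonzero z & point_Om z = x.
Proof.
have /OmE[z Wz E] := set_mem (valP x); exists z => //.
by apply: val_inj; rewrite val_point_Om // E.
Qed.

Lemma etale_point_Om : etale stable_nonzero point_Om.
Proof.
have nW z : stable_nonzero z -> \forall y \near z, chart_point y = val (point_Om y).
  move=> Wz; apply: filterS (open_nbhs_nbhs (conj open_stable_nonzero Wz)) => y Wy.
  by rewrite val_point_Om.
apply: (@etale_sub R V (projective R (N + 1)) Om stable_nonzero point_Om
  point_retract).
- exact: open_stable_nonzero.
- move=> z Wz; have [cp gp] := point_smooth z; have [cr gr] := point_retract_smooth z.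
  split.
  + rewrite /prop_for /continuous_at /= val_point_Om //; apply: cvg_trans cp.
    by apply: near_eq_cvg; exact: nW.
  + move=> f; rewrite val_point_Om // => /gp; apply: smooth_near_eq.
    by apply: filterS (nW _ Wz) => y /= ->.
  + by rewrite val_point_Om.
  + by rewrite val_point_Om // point_retractK.
- by move=> z f Wz sf; rewrite val_point_Om //; have [_] := point_retract_smooth z; exact.
- move=> z Wz; apply: (@filterS _ (nbhs _) _ setT); last exact: filterT.
  move=> x _ y yx; have [z' Wz' E] := point_Om_surj y; subst x; rewrite -E.
  by rewrite [val _]/= val_point_Om // point_retractK.
Qed.

Context (G : set (PGL R (N + 1))) (GE : forall g, G g <-> exists w, g = theta w).
Context (Gamma : set (PGL R (N + 1))) (gG : pgl_subgroup Gamma)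
  (GG : Gamma `<=` G).

Lemma stable_nonzero_act w z : stable_nonzero z -> stable_nonzero (hact w z).
Proof.
case: z => a x; rewrite /stable_nonzero /= => x0.
rewrite A_block -[x]vsubmxK mul_block_col mul0mx addr0 col_mxKu.
exact: (flow_neq0 fAs).
Qed.

Lemma smooth_near_hact u z : smooth_near z (hact u).
Proof.
apply: smooth_near_pair.
  apply: smooth_nearD; first exact: smooth_near_cst.
  apply: smooth_near_mulmx; first exact: smooth_near_cst.
  exact/smooth_near_fst/smooth_near_id.
apply: smooth_near_mulmx; first exact: smooth_near_cst.
exact/smooth_near_snd/smooth_near_id.
Qed.

Definition orbit_param (z : V) : orbit_space Gamma Om := fclass _ (point_Om z).

Lemma orbit_paramP z z' : stable_nonzero z -> stable_nonzero z' ->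
  orbit_param z = orbit_param z' <->
  exists i : lattice_index Gamma, z' = hact (sval i) z.
Proof.
move=> Wz Wz'; apply: (iff_trans (fclassP _ _ _)).
apply: (iff_trans (proj_orbit_eq gG _ _)); rewrite !val_point_Om //.
split=> [[g Gg]|[[u Gu] /= ->]].
  have [i ->] := Gamma_theta GE GG Gg; rewrite theta_act.
  by move/(can_inj point_retractK) => E; exists i.
by exists (theta u) => //; rewrite theta_act.
Qed.

Lemma orbit_param_surj x : exists2 z, stable_nonzero z & orbit_param z = x.
Proof.
have [z Wz E] := point_Om_surj (frepr x); exists z => //.
by rewrite /orbit_param E freprK.
Qed.

Lemma etale_orbit_param : etale stable_nonzero orbit_param.
Proof.
apply: (@etale_orbit R V _ (sub_space Om) _
  (fun x => [set proj_act g (val x) | g in Gamma]) stable_nonzero point_Om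
  (lattice_index Gamma) (fun i => hact (sval i))).
- exact: etale_point_Om.
- exact: point_Om_surj.
- by move=> i z Wz; split; [exact: stable_nonzero_act|exact: smooth_near_hact].
- move=> i; have [j E] := lattice_inv gG i; exists j => z.
  by rewrite E (hactK AD A0) (hactVK AD A0).
- move=> z z' Wz Wz'; apply: iff_trans (orbit_paramP Wz Wz').
  by apply: iff_sym; exact: fclassP.
Qed.

End Domain.
End Core.

(** * Lattices *)

Section Discreteness.
Context {R : realType} (p q : nat) (A : R -> GL R (p.+1 + q))
  (Ms : 'M[R]_p.+1) (Mu : 'M[R]_q)
  (fA : linear_flow (fun t => val (A t)) (block_mx Ms 0 0 Mu)) (c : R) (c0 : 0 < c)
  (dMs : forall x, rdotmx x (Ms *m x) <= - c * rdotmx x x)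
  (sigma : GL R[i] (p.+1 + q + 1)).
Local Notation N := (p.+1 + q)%N.
Local Notation H := ('cV[R]_N * R)%type.
Local Notation V := ('cV[R]_N * 'cV[R]_N)%type.
Local Notation theta := (theta A sigma).
Local Notation chart_point := (chart_point sigma).
Local Notation hmul := (hmul A).
Local Notation hinv := (hinv A).
Local Notation hact := (hact A).
Context (G : set (PGL R (N + 1))) (GE : forall g, G g <-> exists w, g = theta w).
Context (Gamma : set (PGL R (N + 1))) (gG : pgl_subgroup Gamma)
  (GG : Gamma `<=` G) (dG : discrete_subset Gamma).

Let AD s t : val (A (s + t)) = val (A s) *m val (A t). Proof. exact: (flowD fA). Qed.
Let A0 : val (A 0) = 1%:M. Proof. exact: (flow0 fA). Qed.
Let eG := etale_theta_G fA c0 dMs GE.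
Let thetaK := theta_retractK fA c0 dMs sigma.

Lemma theta_continuous w : {for w, continuous theta}.
Proof.
have [_ /(_ w I)[cG _ _]] := eG.
exact: (continuous_for_comp cG (@continuous_set_val _ _ _)).
Qed.

Definition hquot (w : H * H) : H := hmul w.1 (hinv w.2).

Lemma smooth_near_hquot w : smooth_near w hquot.
Proof.
have s1 : smooth_near w (fun w : H * H => w.1) by exact/smooth_near_fst/smooth_near_id.
have s2 : smooth_near w (fun w : H * H => w.2) by exact/smooth_near_snd/smooth_near_id.
have sN : smooth_near w (fun w : H * H => - w.2.2).
  by apply: smooth_nearN; exact: smooth_near_snd s2.
have sI : smooth_near w (fun w : H * H => (hinv w.2).1).
  apply: smooth_near_mx => i j.
  have sM : smooth_near w (fun w : H * H => val (A (- w.2.2)) *m w.2.1).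
    apply: smooth_near_mulmx; last exact: smooth_near_fst s2.
    exact: (smooth_near_A fA).
  apply: smooth_near_ext (smooth_nearN (smooth_near_entry i j sM)) => v.
  by rewrite [RHS]mxE.
apply: smooth_near_pair.
  apply: smooth_nearD; first exact: smooth_near_fst s1.
  apply: smooth_near_mulmx => //.
  by apply: (smooth_near_A fA); exact: smooth_near_snd s1.
by apply: smooth_nearD; first exact: smooth_near_snd s1.
Qed.

Lemma hquot_near (w : H * H) (B : set H) : nbhs (hquot w) B ->
  exists B1 B2, [/\ nbhs w.1 B1, nbhs w.2 B2 &
    forall u v, B1 u -> B2 v -> B (hquot (u, v))].
Proof.
move=> nB; have n : nbhs w (hquot @^-1` B).
  exact: (smooth_near_continuous (smooth_near_hquot w)).
have [[B1 B2] /= [n1 n2] BB] := n.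
by exists B1, B2; split=> // u v b1 b2; apply: (BB (u, v)).
Qed.

Lemma lattice_discrete : exists2 B : set H, nbhs ((0, 0) : H) B &
  forall w, B w -> Gamma (theta w) -> w = (0, 0).
Proof.
have [G1 _ _] := gG; have [U [oU UG]] := dG G1.
have U1 : U (theta (0, 0)).
  rewrite (theta1 A0 sigma); have : (U `&` Gamma) pgl_one by rewrite UG.
  by case.
exists (theta @^-1` U); first by apply: theta_continuous; exact: open_nbhs_nbhs.
move=> w Uw Gw; apply: (can_inj thetaK); rewrite (theta1 A0 sigma).
have : (U `&` Gamma) (theta w) by [].
by rewrite UG.
Qed.

Lemma lattice_hquot u v : Gamma (theta u) -> Gamma (theta v) -> Gamma (theta (hquot (u, v))).
Proof.
have [_ GM GV] := gG => Gu Gv.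
rewrite /hquot -(theta_mul AD sigma) (theta_inv AD A0); apply: GM => //.
exact: GV.
Qed.

Lemma hquotK u v : hmul (hquot (u, v)) v = u.
Proof. by rewrite /hquot /= -(hmulA AD) (hmulV A) hmulr1. Qed.

Lemma hquot_mul u v : hquot (hmul u v, v) = u.
Proof. by rewrite /hquot /= -(hmulA AD) (hmulrV AD A0) hmulr1. Qed.

Lemma hquot_eq u v : hquot (u, v) = (0, 0) -> u = v.
Proof. by move=> E; rewrite -(hquotK u v) E (hmul1 A0). Qed.

(** When [O] times its inverse lies in the neighbourhood of [lattice_discrete], two lattice elements
    of [O] have trivial quotient. The centre [w] is any group element, as closedness and finiteness
    in compact sets require. *)
Lemma lattice_isolated (w : H) : exists2 O, open_nbhs w O &
  forall u v, O u -> O v -> Gamma (theta u) -> Gamma (theta v) -> u = v.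
Proof.
have [B nB B1] := lattice_discrete.
have nq : nbhs (hquot (w, w)) B by rewrite /hquot /= (hmulrV AD A0).
have [B1' [B2' [n1 n2 BB]]] := hquot_near nq.
exists ((B1' `&` B2')^°).
  by split; [exact: open_interior|exact: filterI].
move=> u v /interior_subset[b1 _] /interior_subset[_ b2] Gu Gv.
apply: hquot_eq; apply: B1; first exact: BB.
exact: lattice_hquot.
Qed.

(** At most one lattice element lies near [w]; being different from [w], it is avoided by a smaller
    neighbourhood. *)
Lemma lattice_closed (w : H) : ~ Gamma (theta w) ->
  \forall u \near w, ~ Gamma (theta u).
Proof.
move=> Nw; have [ O nO O1] := lattice_isolated w.
have [[v [Ov Gv]] | nG] := pselect (exists v, O v /\ Gamma (theta v)).
  have vw : v - w != 0.
    by rewrite subr_eq0; apply/eqP => vw; apply: Nw; rewrite -vw.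
  have nv : \forall u \near w, u != v.
    have sv : smooth_near w (fun u : H => v + (- 1) *: u).
      apply: smooth_nearD; first exact: smooth_near_cst.
      apply: (smooth_near_linear (L := *:%R (-1))); exact: scaler_continuous.
    have nz : nbhs w ((fun u : H => v + (- 1) *: u) @^-1` [set u | u != 0]).
      apply: (smooth_near_continuous sv); apply: open_nbhs_nbhs.
      by split; [exact: open_neq0|rewrite /= scaleN1r].
    apply: filterS nz => u /=; rewrite scaleN1r subr_eq0.
    by rewrite eq_sym.
  apply: filterS2 nv (open_nbhs_nbhs nO) => u uv Ou Gu.
  by move/eqP: uv; apply; exact: O1.
apply: filterS (open_nbhs_nbhs nO) => u Ou Gu; by apply: nG; exists u.
Qed.

(** Take a finite subcover by the open sets of [lattice_isolated], each with at most one lattice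
    element. *)
Lemma lattice_compact_finite (K : set H) : compact K ->
  finite_set [set w | Gamma (theta w) /\ K w].
Proof.
move=> cK; have : @cover_compact (pointed_at ((0, 0) : H)) K by rewrite -compact_cover.
move=> /(_ H K).
pose O w := projT1 (cid2 (lattice_isolated w)).
have OP w : open_nbhs w (O w) by rewrite /O; case: cid2.
have O1 w u v : O w u -> O w v -> Gamma (theta u) -> Gamma (theta v) -> u = v.
  by rewrite /O; case: cid2 => /= O' _; exact.
move=> /(_ O) []; first by move=> w _; case: (OP w).
  by move=> w Kw; exists w => //; case: (OP w).
move=> D0 _ KD; move: KD (finite_fset D0); set D := (X in _ `<=` cover X _) => KD fD.
have sub : [set w | Gamma (theta w) /\ K w] `<=`
    \bigcup_(w in D) [set u | O w u /\ Gamma (theta u)].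
  by move=> w [Gw Kw]; have [v Dv Ov] := KD _ Kw; exists v.
apply: (sub_finite_set sub).
apply: bigcup_finite; first exact: fD.
move=> w _; have [[u [Ou Gu]] | nG] := pselect (exists u, O w u /\ Gamma (theta u)).
  apply: (@sub_finite_set _ _ [set u]); last exact: finite_set1.
  by move=> v [Ov Gv]; exact: (O1 w v u).
apply: (@sub_finite_set _ _ set0); last exact: finite_set0.
by move=> v Hv; apply: nG; exists v.
Qed.

Let cP := coset_paramP fA c0 dMs GE gG GG.
Let eC := etale_coset fA c0 dMs GE gG GG.

Lemma coset_param_hquot w w' : coset_param GE Gamma w = coset_param GE Gamma w' <->
  Gamma (theta (hquot (w', w))).
Proof.
apply: (iff_trans (cP w w')); split=> [[[u Gu] /= ->]|Gu].
  by rewrite hquot_mul.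
by exists (exist (fun w => Gamma (theta w)) _ Gu); rewrite /= hquotK.
Qed.

(** The lattice is closed, so a quotient of [w'] by [w] outside it stays outside for nearby pairs;
    the projection to cosets is open. *)
Lemma coset_hausdorff : hausdorff_space (coset_space Gamma G).
Proof.
apply/hausdorff_nbhsP => x y xy.
have [w xE] := coset_param_surj GE x; have [w' yE] := coset_param_surj GE y.
have Nw : ~ Gamma (theta (hquot (w', w))).
  by move=> /coset_param_hquot E; apply: xy; rewrite xE yE.
have [B1 [B2 [n1 n2 BB]]] := hquot_near (lattice_closed Nw).
exists (coset_param GE Gamma @` B2), (coset_param GE Gamma @` B1).
have [_ eC'] := eC; split.
- by rewrite xE; have [_ o _] := eC' w I; exact: o.
- by rewrite yE; have [_ o _] := eC' w' I; exact: o.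
- move=> z [u b2 <-] [v b1 /esym /coset_param_hquot].
  exact: (BB _ _ b1 b2).
Qed.

Lemma coset_locally_injective (w : H) : exists2 B : set H, nbhs w B &
  {in B &, injective (coset_param GE Gamma)}.
Proof.
have [B nB B1] := lattice_discrete.
have nq : nbhs (hquot (w, w)) B by rewrite /hquot /= (hmulrV AD A0).
have [B1' [B2' [n1 n2 BB]]] := hquot_near nq.
exists (B1' `&` B2'); first exact: filterI.
move=> u v /set_mem[u1 u2] /set_mem[v1 v2] /coset_param_hquot Gq.
by apply/esym/hquot_eq; apply: B1 => //; exact: BB.
Qed.

Lemma coset_manifold : smooth_manifold (coset_space Gamma G).
Proof.
apply: (@etale_manifold R H (prod_findim (matrix_findim _ _) real_findim) _ setT (coset_param GE Gamma)).
- exact: eC.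
- by move=> x; have [w ->] := coset_param_surj GE x; exists w.
- by move=> w _; exact: coset_locally_injective.
- exact: coset_hausdorff.
Qed.

Section ProperAction.
Context (Om : set (projective R (N + 1))).
Context (OmE : forall x, Om x <-> exists2 z, stable_nonzero z & x = chart_point z).

Definition group_coord (z : V) : H :=
  (z.1, hit (fun t => ulsubmx (val (A t))) (usubmx z.2)).

Lemma group_coord_act w z : stable_nonzero z ->
  group_coord (hact w z) = hmul w (group_coord z).
Proof.
case: w => b t; case: z => a x; rewrite /stable_nonzero /= => x0.
rewrite /group_coord /hact /hmul /=; congr pair.
rewrite (flow_block fA) -{1}[x]vsubmxK mul_block_col mul0mx addr0 col_mxKu.
by rewrite (hit_flow (flow_ul fA) c0 dMs) // addrC.
Qed.

Lemma smooth_near_group_coord z : stable_nonzero z -> smooth_near z group_coord.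
Proof.
move=> z0; apply: smooth_near_pair; first exact/smooth_near_fst/smooth_near_id.
apply: (smooth_near_comp (f := fun z : V => usubmx z.2)).
  exact: (smooth_near_hit (flow_ul fA) c0 dMs).
apply: smooth_near_mx => i j; under eq_fun do rewrite mxE.
exact/smooth_near_entry/smooth_near_snd/smooth_near_id.
Qed.

(** If [theta w] takes a point of [K] back into [K], equivariance of [group_coord] makes [w] a
    quotient of two elements of the compact image of [K]. Such quotients form a compact set, which
    contains finitely many lattice elements. *)
Lemma Omega_properly_discontinuous : properly_discontinuous Gamma Om.
Proof.
move=> K KOm cK.
pose f x := group_coord (point_retract sigma x).
have cf : {within K, continuous f}.
  apply: continuous_in_subspaceT => x /set_mem /KOm /OmE[z z0 ->].
  apply: (continuous_for_comp (f := point_retract sigma)).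
    by have [] := point_retract_smooth sigma z.
  by rewrite (point_retractK sigma); exact: smooth_near_continuous (smooth_near_group_coord z0).
have cfK : compact (f @` K) by exact: continuous_compact.
have cq : compact (hquot @` (f @` K `*` f @` K)).
  apply: continuous_compact; last exact: compact_setX.
  apply: continuous_subspaceT => w; exact: smooth_near_continuous (smooth_near_hquot w).
apply: (@sub_finite_set _ _ (theta @` [set w | Gamma (theta w) /\
    (hquot @` (f @` K `*` f @` K)) w])); last first.
  by apply: finite_image; exact: lattice_compact_finite.
move=> g [Gg [_ [[x Kx <-] Kgx]]].
have /GE[w gE] := GG Gg; subst g; exists w => //; split=> //.
exists (f (proj_act (theta w) x), f x) => /=.
  by split; [exists (proj_act (theta w) x)|exists x].
have /OmE[z z0 xE] := KOm _ Kx; subst x.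
rewrite theta_act /f !(point_retractK sigma) group_coord_act //.
by rewrite hquot_mul.
Qed.

Lemma Omega_open : open Om.
Proof.
rewrite openE => x /OmE[z z0 ->].
have [cr _] := point_retract_smooth sigma z.
have cp := point_dom_near sigma z.
have nr : nbhs (chart_point z) (point_retract sigma @^-1` (@stable_nonzero R p q)).
  apply: cr; rewrite (point_retractK sigma).
  by apply: open_nbhs_nbhs; split; first exact: open_stable_nonzero.
by apply: filterS2 cp nr => y yE yW; apply/OmE; exists (point_retract sigma y).
Qed.

Lemma Omega_invariant g z : Gamma g -> Om z -> Om (proj_act g z).
Proof.
move=> /GG/GE[w ->] /OmE[y y0 ->]; rewrite theta_act; apply/OmE.
by exists (hact w y) => //; exact: (stable_nonzero_act fA).
Qed.

Lemma Omega_discontinuity_domain : discontinuity_domain Gamma Om.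
Proof.
split; [exact: Omega_open|exact: Omega_invariant|].
exact: Omega_properly_discontinuous.
Qed.

End ProperAction.
End Discreteness.

(** * Recurrence *)

(** The sets [E n] cover, so the common measure [a] is positive; pairwise disjoint [F n] would then
    exceed any finite total measure. *)
Lemma finite_measure_overlap (R : realType) d (T : measurableType d)
    (mu : {measure set T -> \bar R}) (F E : nat -> set T) (a : \bar R) :
  mu setT != 0%E -> (mu setT < +oo)%E ->
  (forall n, measurable (F n)) -> (forall n, mu (F n) = a) ->
  (forall n, measurable (E n)) -> (forall n, mu (E n) = a) ->
  (forall x, exists n, E n x) ->
  exists m n x, [/\ (m < n)%N, F m x & F n x].
Proof.
move=> T0 fT mF aF mE aE cov; apply: contrapT => disj.
have a0 : a != 0%E.
  apply: contra T0 => /eqP aE0; rewrite eq_le measure_ge0 andbT.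
  have cE : setT `<=` \bigcup_n E n by move=> x _; have [n En] := cov x; exists n.
  have := @measure_sigma_subadditive _ _ _ mu _ _ mE measurableT cE.
  by move=> /le_trans; apply; rewrite eseries0 // => i _ _; rewrite [LHS]aE.
have tF : trivIset setT F.
  apply: ltn_trivIset => n m mn; apply/seteqP; split=> // x [Fx Fy].
  by apply: disj; exists m, n, x.
have fin (B : set T) : measurable B -> mu B \is a fin_num.
  move=> mB; rewrite ge0_fin_numE ?measure_ge0 //; apply: le_lt_trans fT.
  by apply: le_measure; rewrite ?inE //; exact: measurableT.
have a_fin : a = (fine a)%:E by rewrite fineK // -(aF 0%N) fin.
have a_gt0 : 0 < fine a.
  rewrite lt_neqAle fine_ge0 -?(aF 0%N) ?measure_ge0 // andbT eq_sym (aF 0%N).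
  by apply: contra a0 => /eqP E0; rewrite a_fin E0.
pose m := fine (mu setT).
have le k : fine a *+ k <= m.
  have : (mu (\big[setU/set0]_(i < k) F i) <= mu setT)%E.
    by apply: le_measure; rewrite ?inE //; exact: bigsetU_measurable.
  have -> : mu (\big[setU/set0]_(i < k) F i) = (\sum_(i < k) (fine a)%:E)%E.
    by rewrite measure_bigsetU //; apply: eq_bigr => i _; rewrite [LHS]aF.
  rewrite sumEFin sumr_const card_ord -[mu setT]fineK ?fin //.
have := le (Num.truncn (m / fine a)).+1.
rewrite leNgt -mulr_natl -ltr_pdivrMr // => /negP; apply.
exact: truncnS_gt.
Qed.

(** The translates by [h] only certify that [B] has positive measure; the overlap is found among the
    translates by [e]. Measurability is ensured by openness. *)
Lemma covolume_overlap (R : realType) n (Gamma G : set (PGL R n))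
    (B : set (coset_space Gamma G)) (h e : nat -> PGL R n) :
  finite_covolume Gamma G -> (forall n, G (h n)) -> (forall n, G (e n)) ->
  open B -> (forall g, G g -> open (right_translate g B)) ->
  (forall y, exists n, right_translate (h n) B y) ->
  exists m n y, [/\ (m < n)%N, right_translate (e m) B y & right_translate (e n) B y].
Proof.
move=> fG hG eG oB oF cov; destruct fG as [x [mu [mu0 muT mu_inv]]].
have mop (S : set (borel x)) : open (S : set (coset_space Gamma G)) -> measurable S.
  by move=> oS; apply: sub_sigma_algebra.
have mF g : G g -> measurable (right_translate g B : set (borel x)).
  by move=> /oF; exact: mop.
have mu_F g : G g -> mu (right_translate g B) = mu B.
  by move=> Gg; apply: mu_inv => //; exact: mop.
exact: (finite_measure_overlap mu0 muT (fun k => mF _ (eG k)) (fun k => mu_F _ (eG k))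
  (fun k => mF _ (hG k)) (fun k => mu_F _ (hG k)) cov).
Qed.

Section Recurrence.
Context {R : realType} (p q : nat) (A : R -> GL R (p.+1 + q))
  (Ms : 'M[R]_p.+1) (Mu : 'M[R]_q)
  (fA : linear_flow (fun t => val (A t)) (block_mx Ms 0 0 Mu)) (c : R) (c0 : 0 < c)
  (dMs : forall x, rdotmx x (Ms *m x) <= - c * rdotmx x x)
  (sigma : GL R[i] (p.+1 + q + 1)).
Local Notation N := (p.+1 + q)%N.
Local Notation H := ('cV[R]_N * R)%type.
Local Notation theta := (theta A sigma).
Local Notation hmul := (hmul A).
Local Notation hinv := (hinv A).
Local Notation hquot := (hquot A).
Context (G : set (PGL R (N + 1))) (GE : forall g, G g <-> exists w, g = theta w).
Context (Gamma : set (PGL R (N + 1))) (gG : pgl_subgroup Gamma)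
  (GG : Gamma `<=` G) (fG : finite_covolume Gamma G).

Let AD s t : val (A (s + t)) = val (A s) *m val (A t). Proof. exact: (flowD fA). Qed.
Let A0 : val (A 0) = 1%:M. Proof. exact: (flow0 fA). Qed.
Let cP := coset_paramP fA c0 dMs GE gG GG.
Let eC := etale_coset fA c0 dMs GE gG GG.
Local Notation cp := (coset_param GE Gamma).

Lemma coset_param_open (U : set H) : open U -> open (cp @` U).
Proof.
move=> oU; rewrite openE => _ [w Uw <-]; have [_ /(_ w I)[_ o _]] := eC.
by apply: o; exact: open_nbhs_nbhs.
Qed.

Lemma right_translate_coset_param g (U : set H) :
  right_translate (theta g) (cp @` U) = cp @` ((fun u => hmul u g) @` U).
Proof.
apply/seteqP; split=> z.
  move=> [y [x [[u Uu E] yE]] <-]; have [w xE] := theta_G_surj GE x.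
  subst x; have /cP[i wE] : cp u = cp w := E.
  exists (hmul u g); first by exists u.
  have -> : y = theta_G GE (hmul w g).
    by apply: val_inj; rewrite yE /= (theta_mul AD).
  by apply/cP; exists i; rewrite wE (hmulA AD).
move=> [_ [u Uu <-] <-]; exists (theta_G GE (hmul u g)) => //.
exists (theta_G GE u); split; first by exists u.
by rewrite /= (theta_mul AD).
Qed.

Lemma open_translate (U : set H) g : open U -> open ((fun u => hmul u g) @` U).
Proof.
move=> oU; rewrite openE => _ [u Uu <-].
have nq : nbhs (hquot (hmul u g, g)) U.
  by rewrite (hquot_mul fA); exact: open_nbhs_nbhs.
have [B1 [B2 [n1 n2 BB]]] := hquot_near fA nq.
apply: filterS n1 => w Bw; exists (hquot (w, g)).
  by apply: BB => //; exact: nbhs_singleton n2.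
by rewrite (hquotK fA).
Qed.

(** Rational points [h] are dense, and [w] times the inverse of [h] is close to [u0] when [h] is
    close to [v0], the product of the inverse of [u0] with [w]. *)
Lemma countable_translates (U : set H) : open U -> U !=set0 ->
  exists h : nat -> H, forall w, exists n, exists2 u, U u & w = hmul u (h n).
Proof.
move=> oU [u0 Uu0].
pose fH : findim H := prod_findim (matrix_findim _ _) real_findim.
exists (fun n => if unpickle n is Some r then @rat_point R H fH r else (0, 0)).
move=> w; pose v0 := hmul (hinv u0) w.
have wE : w = hmul u0 v0 by rewrite /v0 (hmulA AD) (hmulrV AD A0) (hmul1 A0).
have nq : nbhs (hquot (w, v0)) U.
  by rewrite wE (hquot_mul fA); exact: open_nbhs_nbhs.
have [B1 [B2 [n1 n2 BB]]] := hquot_near fA nq.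
have [e0 /= e00 eB] : exists2 e0 : R, 0 < e0 & ball v0 e0 `<=` B2.
  by have /nbhs_ballP[e0 /= e00 eB] := n2; exists e0.
have [r vr] := @rat_point_dense R H fH v0 e0 e00.
exists (pickle r), (hquot (w, @rat_point R H fH r)).
  apply: BB; first exact: nbhs_singleton n1.
  by apply: eB; rewrite -ball_normE.
by rewrite pickleK (hquotK fA).
Qed.

(* Poincare recurrence for the right action of G on the finite measure space
   Gamma \ G *)
Lemma lattice_recurrence (U : set H) (e : nat -> H) : open U -> U !=set0 ->
  exists m n u v, [/\ (m < n)%N, U u, U v &
    Gamma (theta (hquot (hmul v (e n), hmul u (e m))))].
Proof.
move=> oU neU; have [h hw] := countable_translates oU neU.
have Gt w : G (theta w) by apply/GE; exists w.
have oF g : G g -> open (right_translate g (cp @` U)).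
  move=> /GE[w ->]; rewrite right_translate_coset_param.
  by apply: coset_param_open; exact: open_translate.
have cov y : exists n, right_translate (theta (h n)) (cp @` U) y.
  have [w yE] := coset_param_surj GE y; have [n [u Uu wE]] := hw w.
  exists n; rewrite right_translate_coset_param yE; exists w => //.
  by exists u.
have [m [n [y []]]] := covolume_overlap fG (fun n => Gt (h n)) (fun n => Gt (e n))
  (coset_param_open oU) oF cov.
rewrite !right_translate_coset_param => mn [_ [u Uu <-] yE] [_ [v Vv <-] yE'].
exists m, n, u, v; split=> //.
apply/(coset_param_hquot fA c0 dMs GE gG GG).
by rewrite yE yE'.
Qed.
End Recurrence.

(** * Compact sets and decay *)

Section Compactness.
Context {R : realType}.

(** Closed balls of row vectors are compact, and linear coordinates carry them over. *)
Lemma findim_compact_nbhs (V : normedModType R) (fV : findim V) (x : V) (B : set V) :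
  nbhs x B -> exists2 K, nbhs x K & compact K /\ K `<=` B.
Proof.
move=> nB; have co := smooth_near_continuous (@smooth_near_of_row R V fV (to_row x)).
have ct := smooth_near_continuous (@smooth_near_to_row R V fV x).
have nB' : nbhs (to_row x) (@of_row R V fV @^-1` B) by apply: co; rewrite to_rowK.
have /nbhs_closedballP[r rB] := nB'.
exists (@of_row R V fV @` closed_ball (to_row x) r%:num).
  have nb : nbhs x (@to_row R V fV @^-1` ball (to_row x) r%:num).
    by apply: ct; exact: nbhsx_ballx.
  apply: filterS nb => y yb; exists (to_row y); last exact: to_rowK.
  exact: subset_closed_ball.
split; last by move=> _ [y yb <-]; exact: rB.
apply: continuous_compact.
  apply: continuous_subspaceT => y.
  exact: smooth_near_continuous (@smooth_near_of_row R V fV y).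
apply: bounded_closed_compact; last exact: closed_ball_closed.
exists (`|to_row x| + r%:num); split; first exact: num_real.
move=> M lM y; rewrite closed_ballE // => /= yr; apply: le_trans (ltW lM).
rewrite -[y in `|y|](subrK (to_row x)) addrC (le_trans (ler_normD _ _)) //.
by rewrite lerD2l distrC.
Qed.

(** A compact neighbourhood of 0 is scaled up until it contains the ball. *)
Lemma findim_compact_ball (V : normedModType R) (fV : findim V) (r : R) :
  exists2 K : set V, compact K & ball 0 r `<=` K.
Proof.
have [K nK [cK _]] := findim_compact_nbhs fV (filterT : nbhs (0 : V) setT).
have /nbhs_ballP[e /= e0 eK] := nK.
exists ((fun x => (`|r| / e + 1) *: x) @` K).
  apply: continuous_compact => //; apply: continuous_subspaceT => x.
  exact: scaler_continuous.
have s0 : 0 < `|r| / e + 1 by rewrite ltr_wpDl // divr_ge0 // ltW.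
move=> x; rewrite -ball_normE /= sub0r normrN => xr.
exists ((`|r| / e + 1)^-1 *: x); last by rewrite scalerA divff ?gt_eqF // scale1r.
apply: eK; rewrite -ball_normE /= sub0r normrN normrZ gtr0_norm ?invr_gt0 //.
rewrite mulrC ltr_pdivrMr // mulrDr mulr1 mulrCA divff ?gt_eqF // mulr1.
by rewrite (lt_le_trans xr) // (le_trans (ler_norm r)) // lerDl ltW.
Qed.

Lemma ball_rdotmx n (x : 'cV[R]_n) r : 0 < r -> rdotmx x x < r ^+ 2 -> ball 0 r x.
Proof.
move=> r0 xr; split=> [//|i j]; rewrite (ord1 j) -ball_normE /= mxE sub0r normrN.
rewrite -(ltr_pXn2r (n := 2)) ?nnegrE ?normr_ge0 ?(ltW r0) //.
apply: le_lt_trans xr; rewrite real_normK ?num_real // /rdotmx (bigD1 i) //=.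
by rewrite expr2 lerDl sumr_ge0 // => k _; rewrite -expr2 sqr_ge0.
Qed.

Lemma flow_vanish n (A : R -> 'M[R]_n) M (c : R) (x : 'cV[R]_n) (B : set 'cV[R]_n) :
  linear_flow A M -> 0 < c ->
  (forall x, rdotmx x (M *m x) <= - c * rdotmx x x) ->
  nbhs (0 : 'cV[R]_n) B -> exists t0, forall t, t0 <= t -> B (A t *m x).
Proof.
move=> fA c0 dM /nbhs_ballP[e /= e0 eB].
pose D := rdotmx x x; have D0 : 0 <= D := rdotmx_ge0 x.
(* By [1 + x <= expR x] the squared norm at time [t] is at most [D / (1 + 2 * c * t)], which is
   below [e ^+ 2] from this time on. *)
exists (D / e ^+ 2 / (2 * c)) => t tt; apply: eB; apply: ball_rdotmx => //.
have k0 : 0 < 2 * c by rewrite mulr_gt0.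
have t0 : 0 <= t.
  by apply: le_trans tt; exact: divr_ge0 (divr_ge0 D0 (sqr_ge0 _)) (ltW k0).
have := energy_decay fA dM x t0; rewrite subr0 (flow0 fA) mul1mx -/D.
move=> /le_lt_trans; apply; rewrite expRN mulrC ltr_pdivrMr ?expR_gt0 //.
have e20 : 0 < e ^+ 2 by rewrite exprn_gt0.
apply: (@lt_le_trans _ _ (e ^+ 2 * (1 + 2 * c * t))); last first.
  by rewrite ler_pM2l // expR_ge1Dx.
rewrite mulrDr mulr1; suff : D <= e ^+ 2 * (2 * c * t) by lra.
move: tt; rewrite ler_pdivrMr // ler_pdivrMr // => /le_trans; apply.
by rewrite [leRHS]mulrC [2 * c * t]mulrC.
Qed.
End Compactness.

(** * Contracting flows admit no lattice *)

Section Contracting.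
Context {R : realType} (p q : nat) (A : R -> GL R (p.+1 + q))
  (Ms : 'M[R]_p.+1) (Mu : 'M[R]_q)
  (fA : linear_flow (fun t => val (A t)) (block_mx Ms 0 0 Mu)) (c : R) (c0 : 0 < c)
  (dMs : forall x, rdotmx x (Ms *m x) <= - c * rdotmx x x)
  (sigma : GL R[i] (p.+1 + q + 1)).
Local Notation N := (p.+1 + q)%N.
Local Notation H := ('cV[R]_N * R)%type.
Local Notation theta := (theta A sigma).
Local Notation hmul := (hmul A).
Local Notation hinv := (hinv A).
Local Notation hact := (hact A).
Local Notation hquot := (hquot A).
Context (G : set (PGL R (N + 1))) (GE : forall g, G g <-> exists w, g = theta w).
Context (Gamma : set (PGL R (N + 1))) (gG : pgl_subgroup Gamma)
  (GG : Gamma `<=` G) (dG : discrete_subset Gamma) (fG : finite_covolume Gamma G).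
Context (dM : forall x, rdotmx x (block_mx Ms 0 0 Mu *m x) <= - c * rdotmx x x).

Let AD s t : val (A (s + t)) = val (A s) *m val (A t). Proof. exact: (flowD fA). Qed.
Let A0 : val (A 0) = 1%:M. Proof. exact: (flow0 fA). Qed.
Let recurrence := lattice_recurrence fA c0 dMs GE gG GG fG.

(** For [t > 0] the matrix [A t] strictly decreases the norm of nonzero vectors, so it fixes only 0
    and [1%:M - A t] is invertible. *)
Lemma contraction_fixpoint (b : 'cV[R]_N) (t : R) : 0 < t ->
  exists z, b + val (A t) *m z = z.
Proof.
move=> t0; have u : 1%:M - val (A t) \in unitmx.
  apply: unitmx_inj => x; rewrite mulmxBl mul1mx => /subr0_eq xA.
  apply/eqP; rewrite -rdotmx_eq0; apply/negPn/negP => x0.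
  have := energy_decay fA dM x (ltW t0); rewrite (flow0 fA) mul1mx subr0 -xA.
  have xx : 0 < rdotmx x x by rewrite lt_def x0 rdotmx_ge0.
  by rewrite leNgt gtr_pMl // -expR0 ltr_expR oppr_lt0 !mulr_gt0.
exists (invmx (1%:M - val (A t)) *m b).
have E : (1%:M - val (A t)) *m (invmx (1%:M - val (A t)) *m b) = b by rewrite mulKVmx.
by rewrite -{1}E mulmxBl mul1mx subrK.
Qed.

Section Stabilizer.
Context (z : 'cV[R]_N).
(** The stabilizer of the real point [z], as a one-parameter subgroup: [b + A t z = z] determines
    the translation [b]. *)
Definition stab (t : R) : H := (z - val (A t) *m z, t).

Lemma stab_mul s t : hmul (stab s) (stab t) = stab (s + t).
Proof.
rewrite /hmul /stab /=; congr pair.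
by rewrite AD mulmxBr mulmxA addrA subrK.
Qed.

(** The stabilizer is linear in coordinates centred at [z]: if [w] moves [z] by [d], the conjugate
    moves it by [A s d], with the same time component. *)
Lemma stab_conj s w :
  hquot (hmul (stab s) w, stab s) =
  (z - val (A w.2) *m z + val (A s) *m (w.1 + val (A w.2) *m z - z), w.2).
Proof.
have AC : val (A s) *m val (A w.2) = val (A w.2) *m val (A s) by rewrite -!AD addrC.
rewrite -[RHS](hquot_mul fA _ (stab s)); congr (hquot (_, _)).
rewrite /hmul /stab /=; congr pair; last by rewrite addrC.
rewrite !mulmxBr !mulmxDr !mulmxA AC.
move: (_ *m z) (_ *m z) (_ *m z) (_ *m w.1) => b a d e.
by apply/matrixP => i j; rewrite !mxE; ring.
Qed.
End Stabilizer.

Lemma hinv_hmul u v : hinv (hmul u v) = hmul (hinv v) (hinv u).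
Proof.
rewrite -[RHS](hmulr1 A) -(hmulrV AD A0 (hmul u v)) (hmulA AD).
rewrite -(hmulA AD (hinv v)) (hmulA AD (hinv u)) (hmulV A) (hmul1 A0) (hmulV A).
by rewrite (hmul1 A0).
Qed.

Lemma hquot_mulr u v w : hquot (hmul u w, hmul v w) = hquot (u, v).
Proof.
rewrite /hquot /= hinv_hmul (hmulA AD) -(hmulA AD u) (hmulrV AD A0).
by rewrite (hmulr1 A).
Qed.

Let Gmul u v : Gamma (theta u) -> Gamma (theta v) -> Gamma (theta (hmul u v)).
Proof. by have [_ GM _] := gG => Gu Gv; rewrite -(theta_mul AD sigma); exact: GM. Qed.

Lemma lattice_contraction : exists (z : 'cV[R]_N) (t : R), 0 < t /\ Gamma (theta (stab z t)).
Proof.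
(* Times in [U] are so small that the time of the recurring element differs by less than 1/2 from
   [n - m], which is at least 1. *)
pose U : set H := [set u | `|u.2| < 1 / 4].
have oU : open U.
  rewrite openE => u uU.
  have s : smooth_near u (fun u : H => u.2) by exact/smooth_near_snd/smooth_near_id.
  have n : nbhs u ((fun u : H => u.2) @^-1` [set x | `|x| < 1 / 4]).
    apply: (smooth_near_continuous s); apply: open_nbhs_nbhs; split=> //.
    have -> : [set x : R | `|x| < 1 / 4] = ball 0 (1 / 4).
      by apply/seteqP; split=> x; rewrite -ball_normE /= sub0r normrN.
    by apply: ball_open; lra.
  exact: n.
have neU : U !=set0 by exists (0, 0); rewrite /U /= normr0; lra.
have [m [n [u [v [mn Uu Uv Gw]]]]] := recurrence (fun m => (0, m%:R)) oU neU.
move: Gw; set w := hquot _ => Gw.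
have w2 : w.2 = v.2 + n%:R - (u.2 + m%:R) by [].
have mnR : m%:R + 1 <= n%:R :> R by rewrite natr1 ler_nat.
have wt : 0 < w.2 by move: Uu Uv; rewrite w2 /U /= !ltr_norml; lra.
have [z zE] := contraction_fixpoint w.1 wt.
exists z, w.2; split=> //.
suff -> : stab z w.2 = w by [].
by rewrite /stab -{1}zE addrK -surjective_pairing.
Qed.

(* If w in Gamma moves z by d, conjugating w by powers of a contraction in Gamma
   fixing z gives elements of Gamma moving z by A(k t) d, which converge. *)
Lemma lattice_fixes : exists z : 'cV[R]_N,
  forall w, Gamma (theta w) -> w.1 + val (A w.2) *m z = z.
Proof.
have [z [t [t0 Gt]]] := lattice_contraction; exists z => w Gw.
have Gs k : Gamma (theta (stab z (k%:R * t))).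
  elim: k => [|k IH]; last first.
    have -> : k.+1%:R * t = t + k%:R * t by rewrite -natr1 mulrDl mul1r addrC.
    by rewrite -stab_mul; exact: Gmul.
  by rewrite mul0r /stab A0 mul1mx subrr (theta1 A0 sigma); have [] := gG.
pose d := w.1 + val (A w.2) *m z - z.
pose g k : H := (z - val (A w.2) *m z + val (A (k%:R * t)) *m d, w.2).
have Gg k : Gamma (theta (g k)).
  rewrite /g -(stab_conj z (k%:R * t) w).
  apply: (lattice_hquot fA gG); last exact: Gs.
  exact: Gmul (Gs k) Gw.
have [ O nO O1] := lattice_isolated fA c0 dMs GE gG dG (z - val (A w.2) *m z, w.2).
pose f (x : 'cV[R]_N) : H := (z - val (A w.2) *m z + x, w.2).
have nf : nbhs (0 : 'cV[R]_N) (f @^-1` O).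
  have sf : smooth_near (0 : 'cV[R]_N) f.
    apply: smooth_near_pair; last exact: smooth_near_cst.
    by apply: smooth_nearD; [exact: smooth_near_cst|exact: smooth_near_id].
  apply: (smooth_near_continuous sf); rewrite /f addr0; exact: open_nbhs_nbhs.
have [t1 t1P] := flow_vanish d fA c0 dM nf.
pose k := (Num.truncn (`|t1| / t)).+1.
have kt : t1 <= k%:R * t.
  rewrite (le_trans (ler_norm _)) // -ler_pdivrMr // ltW //; exact: truncnS_gt.
have kt' : t1 <= (k.+1)%:R * t.
  by apply: le_trans kt _; rewrite ler_pM2r // ler_nat.
(* Both elements lie in the isolating neighbourhood [O], so they coincide: [A t] fixes the vector
   [A (k * t) d], which must then be 0. *)
have : g k = g k.+1 by apply: O1; rewrite ?Gg //; exact: t1P.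
move=> [/addrI].
have -> : k.+1%:R * t = t + k%:R * t by rewrite -natr1 mulrDl mul1r addrC.
rewrite AD -mulmxA => E.
have fix_d : val (A t) *m (val (A (k%:R * t)) *m d) = val (A (k%:R * t)) *m d by [].
have Ad0 : val (A (k%:R * t)) *m d = 0.
  apply/eqP; rewrite -rdotmx_eq0; apply/negPn/negP => x0.
  have := energy_decay fA dM (val (A (k%:R * t)) *m d) (ltW t0).
  rewrite (flow0 fA) mul1mx subr0 fix_d.
  have xx : 0 < rdotmx (val (A (k%:R * t)) *m d) (val (A (k%:R * t)) *m d).
    by rewrite lt_def x0 rdotmx_ge0.
  by rewrite leNgt gtr_pMl // -expR0 ltr_expR oppr_lt0 !mulr_gt0.
have d0 : d = 0.
  by apply/eqP/negPn/negP => /(flow_neq0 fA (k%:R * t)); rewrite Ad0 eqxx.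
by apply/eqP; rewrite -subr_eq0 -/d d0.
Qed.

Lemma smooth_near_hinv u : smooth_near u hinv.
Proof.
apply: (smooth_near_ext (f := fun u : H => hquot (((0, 0) : H), u))).
  by move=> v; rewrite /hquot /= (hmul1 A0).
apply: (smooth_near_comp (g := hquot)); first exact: (smooth_near_hquot fA).
by apply: smooth_near_pair; [exact: smooth_near_cst|exact: smooth_near_id].
Qed.

(** Let [z] be the common fixed point. Recurrence for the multiples of the translation by [b], of
    norm at least 2, among group elements whose inverse moves [z] by less than 1, gives a lattice
    element [v ((n - m) b) u^-1]. It fixes [z], so [(n - m) b] is a difference of two points at
    distance less than 1 from [z]. *)
Lemma contracting_no_lattice : False.
Proof.
have [z zP] := lattice_fixes.
pose b : 'cV[R]_N := const_mx 2.
have b2 : 2 <= `|b|.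
  rewrite leNgt; apply/negP => b2; have : ball (0 : 'cV[R]_N) 2 b.
    by rewrite -ball_normE /= sub0r normrN.
  by move=> [_ /(_ 0 0)]; rewrite -ball_normE /= !mxE sub0r normrN normr_nat ltxx.
pose f (u : H) : 'cV[R]_N := (hact (hinv u) (z, 0)).1.
pose U : set H := [set u | ball z 1 (f u)].
have cf u : {for u, continuous f}.
  apply: smooth_near_continuous; apply: smooth_nearD.
    exact: smooth_near_fst (smooth_near_hinv u).
  apply: smooth_near_mulmx; last exact: smooth_near_cst.
  by apply: (smooth_near_A fA); exact: smooth_near_snd (smooth_near_hinv u).
have oU : open U.
  rewrite openE => u uU; apply: cf; apply: open_nbhs_nbhs; split=> //.
  exact: ball_open.
have neU : U !=set0.
  exists (0, 0); rewrite /U /f /= oppr0 A0 mul1mx mul1mx oppr0 add0r; exact: ballxx.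
have [m [n [u [v [mn Uu Uv]]]]] := recurrence (fun m => (m%:R *: b, 0)) oU neU.
have -> : (n%:R *: b, 0) = hmul ((n - m)%:R *: b, 0) (m%:R *: b, 0).
  by rewrite /hmul /= A0 mul1mx -scalerDl -natrD subnK ?(ltnW mn) // addr0.
rewrite (hmulA AD) hquot_mulr => Gw.
have : hact (hquot (hmul v ((n - m)%:R *: b, 0), u)) (z, 0) = (z, 0).
  by rewrite /hact zP // mulmx0.
rewrite /hquot (hactM AD) (hactM AD) => /(congr1 (hact (hinv v))).
rewrite (hactK AD A0) => /(congr1 fst); rewrite -/(f v).
rewrite {1}/hact A0 mul1mx -/(f u) => E.
have : `|(n - m)%:R *: b| < 2.
  have -> : (n - m)%:R *: b = (z - f u) - (z - f v).
    by rewrite opprB addrC subrKA -E addrK.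
  move: Uu Uv; rewrite /U /= -!ball_normE /= => Uu Uv.
  rewrite (le_lt_trans (ler_normB _ _)) //; lra.
rewrite normrZ normr_nat ltNge => /negP; apply; apply: le_trans b2 _.
by rewrite ler_peMl // ler1n subn_gt0.
Qed.
End Contracting.

(** * Maximality *)

Section Maximality.
Context {R : realType} (p q : nat) (A : R -> GL R (p.+1 + q))
  (Ms : 'M[R]_p.+1) (Mu : 'M[R]_q)
  (fA : linear_flow (fun t => val (A t)) (block_mx Ms 0 0 Mu)) (c : R) (c0 : 0 < c)
  (dMs : forall x, rdotmx x (Ms *m x) <= - c * rdotmx x x)
  (dMu : forall y, c * rdotmx y y <= rdotmx y (Mu *m y))
  (sigma : GL R[i] (p.+1 + q + 1)).
Local Notation N := (p.+1 + q)%N.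
Local Notation H := ('cV[R]_N * R)%type.
Local Notation V := ('cV[R]_N * 'cV[R]_N)%type.
Local Notation theta := (theta A sigma).
Local Notation chart_point := (chart_point sigma).
Local Notation hmul := (hmul A).
Local Notation hinv := (hinv A).
Local Notation hact := (hact A).
Local Notation hquot := (hquot A).
Context (G : set (PGL R (N + 1))) (GE : forall g, G g <-> exists w, g = theta w).
Context (Gamma : set (PGL R (N + 1))) (gG : pgl_subgroup Gamma)
  (GG : Gamma `<=` G) (dG : discrete_subset Gamma) (fG : finite_covolume Gamma G).

Let AD s t : val (A (s + t)) = val (A s) *m val (A t). Proof. exact: (flowD fA). Qed.
Let A0 : val (A 0) = 1%:M. Proof. exact: (flow0 fA). Qed.
Let recurrence := lattice_recurrence fA c0 dMs GE gG GG fG.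
Let thetaK := theta_retractK fA c0 dMs sigma.

Lemma smooth_near_hmul_comp (W : normedModType R) (x : W) (f g : W -> H) :
  smooth_near x f -> smooth_near x g -> smooth_near x (fun y => hmul (f y) (g y)).
Proof.
move=> sf sg; apply: smooth_near_pair.
  apply: smooth_nearD; first exact: smooth_near_fst sf.
  apply: smooth_near_mulmx; last exact: smooth_near_fst sg.
  by apply: (smooth_near_A fA); exact: smooth_near_snd sf.
by apply: smooth_nearD; [exact: smooth_near_snd sf|exact: smooth_near_snd sg].
Qed.

Lemma smooth_near_hact_comp (W : normedModType R) (x : W) (f : W -> H) (g : W -> V) :
  smooth_near x f -> smooth_near x g -> smooth_near x (fun y => hact (f y) (g y)).
Proof.
move=> sf sg; have sA : smooth_near x (fun y => val (A (f y).2)).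
  by apply: (smooth_near_A fA); exact: smooth_near_snd sf.
apply: smooth_near_pair.
  apply: smooth_nearD; first exact: smooth_near_fst sf.
  by apply: smooth_near_mulmx => //; exact: smooth_near_fst sg.
by apply: smooth_near_mulmx => //; exact: smooth_near_snd sg.
Qed.

Lemma smooth_near_col_mx (W : normedModType R) m1 m2 n (x : W)
    (f : W -> 'M[R]_(m1, n)) (g : W -> 'M[R]_(m2, n)) :
  smooth_near x f -> smooth_near x g -> smooth_near x (fun y => col_mx (f y) (g y)).
Proof.
move=> sf sg; apply: smooth_near_mx => i j; case: (split_ordP i) => k ->.
  by under eq_fun do rewrite col_mxEu; exact: smooth_near_entry.
by under eq_fun do rewrite col_mxEd; exact: smooth_near_entry.
Qed.

(** Recurrence puts elements [v (e k) u^-1] into the lattice with [k] large. They return [K] to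
    itself, so they belong to a finite set [S], and [e k] lies in the compact set [Uc^-1 S Uc],
    against the growth of [e]. *)
Lemma lattice_not_proper (Om' K : set (projective R (N + 1))) (U Uc : set H)
    (e : nat -> H) k0 :
  properly_discontinuous Gamma Om' -> K `<=` Om' -> compact K ->
  open U -> U !=set0 -> U `<=` Uc -> compact Uc ->
  (forall m k, e (m + k)%N = hmul (e m) (e k)) -> (forall k, k%:R <= `|e k|) ->
  (forall k u v, (k0 <= k)%N -> U u -> U v -> exists2 x, K x &
     K (proj_act (theta (hquot (hmul v (e k), u))) x)) ->
  False.
Proof.
move=> pd KOm cK oU neU UUc cUc eD e_norm meet.
pose S : set H := [set w | Gamma (theta w) /\ [set proj_act (theta w) z | z in K] `&` K !=set0].
have fS : finite_set S.
  apply: (@sub_finite_set _ _ (theta_retract A sigma @`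
      [set g | Gamma g /\ [set proj_act g z | z in K] `&` K !=set0])).
    by move=> w Sw; exists (theta w) => //; exact: thetaK.
  by apply: finite_image; exact: pd.
pose f (x : H * (H * H)) : H := hmul (hinv x.2.2) (hmul x.1 x.2.1).
have cf : compact (f @` (S `*` (Uc `*` Uc))).
  apply: continuous_compact; last first.
    by apply: compact_setX; [exact: finite_compact|exact: compact_setX].
  apply: continuous_subspaceT => x; apply: smooth_near_continuous.
  have s2 : smooth_near x (fun x : H * (H * H) => x.2) by exact/smooth_near_snd/smooth_near_id.
  apply: smooth_near_hmul_comp.
    apply: (smooth_near_comp (g := hinv)); first exact: (smooth_near_hinv fA).
    exact: smooth_near_snd s2.
  apply: smooth_near_hmul_comp; first exact/smooth_near_fst/smooth_near_id.
  exact: smooth_near_fst s2.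
have [M [_ MP]] := compact_bounded cf.
pose M1 := `|M| + 1.
have M_lt : M < M1 by rewrite /M1 ltr_pwDr // ler_norm.
(* Recurrence is run along the multiples of [L], so that [k], a positive multiple of [L], is at
   least [k0] and exceeds the bound [M1] of the compact set. *)
pose L := maxn k0 (Num.truncn M1).+1.
have [m [n [u [v [mn Uu Uv]]]]] := recurrence (fun m => e (m * L)%N) oU neU.
pose k := ((n - m) * L)%N.
have -> : e (n * L)%N = hmul (e k) (e (m * L)%N).
  by rewrite -eD -mulnDl subnK // ltnW.
rewrite (hmulA AD) (hquot_mulr fA) => Gw.
have Lk : (L <= k)%N by rewrite /k leq_pmull // subn_gt0.
have [x Kx Kgx] := meet k u v (leq_trans (leq_maxl _ _) Lk) Uu Uv.
have := MP _ M_lt (e k) _; apply: contraPP => _ H1.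
have : `|e k| <= M1.
  apply: H1; exists (hquot (hmul v (e k), u), (u, v)).
    split; last by split; exact: UUc.
    by split=> //; exists (proj_act (theta (hquot (hmul v (e k), u))) x); split=> //; exists x.
  by rewrite /f /= (hquotK fA) (hmulA AD) (hmulV A) (hmul1 A0).
apply/negP; rewrite -ltNge; apply: lt_le_trans (e_norm k).
apply: (@lt_le_trans _ _ ((Num.truncn M1).+1%:R)); first exact: truncnS_gt.
by rewrite ler_nat (leq_trans (leq_maxr _ _) Lk).
Qed.

Section Domain.
Context (Om : set (projective R (N + 1))).
Context (OmE : forall x, Om x <-> exists2 z, stable_nonzero z & x = chart_point z).
Context (Om' : set (projective R (N + 1))) (dOm' : discontinuity_domain Gamma Om').

(** The compact set is the image of a compact neighbourhood of the identity under the orbit map of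
    the point. As translations fix the point, [u'] times a translation times [u^-1] takes the image
    of [u] to that of [u']. *)
Lemma infinity_not_in v (nv : v != 0) : ~ Om' (infinity_point sigma nv).
Proof.
have [oOm' _ pd] := dOm' => Ov.
pose Psi (u : H) := proj_act (theta u) (infinity_point sigma nv).
(* Since [proj_act] uses chosen representatives, continuity is obtained from the explicit
   representatives [s w]. *)
have cPsi u : {for u, continuous Psi}.
  have nw (w : H) : cmx (val (A w.2)) *m v != 0.
    by have [nv' _] := theta_act_infinity AD A0 sigma w.1 w.2 nv.
  pose s w : sub_space (@nonzero R (N + 1)) := SigSub (mem_set (infinity_subproof sigma (nw w))).
  have ss : csmooth_mx u (fun w => val (s w)).
    apply: csmooth_mulmx; first exact: csmooth_mx_cst.
    apply: csmooth_col_mx; last exact: csmooth_mx_cst.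
    apply: csmooth_mulmx; last exact: csmooth_mx_cst.
    apply: csmooth_cmx; apply: (smooth_near_A fA).
    exact/smooth_near_snd/smooth_near_id.
  have [cs _] := @scaling_class_smooth R _ _ (@nonzero R (N + 1)) H s u ss.
  suff -> : Psi = (fun w => fclass _ (s w)) by exact: cs.
  apply/funext => -[b t].
  have [nv' E] := theta_act_infinity AD A0 sigma b t nv.
  by rewrite /Psi E (bool_irrelevance nv' (nw (b, t))).
have Psi0 : Psi (0, 0) = infinity_point sigma nv.
  by rewrite /Psi (theta1 A0 sigma) proj_act1.
have nO : nbhs ((0, 0) : H) (Psi @^-1` Om').
  by apply: cPsi; rewrite Psi0; exact: open_nbhs_nbhs.
pose fH : findim H := prod_findim (matrix_findim _ _) real_findim.
have [Uc nUc [cUc UcO]] := findim_compact_nbhs fH nO.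
(* The norm is the largest entry, so [k%:R *: b] has norm at least [k]. *)
pose b : 'cV[R]_N := const_mx 1.
pose e k : H := (k%:R *: b, 0).
apply: (@lattice_not_proper Om' (Psi @` Uc) (Uc^°) Uc e 0 pd).
- by move=> _ [u Uu <-]; exact: UcO.
- by apply: continuous_compact => //; apply: continuous_subspaceT.
- exact: open_interior.
- by exists (0, 0).
- exact: interior_subset.
- by [].
- by move=> m k; rewrite /e /hmul /= A0 mul1mx addr0 natrD scalerDl.
- move=> k; rewrite prod_normE le_max; apply/orP; left.
  rewrite normrZ normr_nat ler_peMr // leNgt; apply/negP => b1.
  have : ball (0 : 'cV[R]_N) 1 b by rewrite -ball_normE /= sub0r normrN.
  by move=> [_ /(_ 0 0)]; rewrite -ball_normE /= !mxE sub0r normrN normr1 ltxx.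
- move=> k u u' _ /interior_subset Uu /interior_subset Uu'.
  exists (Psi u); first by exists u.
  rewrite /Psi -proj_act_mul (theta_mul AD) (hquotK fA) -(theta_mul AD) proj_act_mul.
  exists u' => //; rewrite /Psi; congr (proj_act _ _).
  have [nv' ->] := theta_act_infinity AD A0 sigma (k%:R *: b) 0 nv.
  apply/proj_ofP; exists 1; rewrite ?oner_neq0 // scale1r.
  by rewrite A0 /cmx map_mx1 mul1mx.
Qed.

(** The compact set has two pieces: one around the given point, inside [Om'] by openness, and one in
    [Om], which the assumed inclusion places in [Om']. The returning elements lead from the first
    piece to the second. *)
Lemma chart_not_in a y : Om `<=` Om' -> ~ Om' (chart_point (a, col_mx 0 y)).
Proof.
have [oOm' _ pd] := dOm' => OmOm' Oa.
pose As t := ulsubmx (val (A t)); pose Au t := drsubmx (val (A t)).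
have fAs : linear_flow As Ms := flow_ul fA.
have fAu : linear_flow Au Mu := flow_dr fA.
pose xi : 'cV[R]_p.+1 := unit_col p.
pose Phi (w : H * 'cV[R]_p.+1) := chart_point (hact w.1 (0, col_mx w.2 y)).
pose Psi (w : H * 'cV[R]_q) := chart_point (hact w.1 (0, col_mx xi w.2)).
have c_chart (W : normedModType R) (f : W -> V) w : smooth_near w f ->
    {for w, continuous (fun w => chart_point (f w))}.
  move=> sf; apply: (continuous_for_comp (f := f)); first exact: smooth_near_continuous.
  by have [] := point_smooth sigma (f w).
have cPhi w : {for w, continuous Phi}.
  apply: c_chart; apply: smooth_near_hact_comp; first exact/smooth_near_fst/smooth_near_id.
  apply: smooth_near_pair; first exact: smooth_near_cst.
  by apply: smooth_near_col_mx; [exact/smooth_near_snd/smooth_near_id|exact: smooth_near_cst].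
have cPsi w : {for w, continuous Psi}.
  apply: c_chart; apply: smooth_near_hact_comp; first exact/smooth_near_fst/smooth_near_id.
  apply: smooth_near_pair; first exact: smooth_near_cst.
  by apply: smooth_near_col_mx; [exact: smooth_near_cst|exact/smooth_near_snd/smooth_near_id].
have nPhi : nbhs (((a, 0), 0) : H * 'cV[R]_p.+1) (Phi @^-1` Om').
  apply: cPhi; have -> : Phi ((a, 0), 0) = chart_point (a, col_mx 0 y).
    by rewrite /Phi /hact /= A0 !mul1mx addr0.
  exact: open_nbhs_nbhs.
pose fH : findim H := prod_findim (matrix_findim _ _) real_findim.
have [K0 nK0 [cK0 K0O]] := findim_compact_nbhs (prod_findim fH (matrix_findim _ _)) nPhi.
have [[Bu Bx] /= [nBu nBx] BK] := nK0.
have [Uc nUc [cUc UcB]] := findim_compact_nbhs fH nBu.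
have [t0 t0P] := flow_vanish xi fAs c0 dMs nBx.
pose D := rdotmx y y; have D0 : 0 <= D := rdotmx_ge0 y.
(* Backward time contracts the unstable block, so the squared Euclidean norm of [Au (- k%:R) *m y]
   is at most [D], below [(D + 1) ^+ 2]; all these vectors lie in [Ky]. *)
have [Ky cKy KyB] := findim_compact_ball (matrix_findim q 1) (D + 1).
pose e k : H := (0, - k%:R).
apply: (@lattice_not_proper Om' (Phi @` K0 `|` Psi @` (Uc `*` Ky)) (Uc^°) Uc e
  (Num.truncn t0).+1 pd).
- move=> x [[w Kw <-]|[[u z] [Uu Kz] <-]]; first exact: K0O.
  apply: OmOm'; apply/OmE; exists (hact u (0, col_mx xi z)) => //.
  apply: (stable_nonzero_act fA); rewrite /stable_nonzero /= col_mxKu.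
  by rewrite -rdotmx_eq0 rdotmx_unit_col oner_eq0.
- apply: compactU; apply: continuous_compact => //.
  + by apply: continuous_subspaceT.
  + by apply: continuous_subspaceT.
  + exact: compact_setX.
- exact: open_interior.
- by exists (a, 0).
- exact: interior_subset.
- by [].
- by move=> m k; rewrite /e /hmul /= mulmx0 addr0 natrD opprD.
- by move=> k; rewrite prod_normE le_max /= normrN normr_nat lexx orbT.
- move=> k u v k0 /interior_subset Uu /interior_subset Uv.
  have tk : t0 <= k%:R.
    by rewrite ltW // (lt_le_trans (truncnS_gt _)) // ler_nat.
  (* For large [k] the vector [As k%:R *m xi] is near 0, so this point lies in the first piece. The
     group element undoes [u], flows backward by [k], which restores [xi], and applies [v]. *)
  exists (Phi (u, As k%:R *m xi)).
    left; exists (u, As k%:R *m xi) => //; apply: (BK (_, _)).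
    by split; [exact: UcB|exact: t0P].
  right; exists (v, Au (- k%:R) *m y).
    split=> //; apply: KyB; apply: ball_rdotmx; first by rewrite ltr_wpDl.
    have dN z : rdotmx z (- Mu *m z) <= - c * rdotmx z z.
      have -> : rdotmx z (- Mu *m z) = - rdotmx z (Mu *m z).
        by rewrite mulNmx /rdotmx -sumrN; apply: eq_bigr => i _; rewrite mxE mulrN.
      by rewrite mulNr lerN2.
    have := energy_decay (flow_opp fAu) dN y (ler0n R k).
    rewrite oppr0 (flow0 fAu) mul1mx addr0 -/D => /le_lt_trans; apply.
    have e1 : expR (- (2 * c * k%:R)) <= 1.
      by rewrite -expR0 ler_expR oppr_le0 !mulr_ge0 // ltW.
    have := ler_piMl D0 e1; have := sqr_ge0 D; rewrite !expr2; nra.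
  rewrite /Phi theta_act /=; congr chart_point.
  rewrite -(hactM AD) (hquotK fA) (hactM AD); congr (hact v _).
  rewrite /hact /= mulmx0 addr0 (flow_block fA) mul_block_col !mul0mx addr0 add0r.
  by rewrite mulmxA (flowNK fAs) mul1mx.
Qed.

Lemma Omega_maximal_in : Om `<=` Om' -> Om' = Om.
Proof.
move=> OO'; apply/seteqP; split=> // x Ox.
have [[[a z] E]|[v [nv E]]] := projective_cases sigma x; last first.
  by case: (infinity_not_in (nv := nv)); rewrite -E.
apply/OmE; exists (a, z) => //; rewrite /stable_nonzero /=; apply/eqP => z0.
by case: (@chart_not_in a (dsubmx z)) => //; rewrite -z0 vsubmxK -E.
Qed.

End Domain.

Lemma Omega_maximal (Om : set (projective R (N + 1))) :
  (forall x, Om x <-> exists2 z, stable_nonzero z & x = chart_point z) ->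
  maximal_discontinuity_domain Gamma Om.
Proof.
move=> OmE; split; first exact: (Omega_discontinuity_domain fA c0 dMs GE gG GG dG OmE).
by move=> Om' dOm' OO'; exact: Omega_maximal_in dOm' OO'.
Qed.
End Maximality.

(** * The trivialization of the domain *)

Section SmoothAlong.
Context {R : realType}.
Implicit Types M N : smooth_space R.

Definition smooth_along (V : normedModType R) M (z : V) (P : V -> M) :=
  {for z, continuous P} /\ forall f, smooth_germ (P z) f -> smooth_near z (f \o P).

Lemma smooth_along_euclidean (V : normedModType R) n (z : V) (h : V -> euclidean R n) :
  smooth_near z h -> smooth_along z h.
Proof.
move=> sh; split=> [|f sf]; first exact: smooth_near_continuous sh.
exact: (smooth_near_comp sf sh).
Qed.

Lemma smooth_along_sub (V : normedModType R) M (S : set M) (z : V) (P : V -> sub_space S) :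
  smooth_along z (fun v => val (P v)) -> smooth_along z P.
Proof.
move=> [cP sP]; have cP' : {for z, continuous P} by exact: continuous_set_type.
split=> // f [F gF Ff].
have n : nbhs z (P @^-1` [set y | F (val y) = f y]) by exact: cP'.
exact: (smooth_near_eq (n : \forall v \near z, F (val (P v)) = f (P v)) (sP _ gF)).
Qed.

Lemma smooth_along_pair (V : normedModType R) M N (z : V) (P : V -> M) (Q : V -> N) :
  smooth_along z P -> smooth_along z Q ->
  smooth_along z (fun v => (P v, Q v) : prod_space M N).
Proof.
move=> [cP sP] [cQ sQ].
have cPQ : {for z, continuous (fun v => (P v, Q v) : prod_space M N)}.
  exact: continuous_pair.
split=> // f [k [l [u [v [F [su sv sF fF]]]]]].
have n : nbhs z ((fun v => (P v, Q v) : prod_space M N) @^-1`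
  [set q | f q = F (u q.1, v q.2)]) by exact: cPQ.
apply: (@smooth_near_eq _ _ _ _ (fun w => F (u (P w), v (Q w)))).
  by apply: filterS n => w /= ->.
apply: (smooth_near_comp (g := F)) => //; apply: smooth_near_pair.
  by apply: smooth_near_mx => i j; rewrite (ord1 i); exact: sP (su j).
by apply: smooth_near_mx => i j; rewrite (ord1 i); exact: sQ (sv j).
Qed.

Lemma smooth_along_etale (V V' : normedModType R) {f' : findim V'} M (W : set V') (P : V' -> M)
    (z : V) (h : V -> V') :
  etale W P -> W (h z) -> smooth_near z h -> smooth_along z (P \o h).
Proof.
move=> [oW eP] Wh sh; have [cP _ sP] := eP _ Wh; split.
  by apply: continuous_for_comp => //; exact: smooth_near_continuous.
by move=> f /sP sf; exact: (smooth_near_comp sf sh).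
Qed.

(** An etale map is open and detects smooth germs, so smoothness of [F] is tested on its lift
    [E]. *)
Lemma etale_smooth_map (V : normedModType R) M N (W : set V) (P : V -> M)
    (F : M -> N) (E : V -> N) :
  etale W P -> (forall m, exists2 w, W w & P w = m) ->
  (forall w, W w -> F (P w) = E w) -> (forall w, W w -> smooth_along w E) ->
  smooth_map F.
Proof.
move=> eP sP FE sE; have [oW eP'] := eP.
have nW w : W w -> \forall y \near w, E y = F (P y).
  by move=> Ww; apply: filterS (open_nbhs_nbhs (conj oW Ww)) => y /FE.
split=> [m|m g]; have [w Ww <-] := sP m.
  move=> A nA; apply/(etale_nbhs _ eP Ww); have [cE _] := sE _ Ww.
  have nE : nbhs w (E @^-1` A) by apply: cE; rewrite -FE.
  by apply: filterS2 (nW _ Ww) nE => y /= ->.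
have [_ _ gP] := eP' _ Ww; rewrite (FE _ Ww) => sg; apply/gP.
have [_ /(_ _ sg)] := sE _ Ww; apply: smooth_near_eq.
by apply: filterS (nW _ Ww) => y /= ->.
Qed.

Definition smooth_coord (V : normedModType R) M (x : M) (r : M -> V) :=
  forall h : V -> R, smooth_near (r x) h -> smooth_germ x (h \o r).

Lemma prod_germ (V1 V2 : normedModType R) {f1 : findim V1} {f2 : findim V2} M N
    (x : prod_space M N) (r1 : M -> V1) (r2 : N -> V2) (f : V1 * V2 -> R)
    (g : prod_space M N -> R) :
  smooth_coord x.1 r1 -> smooth_coord x.2 r2 -> smooth_near (r1 x.1, r2 x.2) f ->
  (\forall q \near x, f (r1 q.1, r2 q.2) = g q) -> smooth_germ x g.
Proof.
move=> s1 s2 sf fg.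
exists _, _, (fun y => @to_row R V1 f1 (r1 y)), (fun y => @to_row R V2 f2 (r2 y)).
exists (fun w => f (@of_row R V1 f1 w.1, @of_row R V2 f2 w.2)); split.
- move=> i; apply: (s1 (fun v => @to_row R V1 f1 v 0 i)).
  exact/smooth_near_entry/smooth_near_to_row.
- move=> i; apply: (s2 (fun v => @to_row R V2 f2 v 0 i)).
  exact/smooth_near_entry/smooth_near_to_row.
- apply: (smooth_near_comp (g := f)); first by rewrite /= !to_rowK.
  apply: smooth_near_pair.
    apply: (smooth_near_comp (g := @of_row R V1 f1)); first exact: smooth_near_of_row.
    exact/smooth_near_fst/smooth_near_id.
  apply: (smooth_near_comp (g := @of_row R V2 f2)); first exact: smooth_near_of_row.
  exact/smooth_near_snd/smooth_near_id.
- by apply: filterS fg => q <-; rewrite !to_rowK.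
Qed.

Lemma etale_local_inverse (V : normedModType R) M (W : set V) (P : V -> M) w B :
  etale W P -> W w -> nbhs w B -> {in B &, injective P} ->
  exists s : M -> V, (forall u, B u -> s (P u) = u) /\ smooth_coord (P w) s.
Proof.
move=> eP Ww nB iP; pose s m := xget (0 : V) [set u | B u /\ P u = m].
have sP u : B u -> s (P u) = u.
  move=> Bu; rewrite /s; case: xgetP => [v _ [Bv E]|/(_ u)]; last by case.
  by apply: iP; rewrite ?inE.
exists s; split=> // h; rewrite (sP w (nbhs_singleton nB)) => sh.
have [_ /(_ w Ww)[_ _ gP]] := eP; apply/gP.
by apply: smooth_near_eq sh; apply: filterS nB => u Bu; rewrite /= sP.
Qed.

(** [M] is parametrized by [P], which is inverted locally, whereas [N] enters through global smooth
    coordinates [r] in a vector space. For the sphere these are its embedding, so its charts do not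
    appear; [K] is the formula for [D] in these coordinates. *)
Lemma prod_etale_smooth_map (V1 V2 V : normedModType R) {f1 : findim V1}
    {f2 : findim V2} {f : findim V} (M N L : smooth_space R) (P : V1 -> M)
    (r : N -> V2) (W : set V) (Q : V -> L) (K : V1 * V2 -> V) (D : prod_space M N -> L) :
  etale setT P -> (forall m, exists w, m = P w) ->
  (forall w : V1, exists2 B : set V1, nbhs w B & {in B &, injective P}) ->
  continuous r -> (forall x, smooth_coord x r) ->
  etale W Q -> (forall w x, W (K (w, r x))) -> (forall v, smooth_near v K) ->
  (forall w x, D (P w, x) = Q (K (w, r x))) -> smooth_map D.
Proof.
move=> eP sP iP cr sr eQ WK sK DE; have [_ eP'] := eP; have [_ eQ'] := eQ.
split=> [[m x]|[m x] g]; have [w ->] := sP m; have [cQ _ gQ] := eQ' _ (WK w x).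
  move=> B nB; rewrite DE in nB.
  have nK : nbhs ((w, r x) : V1 * V2) (K @^-1` (Q @^-1` B)).
    by apply: (smooth_near_continuous (sK _)); exact: cQ.
  have [[B1 B2] /= [n1 n2] BB] := nK.
  exists (P @` B1, r @^-1` B2).
    by split; [have [_ o _] := eP' w I; exact: o|exact: cr].
  by move=> [m' y] [/= [u Bu <-] By] /=; rewrite DE; exact: (BB (u, r y)).
rewrite DE => /gQ sg; have [B nB iB] := iP w.
have [s [sP' ss]] := etale_local_inverse eP I nB iB.
apply: (@prod_germ V1 V2 f1 f2 _ _ _ s r (g \o Q \o K)).
- exact: ss.
- exact: sr.
- rewrite [s _]sP'; last exact: nbhs_singleton nB.
  exact: (smooth_near_comp (f := K) (g := g \o Q)).
- exists (P @` B, setT).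
    by split; [have [_ o _] := eP' w I; exact: o|exact: filterT].
  by move=> [m' y] [/= [u Bu <-] _] /=; rewrite sP' // DE.
Qed.
End SmoothAlong.

Section Diffeomorphism.
Context {R : realType} (p q : nat) (A : R -> GL R (p.+1 + q))
  (Ms : 'M[R]_p.+1) (Mu : 'M[R]_q)
  (fA : linear_flow (fun t => val (A t)) (block_mx Ms 0 0 Mu)) (c : R) (c0 : 0 < c)
  (dMs : forall x, rdotmx x (Ms *m x) <= - c * rdotmx x x)
  (sigma : GL R[i] (p.+1 + q + 1)).
Local Notation N := (p.+1 + q)%N.
Local Notation H := ('cV[R]_N * R)%type.
Local Notation V := ('cV[R]_N * 'cV[R]_N)%type.
Local Notation theta := (theta A sigma).
Local Notation chart_point := (chart_point sigma).
Local Notation hmul := (hmul A).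
Local Notation hact := (hact A).
Context (G : set (PGL R (N + 1))) (GE : forall g, G g <-> exists w, g = theta w).
Context (Gamma : set (PGL R (N + 1))) (gG : pgl_subgroup Gamma)
  (GG : Gamma `<=` G) (dG : discrete_subset Gamma).
Context (Om : set (projective R (N + 1))).
Context (OmE : forall x, Om x <-> exists2 z, stable_nonzero z & x = chart_point z).

Let AD s t : val (A (s + t)) = val (A s) *m val (A t). Proof. exact: (flowD fA). Qed.
Let A0 : val (A 0) = 1%:M. Proof. exact: (flow0 fA). Qed.
Let cP := coset_paramP fA c0 dMs GE gG GG.
Let eC := etale_coset fA c0 dMs GE gG GG.
Let oP := orbit_paramP OmE GE gG GG.
Let eO := etale_orbit_param fA OmE GE gG GG.
Local Notation cp := (coset_param GE Gamma).
Local Notation op := (orbit_param OmE Gamma).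
Local Notation X := (prod_space (sphere R p) (euclidean R q)).
Let As t := ulsubmx (val (A t)).
Let Au t := drsubmx (val (A t)).
Let fAs : linear_flow As Ms := flow_ul fA.
Let fAu : linear_flow Au Mu := flow_dr fA.
Let tau (z : V) := hit As (usubmx z.2).

Fact stable_direction_subproof (x : 'cV[R]_p.+1) : rdotmx x x = 1 ->
  [set x : euclidean R p.+1 | \sum_i x 0 i ^+ 2 = 1] x^T.
Proof. by move=> /= <-; apply: eq_bigr => i _; rewrite mxE expr2. Qed.

(** The value off the unit sphere is arbitrary; it allows [domain_coord] to be a total function. *)
Definition sphere_point (x : 'cV[R]_p.+1) : sphere R p :=
  match pselect (rdotmx x x = 1) with
  | left x1 => SigSub (mem_set (stable_direction_subproof x1))
  | right _ => SigSub (mem_set (stable_direction_subproof (rdotmx_unit_col p)))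
  end.

Lemma val_sphere_point x : rdotmx x x = 1 -> val (sphere_point x) = x^T.
Proof. by rewrite /sphere_point; case: pselect. Qed.

Lemma rdotmx_sphere (s : sphere R p) : rdotmx (val s)^T (val s)^T = 1.
Proof.
have /= s1 := set_mem (valP s); apply: etrans s1.
by apply: eq_bigr => i _; rewrite !mxE expr2.
Qed.

Lemma sphere_pointK (s : sphere R p) : sphere_point (val s)^T = s.
Proof. by apply: val_inj; rewrite val_sphere_point ?trmxK // rdotmx_sphere. Qed.

Definition domain_coord (z : V) : prod_space (coset_space Gamma G) X :=
  (cp (group_coord A z),
   (sphere_point (As (- tau z) *m usubmx z.2), (Au (- tau z) *m dsubmx z.2)^T)).

Definition domain_uncoord (w : H) (x : 'rV[R]_p.+1 * 'rV[R]_q) : V :=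
  (w.1, val (A w.2) *m col_mx x.1^T x.2^T).

Lemma hact_blocks w (z : V) : (hact w z).2 =
  col_mx (As w.2 *m usubmx z.2) (Au w.2 *m dsubmx z.2).
Proof.
rewrite /hact /= -{1}[z.2]vsubmxK (flow_block fA) mul_block_col !mul0mx.
by rewrite addr0 add0r.
Qed.

Lemma tau_hact w z : stable_nonzero z -> tau (hact w z) = tau z + w.2.
Proof.
move=> z0; rewrite /tau hact_blocks col_mxKu; exact: (hit_flow fAs c0 dMs).
Qed.

(** The hitting time increases by the time of the lattice element, which cancels in the sphere and
    Euclidean components; the group coordinate moves within its coset. *)
Lemma domain_coord_act (i : lattice_index A sigma Gamma) z : stable_nonzero z ->
  domain_coord (hact (sval i) z) = domain_coord z.
Proof.
move=> z0; rewrite /domain_coord (group_coord_act fA c0 dMs) // tau_hact //.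
rewrite hact_blocks col_mxKu col_mxKd !mulmxA -(flowD fAs) -(flowD fAu).
rewrite opprD addrNK; congr (_, _); apply/esym/cP; exists i; exact: erefl.
Qed.

Definition domain_trivialize (m : orbit_space Gamma Om) :
    prod_space (coset_space Gamma G) X :=
  domain_coord (projT1 (cid2 (orbit_param_surj OmE m))).

Lemma domain_trivialize_param z : stable_nonzero z ->
  domain_trivialize (op z) = domain_coord z.
Proof.
move=> z0; rewrite /domain_trivialize; case: cid2 => z' z'0 E.
have [i iE] := proj1 (oP z0 z'0) (esym E).
by rewrite [projT1 _]iE; exact: domain_coord_act.
Qed.

Lemma domain_uncoord_act w u x :
  domain_uncoord (hmul w u) x = hact w (domain_uncoord u x).
Proof. by rewrite /domain_uncoord /hact /hmul /= AD mulmxA. Qed.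

Definition X_coord (x : X) : 'rV[R]_p.+1 * 'rV[R]_q := (val x.1, x.2).

Lemma stable_nonzero_uncoord w (x : X) : stable_nonzero (domain_uncoord w (X_coord x)).
Proof.
apply: (@stable_nonzero_act _ _ _ _ _ _ fA (0, w.2) (0, col_mx (val x.1)^T x.2^T)).
by rewrite /stable_nonzero /= col_mxKu -rdotmx_eq0 rdotmx_sphere oner_eq0.
Qed.

Definition domain_assemble (m : prod_space (coset_space Gamma G) X) :
    orbit_space Gamma Om :=
  op (domain_uncoord (projT1 (cid (coset_param_surj GE m.1))) (X_coord m.2)).

Lemma domain_assemble_param w x :
  domain_assemble (cp w, x) = op (domain_uncoord w (X_coord x)).
Proof.
rewrite /domain_assemble [(cp w, x).1]/= [(cp w, x).2]/=.
have /cP[i ->] := projT2 (cid (coset_param_surj GE (cp w))).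
have z0 := stable_nonzero_uncoord w x.
rewrite domain_uncoord_act; apply: esym.
by apply: (proj2 (oP z0 (stable_nonzero_act fA (sval i) z0))); exists i.
Qed.

Lemma rdotmx_hit z : stable_nonzero z ->
  rdotmx (As (- tau z) *m usubmx z.2) (As (- tau z) *m usubmx z.2) = 1.
Proof. by move=> z0; exact: (energy_hit fAs c0 dMs z0). Qed.

Lemma domain_trivializeK : cancel domain_trivialize domain_assemble.
Proof.
move=> m; have [z z0 <-] := orbit_param_surj OmE m.
rewrite domain_trivialize_param // /domain_coord domain_assemble_param.
congr (op _); rewrite /domain_uncoord /X_coord /= val_sphere_point ?rdotmx_hit //.
rewrite !trmxK [RHS]surjective_pairing; congr pair.
rewrite -/(tau z) (flow_block fA) mul_block_col !mul0mx addr0 add0r !mulmxA.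
by rewrite (flowK fAs) (flowK fAu) !mul1mx vsubmxK.
Qed.

Lemma domain_assembleK : cancel domain_assemble domain_trivialize.
Proof.
move=> [m x]; have [w ->] := coset_param_surj GE m.
have z0 := stable_nonzero_uncoord w x.
rewrite domain_assemble_param domain_trivialize_param //.
have E : (domain_uncoord w (X_coord x)).2 =
    col_mx (As w.2 *m (val x.1)^T) (Au w.2 *m x.2^T).
  by rewrite /= (flow_block fA) mul_block_col !mul0mx addr0 add0r.
have T : tau (domain_uncoord w (X_coord x)) = w.2.
  rewrite /tau E col_mxKu (hit_flow fAs c0 dMs).
    by rewrite (hit_eq0 fAs c0 dMs) ?add0r // rdotmx_sphere.
  by rewrite -rdotmx_eq0 rdotmx_sphere oner_eq0.
rewrite /domain_coord /group_coord -/(tau _) T E col_mxKu col_mxKd !mulmxA.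
rewrite (flowNK fAs) (flowNK fAu) !mul1mx sphere_pointK trmxK -!surjective_pairing.
by [].
Qed.

Lemma smooth_near_trmx (W : normedModType R) m n (w : W) (f : W -> 'M[R]_(m, n)) :
  smooth_near w f -> smooth_near w (fun v => (f v)^T).
Proof.
move=> sf; apply: smooth_near_mx => i j; under eq_fun do rewrite mxE.
exact: smooth_near_entry.
Qed.

Lemma domain_trivialize_smooth : smooth_map domain_trivialize.
Proof.
apply: (@etale_smooth_map R V (orbit_space Gamma Om) (prod_space (coset_space Gamma G) X)
  (@stable_nonzero R p q) op domain_trivialize domain_coord eO).
- exact: orbit_param_surj.
- exact: domain_trivialize_param.
move=> z z0.
have sz : smooth_near z (fun z : V => z.2) by exact/smooth_near_snd/smooth_near_id.
have su : smooth_near z (fun z : V => usubmx z.2).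
  apply: smooth_near_mx => i j; under eq_fun do rewrite mxE.
  exact: smooth_near_entry.
have sd : smooth_near z (fun z : V => dsubmx z.2).
  apply: smooth_near_mx => i j; under eq_fun do rewrite mxE.
  exact: smooth_near_entry.
have st : smooth_near z (fun z => - tau z).
  apply: smooth_nearN; apply: (smooth_near_comp (g := hit As) _ su).
  exact: (smooth_near_hit fAs c0 dMs).
apply: smooth_along_pair.
  apply: (smooth_along_etale (f' := prod_findim (matrix_findim _ _) real_findim) eC) => //.
  exact: (smooth_near_group_coord fA c0 dMs).
apply: smooth_along_pair.
  apply: smooth_along_sub; apply: smooth_along_euclidean.
  apply: (smooth_near_eq (f := fun z => (As (- tau z) *m usubmx z.2)^T)).
    apply: filterS (open_nbhs_nbhs (conj (@open_stable_nonzero R p q) z0)) => y y0.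
    by rewrite val_sphere_point // rdotmx_hit.
  apply: smooth_near_trmx; apply: smooth_near_mulmx => //.
  by apply: (smooth_near_comp (g := As)) st; exact: (flow_smooth fAs).
apply: smooth_along_euclidean; apply: smooth_near_trmx; apply: smooth_near_mulmx => //.
by apply: (smooth_near_comp (g := Au)) st; exact: (flow_smooth fAu).
Qed.

Lemma smooth_near_uncoord (w : H) (x : 'rV[R]_p.+1 * 'rV[R]_q) :
  smooth_near ((w, x) : H * ('rV[R]_p.+1 * 'rV[R]_q))
    (fun v => domain_uncoord v.1 v.2).
Proof.
have s1 : smooth_near ((w, x) : H * ('rV[R]_p.+1 * 'rV[R]_q)) (fun v => v.1).
  exact/smooth_near_fst/smooth_near_id.
have s2 : smooth_near ((w, x) : H * ('rV[R]_p.+1 * 'rV[R]_q)) (fun v => v.2).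
  exact/smooth_near_snd/smooth_near_id.
apply: smooth_near_pair; first exact: smooth_near_fst s1.
apply: smooth_near_mulmx.
  by apply: (smooth_near_A fA); exact: smooth_near_snd s1.
apply: smooth_near_col_mx; apply: smooth_near_trmx.
  exact: smooth_near_fst s2.
exact: smooth_near_snd s2.
Qed.

Lemma X_coord_continuous : continuous X_coord.
Proof.
move=> x.
have c1 : {for x, continuous (fun x : X => val x.1 : 'rV[R]_p.+1)}.
  exact: (continuous_for_comp (@continuous_for_fst _ _ x) (@continuous_set_val _ _ _)).
have c2 : {for x, continuous (fun x : X => x.2 : 'rV[R]_q)}.
  exact: (@continuous_for_snd _ _ x).
exact: (continuous_pair c1 c2).
Qed.

Lemma X_coord_smooth x : smooth_coord x X_coord.
Proof.
move=> h sh; apply: (@prod_germ R _ _ (matrix_findim _ _) (matrix_findim _ _)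
  (sphere R p) (euclidean R q) x val id h) => //.
- by move=> g sg; exists g => //; apply: filterE => y.
- by apply: filterE => y.
Qed.

Lemma domain_assemble_smooth : smooth_map domain_assemble.
Proof.
apply: (@prod_etale_smooth_map R H ('rV[R]_p.+1 * 'rV[R]_q)%type V
  (prod_findim (matrix_findim _ _) real_findim)
  (prod_findim (matrix_findim _ _) (matrix_findim _ _))
  (prod_findim (matrix_findim _ _) (matrix_findim _ _))
  (coset_space Gamma G) X (orbit_space Gamma Om) cp X_coord (@stable_nonzero R p q)
  op (fun v => domain_uncoord v.1 v.2) domain_assemble eC).
- exact: coset_param_surj.
- exact: (coset_locally_injective fA c0 dMs GE gG GG dG).
- exact: X_coord_continuous.
- exact: X_coord_smooth.
- exact: eO.
- exact: stable_nonzero_uncoord.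
- by case=> w x; exact: smooth_near_uncoord.
- exact: domain_assemble_param.
Qed.

Lemma domain_diffeomorphic : diffeomorphic (orbit_space Gamma Om)
  (prod_space (coset_space Gamma G) X).
Proof.
exists domain_trivialize, domain_assemble; split.
- exact: domain_trivializeK.
- exact: domain_assembleK.
- exact: domain_trivialize_smooth.
- exact: domain_assemble_smooth.
Qed.
End Diffeomorphism.

(** * Reduction to the block-diagonal case *)

Section Reduction.
Context {R : realType}.
Local Notation C := R[i].

Lemma linear_flow_conj n (A : R -> 'M[R]_n) M (S : 'M[R]_n) : S \in unitmx ->
  linear_flow A M -> linear_flow (fun t => invmx S *m A t *m S) (invmx S *m M *m S).
Proof.
move=> Su fA; have [AD A0 As dA] := fA; split.
- by move=> s t; rewrite AD !mulmxA mulmxK.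
- by rewrite A0 mulmx1 mulVmx.
- move=> t; apply: smooth_near_mulmx; last exact: smooth_near_cst.
  by apply: smooth_near_mulmx; first exact: smooth_near_cst.
- have d0 := smooth_near_differentiable (As 0).
  have sA : smooth_near (0 : R) (fun t => invmx S *m A t).
    by apply: smooth_near_mulmx; first exact: smooth_near_cst.
  have := derive_lin (L := mulmxr S) (1 : R) (@mulmxr_continuous R n n n S)
    (smooth_near_differentiable sA).
  move=> /= ->; congr (_ *m _).
  have := derive_lin (L := mulmx (invmx S)) (1 : R) (@mulmxl_continuous R n n n (invmx S)) d0.
  by move=> /= ->; rewrite dA.
Qed.

Lemma im_proj_neq0 N (Es Eu : {vspace 'cV[R]_N}) (z : 'cV[C]_N) :
  (Es + Eu = fullv)%VS -> (Es :&: Eu = 0)%VS ->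
  (im_proj Es Eu z != 0) = (map_mx (@complex.Im R) z \notin Eu).
Proof.
move=> sE cE; rewrite /im_proj; set v := map_mx _ z; congr negb.
have vE : daddv_pi Es Eu v + daddv_pi Eu Es v = v.
  by apply: daddv_pi_add => //; rewrite sE memvf.
apply/eqP/idP => [v0|vEu]; first by rewrite -vE v0 add0r memv_pi.
have : daddv_pi Eu Es v = v by apply: daddv_pi_id => //; rewrite capvC.
by move=> E; move: vE; rewrite E -[v in RHS]add0r => /addIr.
Qed.

Lemma cmx_mul_of_reim m n k (Y : 'M[R]_(m, n)) (z : 'M[R]_(n, k) * 'M[R]_(n, k)) :
  cmx Y *m of_reim z = of_reim (Y *m z.1, Y *m z.2).
Proof.
apply/matrixP => i j; rewrite !mxE.
rewrite (eq_bigr (fun l => Complex (Y i l * z.1 l j) (Y i l * z.2 l j))).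
  apply/eqP; rewrite eq_complex /= (raddf_sum (@complex.Re R)) (raddf_sum (@complex.Im R)).
  by rewrite !eqxx.
by move=> l _; rewrite !mxE; apply/eqP; rewrite eq_complex /= !mul0r subr0 addr0 !eqxx.
Qed.

(** The adapted basis [S] acts linearly on the chart and is absorbed in [sigma']. Group and domain
    remain the same sets, with [(b, t)] replaced by [(invmx S *m b, t)]. The last clause lets a
    trivial unstable block be treated as zero without rewriting the dimension. *)
Lemma block_normal_form p q (A : R -> GL R (p + q)) (M : 'M[R]_(p + q))
    (sigma : GL C (p + q + 1)) (Es Eu : {vspace 'cV[R]_(p + q)}) :
  linear_flow (fun t => val (A t)) M -> \dim Es = p -> spectral_splitting M Es Eu ->
  exists (A' : R -> GL R (p + q)) (Ms : 'M[R]_p) (Mu : 'M[R]_q) (c : R)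
         (sigma' : GL C (p + q + 1)),
    [/\ linear_flow (fun t => val (A' t)) (block_mx Ms 0 0 Mu), 0 < c,
        (forall x, rdotmx x (Ms *m x) <= - c * rdotmx x x) /\
        (forall y, c * rdotmx y y <= rdotmx y (Mu *m y)),
        forall g, (exists w, g = theta A sigma w) <-> (exists w, g = theta A' sigma' w) &
        (forall x, Omega sigma Es Eu x <->
           exists2 z, usubmx z.2 != 0 & x = chart_point sigma' z) /\
        (Eu = 0%VS -> forall y : 'cV[R]_q, y = 0)].
Proof.
move=> fA dE sE; have [S [Ms [Mu [c [Su c0 MS [dMs dMu] EuE]]]]] := spectral_basis dE sE.
have uA' t : GL R (p + q) (invmx S *m val (A t) *m S).
  by rewrite /GL /= !unitmx_mul unitmx_inv Su gl_unit.
pose A' t := gl_of (uA' t).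
have uT : GL C (p + q + 1) (block_mx (cmx S) 0 0 1%:M).
  by rewrite /GL /= unitmxE det_ublock det1 mulr1 -unitmxE map_unitmx.
pose sigma' := gl_mul sigma (gl_of uT).
have SK (x : 'cV[R]_(p + q)) : S *m (invmx S *m x) = x by rewrite mulKVmx.
have thetaE w : theta A' sigma' w = theta A sigma (S *m w.1, w.2).
  rewrite /theta; congr pgl_class; apply: gl_val_inj; rewrite [LHS]/= [RHS]/=.
  rewrite (invmxM (gl_unit sigma) uT) -!mulmxA; congr (_ *m _).
  rewrite [LHS]mulmxA [LHS]mulmxA; congr (_ *m _).
  apply: (canLR (mulmxK uT)).
  rewrite !mulmx_block !mulmx0 !mul0mx !mulmx1 !addr0 !add0r -!cmxM.
  by rewrite !mulmxA mulmxV // mul1mx.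
have pointE' z : chart_point sigma' z = chart_point sigma (S *m z.1, S *m z.2).
  apply/proj_ofP; exists 1; rewrite ?oner_neq0 // scale1r [val sigma']/= -mulmxA.
  congr (_ *m _); rewrite mul_block_col !mul0mx !mulmx1 addr0 add0r; congr col_mx.
  by rewrite cmx_mul_of_reim.
exists A', Ms, Mu, c, sigma'; split=> //.
- have := linear_flow_conj Su fA.
  by rewrite -mulmxA MS mulKmx.
- move=> g; split=> [[[b t] ->]|[w ->]]; last by rewrite thetaE; eexists.
  by exists (invmx S *m b, t); rewrite thetaE /= SK.
split=> [x|Eu0 y].
  have [[sE1 sE2] _ _ _ _] := sE.
  split=> [[z]|[z z0 ->]].
    rewrite /= im_proj_neq0 // EuE -pointE => z0 <-.
    exists (invmx S *m (reim z).1, invmx S *m (reim z).2) => //.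
    by rewrite pointE' /= !SK.
  exists (of_reim (S *m z.1, S *m z.2)).
    by rewrite /= im_proj_neq0 // EuE [map_mx _ _](congr1 snd (of_reimK _)) mulKmx.
  by rewrite -pointE of_reimK pointE'.
have : S *m col_mx 0 y \in Eu by rewrite EuE mulKmx // col_mxKu.
rewrite Eu0 memv0 => /eqP E; have : col_mx 0 y = 0 :> 'cV[R]_(p + q).
  by rewrite -[LHS](mulKmx Su) E mulmx0.
by rewrite -col_mx0 => /eq_col_mx[].
Qed.

(** When [Eu] is zero the second block carries only the zero vector, so dissipativity of [Ms] is
    that of the whole generator. The dimension is given by an equation, so that the same [N] can be
    split in different ways. *)
Lemma contracting_half_no_lattice N p q (A : R -> GL R N) (M : 'M[R]_N)
    (sigma : GL C (N + 1)) (G Gamma : set (PGL R (N + 1)))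
    (Es Eu : {vspace 'cV[R]_N}) : N = (p.+1 + q)%N ->
  linear_flow (fun t => val (A t)) M ->
  (forall g, G g <-> exists w, g = theta A sigma w) -> lattice Gamma G ->
  \dim Es = p.+1 -> Eu = 0%VS -> spectral_splitting M Es Eu -> False.
Proof.
move=> NE fA GE [GG gG dG fG] dE Eu0 sE; subst N.
have [A' [Ms [Mu [c [sigma' [fA' c0 [dMs dMu] GE' [_ q0]]]]]]] :=
  block_normal_form sigma fA dE sE.
have GE2 g : G g <-> exists w, g = theta A' sigma' w.
  by apply: iff_trans (GE g) (GE' g).
apply: (contracting_no_lattice fA' c0 dMs GE2 gG GG dG fG) => x.
rewrite -[x]vsubmxK (q0 Eu0 (dsubmx x)) mul_block_col !mulmx0 !mul0mx !addr0.
have col0 (y z : 'cV[R]_p.+1) :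
    rdotmx (col_mx y (0 : 'cV[R]_q)) (col_mx z 0) = rdotmx y z.
  rewrite /rdotmx big_split_ord /= [X in _ + X]big1 ?addr0.
    by apply: eq_bigr => i _; rewrite !col_mxEu.
  by move=> i _; rewrite !col_mxEd mxE mul0r.
by rewrite !col0.
Qed.

Lemma half_domain N p q (A : R -> GL R N) (M : 'M[R]_N)
    (sigma : GL C (N + 1)) (G Gamma : set (PGL R (N + 1)))
    (Es Eu : {vspace 'cV[R]_N}) : N = (p.+1 + q)%N ->
  linear_flow (fun t => val (A t)) M ->
  (forall g, G g <-> exists w, g = theta A sigma w) -> lattice Gamma G ->
  \dim Es = p.+1 -> spectral_splitting M Es Eu ->
  [/\ maximal_discontinuity_domain Gamma (Omega sigma Es Eu),
      smooth_manifold (orbit_space Gamma (Omega sigma Es Eu)) &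
      diffeomorphic (orbit_space Gamma (Omega sigma Es Eu))
        (prod_space (coset_space Gamma G) (prod_space (sphere R p) (euclidean R q)))].
Proof.
move=> NE fA GE [GG gG dG fG] dE sE; subst N.
have [A' [Ms [Mu [c [sigma' [fA' c0 [dMs dMu] GE' [OmE _]]]]]]] :=
  block_normal_form sigma fA dE sE.
have GE2 g : G g <-> exists w, g = theta A' sigma' w.
  by apply: iff_trans (GE g) (GE' g).
have D := domain_diffeomorphic fA' c0 dMs GE2 gG GG dG OmE.
split; first exact: (Omega_maximal fA' c0 dMs dMu GE2 gG GG dG fG OmE).
- apply: diffeomorphic_manifold D _; apply: prod_manifold.
    exact: (coset_manifold fA' c0 dMs GE2 gG GG dG).
  by apply: prod_manifold; [exact: sphere_manifold|exact: euclidean_manifold].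
- exact: D.
Qed.

Lemma theta_opp N (A : R -> GL R N) (sigma : GL C (N + 1)) w :
  theta (fun t => A (- t)) sigma w = theta A sigma (w.1, - w.2).
Proof. by congr pgl_class; apply: gl_val_inj. Qed.

Lemma spectral_splitting_opp N (M : 'M[R]_N) Es Eu :
  spectral_splitting M Es Eu -> spectral_splitting (- M) Eu Es.
Proof.
move=> [[s1 s2] iS iU eS eU]; split.
- by rewrite addvC capvC.
- by move=> v /iU; rewrite mulNmx rpredN.
- by move=> v /iS; rewrite mulNmx rpredN.
- move=> c [w [w0 wr wi E]]; rewrite -oppr_gt0 -raddfN; apply: eU.
  by exists w; split=> //; rewrite scaleNr -E /cmx map_mxN mulNmx opprK.
- move=> c [w [w0 wr wi E]]; rewrite -oppr_lt0 -raddfN; apply: eS.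
  by exists w; split=> //; rewrite scaleNr -E /cmx map_mxN mulNmx opprK.
Qed.

(** The sphere has dimension one less than [Es], so [Es] must be nonzero. If it were zero, the
    reversed flow would contract everything, and there would be no lattice. *)
Lemma half_domain_all N (A : R -> GL R N) (M : 'M[R]_N)
    (sigma : GL C (N + 1)) (G Gamma : set (PGL R (N + 1)))
    (Es Eu : {vspace 'cV[R]_N}) : (0 < N)%N ->
  linear_flow (fun t => val (A t)) M ->
  (forall g, G g <-> exists w, g = theta A sigma w) -> lattice Gamma G ->
  spectral_splitting M Es Eu -> exists p q,
  [/\ maximal_discontinuity_domain Gamma (Omega sigma Es Eu),
      smooth_manifold (orbit_space Gamma (Omega sigma Es Eu)) &
      diffeomorphic (orbit_space Gamma (Omega sigma Es Eu))
        (prod_space (coset_space Gamma G) (prod_space (sphere R p) (euclidean R q)))].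
Proof.
move=> N0 fA GE lat sE.
have fAo := flow_opp fA.
have GEo g : G g <-> exists w, g = theta (fun t => A (- t)) sigma w.
  apply: (iff_trans (GE g)); split=> -[w ->].
    by exists (w.1, - w.2); rewrite theta_opp /= opprK -surjective_pairing.
  by exists (w.1, - w.2); rewrite theta_opp.
have [[s1 s2] _ _ _ _] := sE.
have dimN : (\dim Es + \dim Eu = N)%N.
  by rewrite -(dimv_disjoint_sum s2) s1 dimvf /dim /= muln1.
have [d0|d0] := posnP (\dim Es).
  have Es0 : Es = 0%VS by apply/eqP; rewrite -dimv_eq0 d0.
  case: (@contracting_half_no_lattice N N.-1 0 _ _ sigma G Gamma Eu Es _ fAo GEo lat _ Es0
    (spectral_splitting_opp sE)).
    by rewrite addn0 prednK.
  by rewrite prednK //; move: dimN; rewrite d0.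
exists (\dim Es).-1, (\dim Eu).
by apply: (half_domain _ fA GE lat _ sE); rewrite prednK.
Qed.
End Reduction.

Theorem corollary1p2 (R : realType) (N : nat) (A : R -> GL R N)
    (A_hom : forall s t, A (s + t) = gl_mul (A s) (A t))
    (A_smooth : forall t : R, smooth_near t (fun s : R => val (A s)))
    (A_faithful : injective A)
    (A_closed : closed (range A))
    (A_hyperbolic : forall (t : R) (c : R[i]), t != 0 ->
       eigenvalue (cmx (val (A t))) c -> `|c| != 1)
    (G : set (PGL R (N + 1))) (G_lie : lie_subgroup G)
    (Gt : set (GL R[i] (N + 1))) (Gt_group : gl_subgroup Gt)
    (Gt_lift : [set pgl_class g | g in Gt] = G)
    (sigma : GL R[i] (N + 1))
    (Gt_conj : [set gl_mul (gl_inv sigma) (gl_mul g sigma) | g in Gt] =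
               [set rho A p.1 p.2 | p in [set: 'cV[R]_N * R]])
    (Gamma : set (PGL R (N + 1))) (Gamma_lattice : lattice Gamma G)
    (Es Eu : {vspace 'cV[R]_N})
    (Es_Eu : spectral_splitting (generator A) Es Eu) :
  forall Om : set (projective R (N + 1)),
    Om = Omega sigma Es Eu \/ Om = Omega sigma Eu Es ->
    [/\ maximal_discontinuity_domain Gamma Om,
        smooth_manifold (orbit_space Gamma Om) &
        exists X : smooth_space R,
          [/\ smooth_manifold X,
              exists p q, diffeomorphic X
                (prod_space (sphere R p) (euclidean R q)) &
              diffeomorphic (orbit_space Gamma Om)
                (prod_space (coset_space Gamma G) X)]].
Proof.
move=> Om OmE.
have A0 : val (A 0) = 1%:M.
  have := A_hom 0 0; rewrite addr0 => /(congr1 val) /= E.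
  by rewrite -[LHS](mulKmx (gl_unit (A 0))) -E mulVmx // gl_unit.
have fA : linear_flow (fun t => val (A t)) (generator A).
  split; [by move=> s t; rewrite A_hom|exact: A0|exact: A_smooth|].
  by rewrite /generator derive1E.
(* In dimension 0 all matrices are equal, contrary to faithfulness. *)
have N0 : (0 < N)%N.
  rewrite lt0n; apply/eqP => N0; have : A 0 = A 1.
    apply: val_inj; apply/matrixP => i; exfalso; move: (ltn_ord i).
    by rewrite [X in (_ < X)%N]N0.
  by move/A_faithful/eqP; rewrite eq_sym oner_eq0.
(* Conjugating the lift back by [sigma] and projecting describes [G] as the image of [theta]. *)
have GE g : G g <-> exists w, g = theta A sigma w.
  have conjP h w : gl_mul (gl_inv sigma) (gl_mul h sigma) = rho A w.1 w.2 <->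
      h = theta_lift A sigma w.
    split=> [/(congr1 val) /= E|->]; apply: gl_val_inj; rewrite /=.
      by rewrite -E !mulmxA mulmxV ?gl_unit // mul1mx mulmxK // gl_unit.
    by rewrite -!mulmxA mulVmx ?gl_unit // mulmx1 mulKmx // gl_unit.
  rewrite -Gt_lift; split=> [[h Gh <-]|[w ->]].
    have : [set gl_mul (gl_inv sigma) (gl_mul g sigma) | g in Gt]
      (gl_mul (gl_inv sigma) (gl_mul h sigma)) by exists h.
    by rewrite Gt_conj => -[w _ /esym/conjP ->]; exists w.
  have : [set rho A p.1 p.2 | p in [set: 'cV[R]_N * R]] (rho A w.1 w.2) by exists w.
  by rewrite -Gt_conj => -[h Gh /conjP E]; exists h => //; rewrite E.
suff [p [q [H1 H2 H3]]] : exists p q,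
    [/\ maximal_discontinuity_domain Gamma Om, smooth_manifold (orbit_space Gamma Om) &
      diffeomorphic (orbit_space Gamma Om)
        (prod_space (coset_space Gamma G) (prod_space (sphere R p) (euclidean R q)))].
  split=> //; exists (prod_space (sphere R p) (euclidean R q)); split=> //.
    by apply: prod_manifold; [exact: sphere_manifold|exact: euclidean_manifold].
  exists p, q, id, id; split=> //.
    by split=> [x|x g //]; exact: cvg_id.
  by split=> [x|x g //]; exact: cvg_id.
case: OmE => ->; first exact: (half_domain_all N0 fA GE Gamma_lattice Es_Eu).
(* Time reversal exchanges [Es] and [Eu] and leaves the group unchanged. *)
have GEo g : G g <-> exists w, g = theta (fun t => A (- t)) sigma w.
  apply: (iff_trans (GE g)); split=> -[w ->].
    by exists (w.1, - w.2); rewrite theta_opp /= opprK -surjective_pairing.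
  by exists (w.1, - w.2); rewrite theta_opp.
exact: (half_domain_all N0 (flow_opp fA) GEo Gamma_lattice
  (spectral_splitting_opp Es_Eu)).
Qed.
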